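(* If $(\mathcal M,X)$ is a hyperfinite tracially complete $C^*$-algebra such that $\mathcal M$ is $\|\cdot\|_{2,X}$-separable, then $(\mathcal M,X)$ is (isomorphic to) an inductive limit of a sequence of tracially complete $C^*$-algebras $(\mathcal M_n,X_n)_{n=1}^\infty$ such that each $\mathcal M_n$ is finite dimensional.
   Context: A trace means a tracial state; $T(A)$ is the set of traces on $A$ with the weak$^*$ topology, and $\|a\|_{2,X}=\sup_{\tau\in X}\tau(a^*a)^{1/2}$ for $X\subseteq T(A)$. A tracially complete $C^*$-algebra is a pair $(\mathcal M,X)$ where $\mathcal M$ is a $C^*$-algebra and $X\subseteq T(\mathcal M)$ is compact and convex such that $\|\cdot\|_{2,X}$ is a norm and the operator-norm closed unit ball of $\mathcal M$ is $\|\cdot\|_{2,X}$-complete. A morphism $\phi\colon(\mathcal M,X)\to(\mathcal N,Y)$ is a $^*$-homomorphism with $\tau\circ\phi\in X$ for all $\tau\in Y$; isomorphisms are invertible morphisms. $(\mathcal M,X)$ is hyperfinite if for every finite $\mathcal F\subseteq\mathcal M$ and $\epsilon>0$ there is a finite dimensional $C^*$-subalgebra $F\subseteq\mathcal M$ such that for every $a\in\mathcal F$ there is $b\in F$ with $\|a-b\|_{2,X}<\epsilon$. Inductive limits: given morphisms $\phi_n^{n+1}\colon(\mathcal M_n,X_n)\to(\mathcal M_{n+1},X_{n+1})$, $n\ge1$, let $A$ be the $C^*$-inductive limit with canonical maps $\hat\phi_n^\infty\colon\mathcal M_n\to A$ and let $X=\{\tau\in T(A):\tau\circ\hat\phi_n^\infty\in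 X_n\text{ for all }n\}$. The inductive limit is $(\overline A^X,X)$, where $\overline A^X$ is the algebra of norm-bounded $\|\cdot\|_{2,X}$-Cauchy sequences in $A$ modulo norm-bounded $\|\cdot\|_{2,X}$-null sequences, and $\tau\in X$ is identified with the trace $(a_n)\mapsto\lim\tau(a_n)$. (This is the inductive limit in the category of tracially complete $C^*$-algebras.) *)

(* Defs.v *)
From HB Require Import structures.
From mathcomp Require Import all_boot all_order all_algebra.
From mathcomp Require Import complex.
From mathcomp Require Import all_classical all_reals all_analysis.

Set Implicit Arguments.
Unset Strict Implicit.
Unset Printing Implicit Defensive.

Import Order.TTheory GRing.Theory Num.Theory.
Import numFieldNormedType.Exports.

Local Open Scope classical_set_scope.
Local Open Scope ring_scope.
Local Open Scope complex_scope.

(* C*-algebras are not assumed unital, and the zero algebra is allowed; the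
   norm takes values in R[i], as for any normed module over R[i]. *)
HB.mixin Record isCStarAlgebra (R : realType) A
    of CompleteNormedModule R[i] A := {
  cmul : A -> A -> A ;
  star : A -> A ;
  cmulA : associative cmul ;
  cmulDl : left_distributive cmul +%R ;
  cmulDr : right_distributive cmul +%R ;
  cmulZl : forall (c : R[i]) (a b : A), cmul (c *: a) b = c *: cmul a b ;
  cmulZr : forall (c : R[i]) (a b : A), cmul a (c *: b) = c *: cmul a b ;
  starK : involutive star ;
  starD : forall a b : A, star (a + b) = star a + star b ;
  starZ : forall (c : R[i]) (a : A), star (c *: a) = c^* *: star a ;
  starM : forall a b : A, star (cmul a b) = cmul (star b) (star a) ;
  cnormM : forall a b : A, `|cmul a b| <= `|a| * `|b| ;
  cstar_identity : forall a : A, `|cmul (star a) a| = `|a| ^+ 2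
}.

#[short(type="cstarType")]
HB.structure Definition CStarAlgebra (R : realType) :=
  {A of isCStarAlgebra R A & CompleteNormedModule R[i] A}.

Notation "a ** b" := (cmul a b) (at level 40, left associativity) : ring_scope.

Section CStar.
Variable R : realType.
Implicit Types A B : cstarType R.

Definition rnorm A (a : A) : R := complex.Re `|a|.

Definition finite_dimensional A : Prop :=
  exists s : seq A, forall a : A,
    exists c : 'I_(size s) -> R[i], a = \sum_(i < size s) c i *: s`_i.

Record fd_cstar_subalgebra A (F : set A) : Prop := {
  fds0 : F 0 ;
  fdsD : forall a b, F a -> F b -> F (a + b) ;
  fdsZ : forall (c : R[i]) a, F a -> F (c *: a) ;
  fdsM : forall a b, F a -> F b -> F (a ** b) ;
  fds_star : forall a, F a -> F (star a) ;
  fds_closed : closed F ;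
  fds_span : exists s : seq A, forall a, F a ->
    exists c : 'I_(size s) -> R[i], a = \sum_(i < size s) c i *: s`_i
}.

Record star_hom A B (f : A -> B) : Prop := {
  star_homD : forall a b, f (a + b) = f a + f b ;
  star_homZ : forall (c : R[i]) a, f (c *: a) = c *: f a ;
  star_homM : forall a b, f (a ** b) = f a ** f b ;
  star_hom_star : forall a, f (star a) = star (f a)
}.

(* An unbounded functional is excluded by [trace_norm1], since [sup] is then
   0 by convention. *)
Record is_trace A (tau : A -> R[i]) : Prop := {
  traceD : forall a b, tau (a + b) = tau a + tau b ;
  traceZ : forall (c : R[i]) a, tau (c *: a) = c * tau a ;
  trace_ge0 : forall a, 0 <= tau (star a ** a) ;
  trace_norm1 : sup [set complex.Re `|tau a| | a in [set a : A | `|a| <= 1]] = 1 ;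
  trace_mulC : forall a b, tau (a ** b) = tau (b ** a)
}.

(* [norm2 set0] is constantly 0. *)
Definition norm2 A (X : set (A -> R[i])) (a : A) : R :=
  sup [set Num.sqrt (complex.Re (tau (star a ** a))) | tau in X].

Definition norm2_is_norm A (X : set (A -> R[i])) : Prop :=
  [/\ forall a b, norm2 X (a + b) <= norm2 X a + norm2 X b,
      forall (c : R[i]) a, norm2 X (c *: a) = complex.Re `|c| * norm2 X a
    & forall a, norm2 X a = 0 -> a = 0].

Definition norm2_cauchy A (X : set (A -> R[i])) (u : nat -> A) : Prop :=
  forall e : R, 0 < e -> exists N : nat, forall m n : nat,
    (N <= m)%N -> (N <= n)%N -> norm2 X (u m - u n) < e.

Definition norm2_cvg A (X : set (A -> R[i])) (u : nat -> A) (a : A) : Prop :=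
  norm2 X (u n - a) @[n --> \oo] --> (0 : R).

(* The weak* topology is the one induced by the topology of pointwise
   convergence on all functions [A -> R[i]]. *)
Record tracially_complete A (X : set (A -> R[i])) : Prop := {
  tc_trace : forall tau, X tau -> is_trace tau ;
  tc_compact : compact (X : set {ptws A -> R[i]^o}) ;
  tc_convex : forall (t : R) sigma tau, 0 <= t <= 1 -> X sigma -> X tau ->
    X (fun a => t%:C * sigma a + (1 - t)%:C * tau a) ;
  tc_norm : norm2_is_norm X ;
  tc_ball_complete : forall u : nat -> A,
    (forall n, rnorm (u n) <= 1) -> norm2_cauchy X u ->
    exists2 a, rnorm a <= 1 & norm2_cvg X u a
}.

End CStar.

Record tcAlgebra (R : realType) := TcAlgebra {
  tc_alg :> cstarType R ;
  tc_traces : set (tc_alg -> R[i]) ;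
  tcP : tracially_complete tc_traces
}.

Section TraciallyComplete.
Variable R : realType.
Implicit Types M N : tcAlgebra R.

Definition tc_morphism M N (f : M -> N) : Prop :=
  star_hom f /\ forall tau, tc_traces (t:=N) tau -> tc_traces (t:=M) (tau \o f).

Definition tc_isomorphic M N : Prop :=
  exists f : M -> N, exists g : N -> M,
    [/\ tc_morphism f, tc_morphism g, cancel f g & cancel g f].

Definition hyperfinite M : Prop :=
  forall (s : seq M) (e : R), 0 < e ->
    exists2 F : set M, fd_cstar_subalgebra F &
      forall a, a \in s -> exists2 b, F b & norm2 (@tc_traces R M) (a - b) < e.

Definition norm2_separable M : Prop :=
  exists2 D : set M, countable D &
    forall (a : M) (e : R), 0 < e ->
      exists2 b, D b & norm2 (@tc_traces R M) (a - b) < e.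

End TraciallyComplete.

Section InductiveLimit.
Variables (R : realType) (M : nat -> tcAlgebra R).
Variable phi : forall n : nat, M n -> M n.+1.

Fixpoint phi_iter (n k : nat) (a : M n) : M (k + n)%N :=
  match k with
  | 0%N => a
  | k'.+1 => phi (phi_iter k' a)
  end.

(* A, with the maps [phihat n], is the Hausdorff completion of the algebraic
   direct limit of the [M n] for the seminorm [a |-> lim_m `|phi_n^m a|]. *)
Record cstar_limit (A : cstarType R) (phihat : forall n, M n -> A) : Prop := {
  cl_hom : forall n, star_hom (phihat n) ;
  cl_compat : forall n (a : M n), phihat n.+1 (phi a) = phihat n a ;
  cl_norm : forall n (a : M n),
    rnorm (phi_iter k a) @[k --> \oo] --> rnorm (phihat n a) ;
  cl_dense : closure (\bigcup_n range (phihat n)) = setT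
}.

Definition limit_traces (A : cstarType R) (phihat : forall n, M n -> A) :
    set (A -> R[i]) :=
  [set tau | is_trace tau /\ forall n, tc_traces (t:=M n) (tau \o phihat n)].

End InductiveLimit.

Section TracialCompletion.
Variables (R : realType) (A : cstarType R) (X : set (A -> R[i])).

Definition bounded_cauchy (u : nat -> A) : Prop :=
  (exists C : R, forall n, rnorm (u n) <= C) /\ norm2_cauchy X u.

(* [q] presents L as the quotient of the *-algebra of norm-bounded
   [norm2 X]-Cauchy sequences by the ideal of null sequences, and the traces
   of L are the [(a_n) |-> lim tau a_n] for [tau] in X.  The values of [q]
   outside [bounded_cauchy] are irrelevant.  The norm of L is not mentioned as
   a *-algebra has at most one complete C*-norm. *)
Record tracial_completion (L : tcAlgebra R) (q : (nat -> A) -> L) : Prop := {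
  tcpD : forall u v, bounded_cauchy u -> bounded_cauchy v ->
    q (fun n => u n + v n) = q u + q v ;
  tcpZ : forall (c : R[i]) u, bounded_cauchy u ->
    q (fun n => c *: u n) = c *: q u ;
  tcpM : forall u v, bounded_cauchy u -> bounded_cauchy v ->
    q (fun n => u n ** v n) = q u ** q v ;
  tcp_star : forall u, bounded_cauchy u -> q (fun n => star (u n)) = star (q u) ;
  tcp_surj : forall b : L, exists2 u, bounded_cauchy u & q u = b ;
  tcp_ker : forall u, bounded_cauchy u -> (q u = 0 <-> norm2_cvg X u 0) ;
  tcp_traces : tc_traces (t:=L) =
    [set sigma | exists2 tau, X tau & forall u, bounded_cauchy u ->
       (tau (u n) : R[i]^o) @[n --> \oo] --> (sigma (q u) : R[i]^o)]
}.

End TracialCompletion.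

Definition tc_inductive_limit (R : realType) (M : nat -> tcAlgebra R)
    (phi : forall n, M n -> M n.+1) (L : tcAlgebra R) : Prop :=
  exists (A : cstarType R) (phihat : forall n, M n -> A)
         (q : (nat -> A) -> L),
    cstar_limit phi phihat /\ tracial_completion (limit_traces phihat) q.

(* Main.v *)
Require Import Defs.
From HB Require Import structures.
From mathcomp Require Import all_boot all_order all_algebra.
From mathcomp Require Import complex.
From mathcomp Require Import all_classical all_reals all_analysis.
From mathcomp Require Import ring lra zify.

(* Fix a finite dimensional subalgebra F of M, given by matrix units. Hyperfiniteness puts
   elements close to these units in the uniform 2-norm into another finite dimensional subalgebra
   F', and a perturbation argument inside F' turns them into exact matrix units. They need not have
   the same unit as F: an embedding F -> F' close to the inclusion exists only after cutting off a
   corner that is small in the 2-norm. Iterating along a dense sequence gives an approximate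
   intertwining F_0 -> F_1 -> ... whose limit homomorphisms psi_n : F_n -> M have increasing images
   with dense union; adding the complement of the unit of psi_n(F_n) to psi_n(F_n) then gives an
   increasing sequence G_n of unital finite dimensional subalgebras of M. The limit of the G_n, with
   the traces restricted from M, is (M, X): a trace on the norm closure of the union which extends to
   an element of X from each G_n extends to an element of X by compactness, and every element of M
   is the 2-norm limit of a norm-bounded sequence in the union.
   No continuous functional calculus in M itself is needed. In finite dimensional subalgebras it
   comes from polynomials; norms of self-adjoint elements are estimated by repeated squaring; and
   truncating the spectrum replaces the Kaplansky density theorem. The unit of M, needed because
   restricted traces must have norm 1, is the 2-norm limit of the units of finite dimensional
   subalgebras. That these are large in all traces uses the compactness of X, and the 2-norm
   continuity of traces, for which approximate units are built from Cesaro means of the powers of a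
   Cayley transform. *)

Set Implicit Arguments.
Unset Strict Implicit.
Unset Printing Implicit Defensive.

Import Order.TTheory GRing.Theory Num.Theory.
Import numFieldNormedType.Exports.

Local Open Scope classical_set_scope.
Local Open Scope ring_scope.
Local Open Scope complex_scope.

(** A homomorphism between finite dimensional subalgebras that is close to the inclusion need not
    respect X, so it comes without a bound in the uniform 2-norm. The estimates therefore compare
    2-norm errors with operator norms, in the form N(phi(x) - x) <= ||x|| / 2^n, and contractivity
    in the operator norm keeps these errors summable. Similarly, elements supplied by
    hyperfiniteness are close only in the 2-norm and are truncated before use, since products are
    2-norm continuous only on norm-bounded sets. The perturbation of matrix units runs along a
    sequence of subalgebras whose errors tend to 0, so that no explicit tolerances have to be
    carried through the induction. What it would give, such as |tau(x^* c x)| <= ||c|| tau(x^* x) or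
    the contractivity of homomorphisms, starts from a crude bound with a constant, is applied to the
    powers of exponent 2^k, and loses the constant under 2^k-th roots. As long as no unit is known,
    expressions like 1 - p, (1 + m)^k or a polynomial in h are replaced by their action on elements
    or by their difference from 1. *)

Definition cabs (R : realType) (c : R[i]) : R := complex.Re `|c|.

(** * Real-valued moduli of complex numbers *)

Section Scalars.
Variable R : realType.
Implicit Types c : R[i].

Lemma eq_le_num (x y : R) : x = y -> x <= y.
Proof. by move=> ->. Qed.

Lemma cabsE c : `|c| = (cabs c)%:C.
Proof. by rewrite /cabs normc_def. Qed.

Lemma cabs_ge0 c : 0 <= cabs c.
Proof. by rewrite -ler0c -cabsE normr_ge0. Qed.

Lemma cabsM c d : cabs (c * d) = cabs c * cabs d.
Proof. by apply: (@complexI R); rewrite rmorphM -!cabsE normrM. Qed.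

Lemma cabsD c d : cabs (c + d) <= cabs c + cabs d.
Proof. by rewrite -lecR rmorphD -!cabsE ler_normD. Qed.

Lemma cabsN c : cabs (- c) = cabs c.
Proof. by rewrite /cabs normrN. Qed.


Lemma cabsR (x : R) : cabs x%:C = `|x|.
Proof. by rewrite /cabs normc_def /= expr0n /= addr0 sqrtr_sqr. Qed.

Lemma cabs0 : cabs (0 : R[i]) = 0.
Proof. by rewrite /cabs normr0. Qed.

Lemma cabs1 : cabs (1 : R[i]) = 1.
Proof. by rewrite /cabs normr1. Qed.

Lemma cabsi : cabs ('i%C : R[i]) = 1.
Proof. by rewrite /cabs normc_def /= expr0n add0r expr1n sqrtr1. Qed.

Lemma cabs_eq0 c : cabs c = 0 -> c = 0.
Proof. by move=> c0; apply/normr0_eq0; rewrite cabsE c0. Qed.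

Lemma Re_le_cabs c : `|complex.Re c| <= cabs c.
Proof. by rewrite -lecR -cabsE normc_ge_Re. Qed.


Lemma ReD c d : complex.Re (c + d) = complex.Re c + complex.Re d.
Proof. by case: c; case: d. Qed.
Lemma ReN c : complex.Re (- c) = - complex.Re c.
Proof. by case: c. Qed.
Lemma ReRM (x : R) c : complex.Re (x%:C * c) = x * complex.Re c.
Proof. by case: c => a b /=; rewrite mul0r subr0. Qed.
Lemma Re_conjc c : complex.Re (conjc c) = complex.Re c.
Proof. by case: c. Qed.
Lemma conjci : conjc 'i%C = - 'i%C :> R[i].
Proof. by apply/eqP; rewrite eq_complex /= oppr0 !eqxx. Qed.
Lemma conjcN c : conjc (- c) = - conjc c.
Proof. exact: rmorphN. Qed.
Lemma conjcD c d : conjc (c + d) = conjc c + conjc d.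
Proof. exact: rmorphD. Qed.
Lemma conjcM c d : conjc (c * d) = conjc c * conjc d.
Proof. exact: rmorphM. Qed.
Lemma mulii : 'i%C * 'i%C = -1 :> R[i].
Proof. by rewrite -expr2 sqr_i. Qed.
Lemma conjcR (x : R) : conjc x%:C = x%:C.
Proof. by rewrite /= oppr0. Qed.

(** Taking 2^k-th roots, the constant C tends to 1. Instead of roots, Bernoulli's inequality for t /
    K = 1 + x makes the powers unbounded when x > 0. Every repeated squaring below ends here. *)
Lemma le_of_pow2 (t C K : R) : 0 <= t -> 0 <= K ->
  (forall k : nat, t ^+ (2 ^ k) <= C * K ^+ (2 ^ k)) -> t <= K.
Proof.
move=> t0 K0 H; rewrite leNgt; apply/negP => Kt.
have tpos : 0 < t by apply: le_lt_trans Kt.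
move: K0; rewrite le_eqVlt => /predU1P[K0|K0].
  have := H 0%N; rewrite -K0 expn0 !expr1 mulr0 => /(lt_le_trans tpos).
  by rewrite ltxx.
have C0 : 0 < C.
  by have := lt_le_trans (exprn_gt0 _ tpos) (H 0%N); rewrite pmulr_lgt0 // exprn_gt0.
pose x := t / K - 1.
have x0 : 0 < x by rewrite subr_gt0 ltr_pdivlMr // mul1r.
have H2 n : n%:R * x <= C.
  apply: (@le_trans _ _ ((1 + x) ^+ (2 ^ n))).
    have bern k : 1 + k%:R * x <= (1 + x) ^+ k.
      elim: k => [|k IH]; first by rewrite mul0r addr0.
      rewrite exprS; apply: le_trans (ler_wpM2l _ IH); last by rewrite ltW // addr_gt0.
      rewrite -natr1 -subr_ge0.
      have -> : (1 + x) * (1 + k%:R * x) - (1 + (k%:R + 1) * x) = k%:R * x ^+ 2 by ring.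
      by rewrite mulr_ge0 ?sqr_ge0.
    apply: le_trans (bern _); rewrite -[leLHS]add0r; apply: lerD => //.
    by rewrite ler_pM2r // ler_nat ltnW // ltn_expl.
  rewrite /x addrC subrK expr_div_n ler_pdivrMr ?exprn_gt0 //; exact: H.
have /archi_boundP : 0 <= C / x by rewrite divr_ge0 // ltW.
rewrite ltr_pdivrMr // => /lt_le_trans /(_ (H2 _)); by rewrite ltxx.
Qed.

End Scalars.

(** * Elementary identities and the norm of self-adjoint elements *)

Section StarAlgebra.
Variables (R : realType) (A : cstarType R).
Implicit Types a b : A.

Lemma cmul0r a : 0 ** a = 0.
Proof. by rewrite -[X in X ** _](scale0r (0 : A)) cmulZl scale0r. Qed.
Lemma cmulr0 a : a ** 0 = 0.
Proof. by rewrite -[X in _ ** X](scale0r (0 : A)) cmulZr scale0r. Qed.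
Lemma cmulNr a b : (- a) ** b = - (a ** b).
Proof. by rewrite -scaleN1r cmulZl scaleN1r. Qed.
Lemma cmulrN a b : a ** (- b) = - (a ** b).
Proof. by rewrite -[- b]scaleN1r cmulZr scaleN1r. Qed.
Lemma cmulBl a b c : (a - b) ** c = a ** c - b ** c.
Proof. by rewrite cmulDl cmulNr. Qed.
Lemma cmulBr a b c : c ** (a - b) = c ** a - c ** b.
Proof. by rewrite cmulDr cmulrN. Qed.
Lemma starZ_conjc c a : star (c *: a) = conjc c *: star a.
Proof. exact: starZ. Qed.
Lemma star0 : star (0 : A) = 0.
Proof. by apply: (addrI (star 0)); rewrite -starD !addr0. Qed.
Lemma starN a : star (- a) = - star a.
Proof. by apply: (addrI (star a)); rewrite -starD !subrr star0. Qed.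
Lemma starB a b : star (a - b) = star a - star b.
Proof. by rewrite starD starN. Qed.
Lemma cmul_suml (I : Type) (r : seq I) (P : pred I) (F : I -> A) b :
  (\sum_(i <- r | P i) F i) ** b = \sum_(i <- r | P i) F i ** b.
Proof. exact: (big_morph (fun x => x ** b) (fun x y => cmulDl x y b) (cmul0r b)). Qed.
Lemma cmul_sumr (I : Type) (r : seq I) (P : pred I) (F : I -> A) b :
  b ** (\sum_(i <- r | P i) F i) = \sum_(i <- r | P i) b ** F i.
Proof. exact: (big_morph (fun x => b ** x) (fun x y => cmulDr b x y) (cmulr0 b)). Qed.
Lemma star_sum (I : Type) (r : seq I) (P : pred I) (F : I -> A) :
  star (\sum_(i <- r | P i) F i) = \sum_(i <- r | P i) star (F i).
Proof. exact: (big_morph (@star R A) (@starD R A) star0). Qed.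

Lemma rnormE a : `|a| = (rnorm a)%:C.
Proof. by rewrite /rnorm -[LHS]RRe_real // ger0_real. Qed.
Lemma rnorm_ge0 a : 0 <= rnorm a.
Proof. by rewrite -ler0c -rnormE normr_ge0. Qed.
Lemma rnorm0 : rnorm (0 : A) = 0.
Proof. by rewrite /rnorm normr0. Qed.
Lemma rnorm_eq0 a : rnorm a = 0 -> a = 0.
Proof. by move=> a0; apply/normr0_eq0; rewrite rnormE a0. Qed.
Lemma rnormD a b : rnorm (a + b) <= rnorm a + rnorm b.
Proof. by have := ler_normD a b; rewrite !rnormE -rmorphD lecR. Qed.
Lemma rnormN a : rnorm (- a) = rnorm a.
Proof. by rewrite /rnorm normrN. Qed.
Lemma rnormB a b : rnorm (a - b) <= rnorm a + rnorm b.
Proof. by rewrite -(rnormN b) rnormD. Qed.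
Lemma rnormZ c a : rnorm (c *: a) = cabs c * rnorm a.
Proof. by apply: (@complexI R); have := normrZ c a; rewrite !rnormE cabsE -rmorphM. Qed.
Lemma rnormM a b : rnorm (a ** b) <= rnorm a * rnorm b.
Proof. by have := cnormM a b; rewrite !rnormE -rmorphM lecR. Qed.
Lemma rnorm_cstar a : rnorm (star a ** a) = rnorm a ^+ 2.
Proof. by apply: (@complexI R); have := cstar_identity a; rewrite !rnormE -rmorphXn. Qed.
Lemma rnorm_star a : rnorm (star a) = rnorm a.
Proof.
suff H (b : A) : rnorm b <= rnorm (star b).
  by apply/eqP; rewrite eq_le H andbT -{2}(starK a) H.
have [->|b0] := eqVneq b 0; first by rewrite star0.
have bp : 0 < rnorm b.
  by rewrite lt_def rnorm_ge0 andbT; apply: contraNneq b0 => /rnorm_eq0 ->.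
by rewrite -(ler_pM2r bp) -expr2 -rnorm_cstar rnormM.
Qed.
Lemma rnorm_sum (I : Type) (r : seq I) (P : pred I) (F : I -> A) :
  rnorm (\sum_(i <- r | P i) F i) <= \sum_(i <- r | P i) rnorm (F i).
Proof.
elim/big_ind2 : _ => [|x1 x2 y1 y2 h1 h2|//]; first by rewrite rnorm0.
by apply: le_trans (rnormD _ _) (lerD h1 h2).
Qed.
Lemma star_mul_eq0 a : star a ** a = 0 -> a = 0.
Proof.
move=> h; apply: rnorm_eq0; apply/eqP; rewrite -sqrf_eq0 -rnorm_cstar h.
by rewrite rnorm0.
Qed.

Lemma rnorm_iter_sqr (x : nat -> A) : (forall k, x k.+1 = x k ** x k) ->
  star (x 0%N) = x 0%N -> forall k, star (x k) = x k /\ rnorm (x k) = rnorm (x 0%N) ^+ (2 ^ k).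
Proof.
move=> xS x0; elim=> [|k [IH1 IH2]]; first by rewrite expr1.
rewrite xS starM !IH1; split=> //.
by rewrite -[X in X ** _]IH1 rnorm_cstar IH2 -exprM expnS mulnC.
Qed.

(** The C*-identity gives ||x^2|| = ||x||^2 for self-adjoint x, so a bound on the iterated squares
    with a common factor C gives the bound without it. This plays the part of the spectral radius
    formula. *)
Lemma rnorm_le_iter_sqr (x : nat -> A) (C K : R) : (forall k, x k.+1 = x k ** x k) ->
  star (x 0%N) = x 0%N -> 0 <= K -> (forall k, rnorm (x k) <= C * K ^+ (2 ^ k)) ->
  rnorm (x 0%N) <= K.
Proof.
move=> xS x0 K0 H; apply: (@le_of_pow2 R _ C) => //; first exact: rnorm_ge0.
by move=> k; have [_ <-] := rnorm_iter_sqr xS x0 k.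
Qed.

End StarAlgebra.

(** * Normalisation of expressions in a star-algebra *)

Section Normalise.
Variables (R : realType) (A : cstarType R).

Inductive salg_expr : Type :=
| SVar of nat | SZero | SAdd of salg_expr & salg_expr | SOpp of salg_expr
| SMul of salg_expr & salg_expr | SStar of salg_expr | SScale of R[i] & salg_expr.

Definition letter : Type := (nat * bool)%type.
(* A nonempty word is stored as its first letter and the list of the others. *)
Definition word : Type := (letter * list letter)%type.
Definition mono : Type := (R[i] * word)%type.

(** The operations on lists and letters are defined here so that [salg_compute] unfolds exactly
    these and leaves the arithmetic of the coefficients to [ring]. *)
Fixpoint lst_app (T : Type) (s t : list T) : list T :=
  match s with [::] => t | x :: s' => x :: lst_app s' t end.
Fixpoint lst_map (T U : Type) (f : T -> U) (s : list T) : list U :=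
  match s with [::] => [::] | x :: s' => f x :: lst_map f s' end.
Fixpoint lst_nth (x0 : A) (s : list A) (n : nat) : A :=
  match s, n with [::], _ => x0 | x :: _, 0%N => x | _ :: s', S n' => lst_nth x0 s' n' end.
Fixpoint nat_eqb (m n : nat) : bool :=
  match m, n with 0%N, 0%N => true | S m', S n' => nat_eqb m' n' | _, _ => false end.
Definition letter_eqb (x y : letter) : bool :=
  if nat_eqb x.1 y.1 then (if x.2 then y.2 else (if y.2 then false else true)) else false.
Fixpoint lst_eqb (s t : list letter) : bool :=
  match s, t with
  | [::], [::] => true
  | x :: s', y :: t' => if letter_eqb x y then lst_eqb s' t' else false
  | _, _ => false
  end.
Definition word_eqb (v w : word) : bool :=
  if letter_eqb v.1 w.1 then lst_eqb v.2 w.2 else false.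
Definition word_cat (v w : word) : word := (v.1, lst_app v.2 (w.1 :: w.2)).
Definition flip (x : letter) : letter := (x.1, if x.2 then false else true).
Fixpoint word_star_rec (acc : word) (s : list letter) : word :=
  match s with [::] => acc | x :: s' => word_star_rec (flip x, acc.1 :: acc.2) s' end.
Definition word_star (w : word) : word := word_star_rec (flip w.1, [::]) w.2.

Fixpoint mono_mul (s t : list mono) : list mono :=
  match s with
  | [::] => [::]
  | m :: s' => lst_app (lst_map (fun m' => (m.1 * m'.1, word_cat m.2 m'.2)) t) (mono_mul s' t)
  end.

Fixpoint salg_norm (e : salg_expr) : list mono :=
  match e with
  | SVar n => [:: (1, ((n, false), [::]))]
  | SZero => [::]
  | SAdd e1 e2 => lst_app (salg_norm e1) (salg_norm e2)
  | SOpp e1 => lst_map (fun m => (- m.1, m.2)) (salg_norm e1)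
  | SMul e1 e2 => mono_mul (salg_norm e1) (salg_norm e2)
  | SStar e1 => lst_map (fun m => (conjc m.1, word_star m.2)) (salg_norm e1)
  | SScale c e1 => lst_map (fun m => (c * m.1, m.2)) (salg_norm e1)
  end.

Fixpoint mono_insert (m : mono) (s : list mono) : list mono :=
  match s with
  | [::] => [:: m]
  | m' :: s' => if word_eqb m.2 m'.2 then (m.1 + m'.1, m'.2) :: s' else m' :: mono_insert m s'
  end.
Fixpoint collect (s : list mono) : list mono :=
  match s with [::] => [::] | m :: s' => mono_insert m (collect s') end.
Fixpoint all_zero (s : list mono) : Prop :=
  match s with [::] => True | m :: s' => m.1 = 0 /\ all_zero s' end.

Variable env : list A.

Fixpoint salg_eval (e : salg_expr) : A :=
  match e with
  | SVar n => lst_nth 0 env n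
  | SZero => 0
  | SAdd e1 e2 => salg_eval e1 + salg_eval e2
  | SOpp e1 => - salg_eval e1
  | SMul e1 e2 => salg_eval e1 ** salg_eval e2
  | SStar e1 => star (salg_eval e1)
  | SScale c e1 => c *: salg_eval e1
  end.

Definition eval_letter (x : letter) : A :=
  if x.2 then star (lst_nth 0 env x.1) else lst_nth 0 env x.1.
Fixpoint eval_rec (a : A) (s : list letter) : A :=
  match s with [::] => a | x :: s' => eval_rec (a ** eval_letter x) s' end.
Definition eval_word (w : word) : A := eval_rec (eval_letter w.1) w.2.
Fixpoint eval_monos (s : list mono) : A :=
  match s with [::] => 0 | m :: s' => m.1 *: eval_word m.2 + eval_monos s' end.

Lemma nat_eqbP m n : nat_eqb m n -> m = n.
Proof. by elim: m n => [|m IH] [|n] //= /IH ->. Qed.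
Lemma letter_eqbP x y : letter_eqb x y -> x = y.
Proof.
case: x => [m b]; case: y => [n c]; rewrite /letter_eqb /=.
by case: ifP => // /nat_eqbP ->; case: b; case: c.
Qed.
Lemma lst_eqbP s t : lst_eqb s t -> s = t.
Proof. by elim: s t => [|x s IH] [|y t] //=; case: ifP => // /letter_eqbP -> /IH ->. Qed.
Lemma word_eqbP v w : word_eqb v w -> v = w.
Proof.
case: v => [x s]; case: w => [y t]; rewrite /word_eqb /=.
by case: ifP => // /letter_eqbP -> /lst_eqbP ->.
Qed.
Lemma eval_rec_cat a s t : eval_rec a (lst_app s t) = eval_rec (eval_rec a s) t.
Proof. by elim: s a => //= x s IH a; rewrite IH. Qed.
Lemma eval_recM a b s : eval_rec (a ** b) s = a ** eval_rec b s.
Proof. by elim: s b => //= x s IH b; rewrite -IH cmulA. Qed.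
Lemma eval_word_cat v w : eval_word (word_cat v w) = eval_word v ** eval_word w.
Proof.
by case: v w => [x s] [y t]; rewrite /eval_word /= eval_rec_cat /= eval_recM.
Qed.
Lemma eval_flip x : eval_letter (flip x) = star (eval_letter x).
Proof. by case: x => n []; rewrite /eval_letter //= starK. Qed.
Lemma eval_star_rec acc s :
  eval_word (word_star_rec acc s) = star (eval_rec (star (eval_word acc)) s).
Proof.
elim: s acc => [|x s IH] acc /=; first by rewrite starK.
rewrite IH; congr (star (eval_rec _ s)).
by case: acc => y t; rewrite /eval_word /= eval_recM starM eval_flip starK.
Qed.
Lemma eval_word_star w : eval_word (word_star w) = star (eval_word w).
Proof. by rewrite /word_star eval_star_rec /eval_word /= eval_flip starK. Qed.
Lemma eval_monos_app s t : eval_monos (lst_app s t) = eval_monos s + eval_monos t.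
Proof. by elim: s => [|m s IH] /=; rewrite ?add0r // IH addrA. Qed.
Lemma eval_monosM s t : eval_monos (mono_mul s t) = eval_monos s ** eval_monos t.
Proof.
elim: s => [|m s IH] /=; first by rewrite cmul0r.
rewrite eval_monos_app IH cmulDl; congr (_ + _); move=> {IH}.
elim: t => [|m' t IHt] /=; first by rewrite cmulr0.
by rewrite IHt cmulDr eval_word_cat !cmulZl !cmulZr !scalerA.
Qed.
Lemma salg_normE e : eval_monos (salg_norm e) = salg_eval e.
Proof.
elim: e => [n||e1 IH1 e2 IH2|e IH|e1 IH1 e2 IH2|e IH|c e IH] /=.
- by rewrite addr0 scale1r.
- by [].
- by rewrite eval_monos_app IH1 IH2.
- rewrite -IH; elim: (salg_norm e) => [|m s IHs] /=; first by rewrite oppr0.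
  by rewrite IHs opprD scaleNr.
- by rewrite eval_monosM IH1 IH2.
- rewrite -IH; elim: (salg_norm e) => [|m s IHs] /=; first by rewrite star0.
  by rewrite IHs starD starZ_conjc eval_word_star.
- rewrite -IH; elim: (salg_norm e) => [|m s IHs] /=; first by rewrite scaler0.
  by rewrite IHs scalerDr scalerA.
Qed.
Lemma eval_insert m s : eval_monos (mono_insert m s) = m.1 *: eval_word m.2 + eval_monos s.
Proof.
elim: s => [//|m' s IH] /=; case: ifP => [/word_eqbP ->|_] /=.
  by rewrite scalerDl addrA.
by rewrite IH addrCA.
Qed.
Lemma eval_collect s : eval_monos (collect s) = eval_monos s.
Proof. by elim: s => //= m s IH; rewrite eval_insert IH. Qed.
(** Both sides are expanded in the free star-algebra; it suffices that the coefficient of every word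
    in their difference vanishes, which is an equation between scalars. *)
Lemma salg_sound e1 e2 :
  all_zero (collect (salg_norm (SAdd e1 (SOpp e2)))) -> salg_eval e1 = salg_eval e2.
Proof.
move=> H; apply/eqP; rewrite -subr_eq0.
rewrite -[_ - _]/(salg_eval (SAdd e1 (SOpp e2))) -salg_normE -eval_collect.
elim: (collect _) H => //= m s IH [-> /IH /eqP ->]; by rewrite scale0r addr0.
Qed.
End Normalise.

Ltac salg_mem a l :=
  lazymatch l with
  | [::] => constr:(false)
  | a :: _ => constr:(true)
  | _ :: ?l' => salg_mem a l'
  end.
Ltac salg_index a l :=
  lazymatch l with
  | a :: _ => constr:(0%N)
  | _ :: ?l' => let n := salg_index a l' in constr:(S n)
  end.
Ltac salg_atoms t l :=
  lazymatch t with
  | (?a + ?b)%R => let l' := salg_atoms a l in salg_atoms b l'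
  | (- ?a)%R => salg_atoms a l
  | (?a ** ?b) => let l' := salg_atoms a l in salg_atoms b l'
  | star ?a => salg_atoms a l
  | (_ *: ?a)%R => salg_atoms a l
  | 0%R => l
  | _ => let b := salg_mem t l in
         lazymatch b with true => l | false => constr:(t :: l) end
  end.
Ltac salg_reify K t l :=
  lazymatch t with
  | (?a + ?b)%R => let x := salg_reify K a l in let y := salg_reify K b l in constr:(SAdd x y)
  | (- ?a)%R => let x := salg_reify K a l in constr:(SOpp x)
  | (?a ** ?b) => let x := salg_reify K a l in let y := salg_reify K b l in constr:(SMul x y)
  | star ?a => let x := salg_reify K a l in constr:(SStar x)
  | (?c *: ?a)%R => let x := salg_reify K a l in constr:(SScale c x)
  | 0%R => constr:(SZero K)
  | _ => let n := salg_index t l in constr:(SVar K n)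
  end.
Ltac salg_compute :=
  cbv [salg_norm all_zero collect mono_insert mono_mul word_star word_star_rec flip word_cat
       word_eqb lst_eqb letter_eqb nat_eqb lst_map lst_app fst snd].
(** Coefficient equations that [ring] alone does not prove, such as those that use i^2 = -1, are
    left as goals. *)
Ltac salg :=
  lazymatch goal with
  | |- @eq ?T ?a ?b =>
    let l := salg_atoms a (@nil T) in
    let l := salg_atoms b l in
    let K := open_constr:(_ : realType) in
    let x := salg_reify K a l in
    let y := salg_reify K b l in
    refine (@salg_sound K _ l x y _);
    salg_compute; rewrite ?(conjci, conjcR, conjc1, conjc0, conjcN, conjcM, conjcD, conjcK);
    repeat split; try ring
  end.

(** * Traces and the uniform 2-norm *)

Definition trace_sqr (R : realType) (A : cstarType R) (tau : A -> R[i]) (a : A) : R :=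
  complex.Re (tau (star a ** a)).
Definition trace_norm2 (R : realType) (A : cstarType R) (tau : A -> R[i]) (a : A) : R :=
  Num.sqrt (trace_sqr tau a).

Section Trace.
Variables (R : realType) (A : cstarType R) (tau : A -> R[i]).
Hypothesis htau : is_trace tau.
Implicit Types a b x : A.
Local Notation sq := (trace_sqr tau).
Local Notation n2 := (trace_norm2 tau).

Lemma tauD a b : tau (a + b) = tau a + tau b. Proof. exact: (traceD htau). Qed.
Lemma tauZ c a : tau (c *: a) = c * tau a. Proof. exact: (traceZ htau). Qed.
Lemma tauC a b : tau (a ** b) = tau (b ** a). Proof. exact: (trace_mulC htau). Qed.
Lemma tau0 : tau 0 = 0. Proof. by rewrite -(scale0r 0) tauZ mul0r. Qed.
Lemma tauN a : tau (- a) = - tau a. Proof. by rewrite -scaleN1r tauZ mulN1r. Qed.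
Lemma tauB a b : tau (a - b) = tau a - tau b. Proof. by rewrite tauD tauN. Qed.
Lemma tau_sum (I : Type) (r : seq I) (P : pred I) (F : I -> A) :
  tau (\sum_(i <- r | P i) F i) = \sum_(i <- r | P i) tau (F i).
Proof. exact: (big_morph tau tauD tau0). Qed.

Lemma trace_sqrE a : tau (star a ** a) = (sq a)%:C.
Proof. by rewrite /trace_sqr RRe_real // ger0_real // (trace_ge0 htau). Qed.
Lemma trace_sqr_ge0 a : 0 <= sq a.
Proof. by rewrite -ler0c -trace_sqrE (trace_ge0 htau). Qed.
Lemma trace_sqr_star a : sq (star a) = sq a.
Proof. by rewrite /trace_sqr starK tauC. Qed.

(** Polarization: positivity makes the values at (a + b)^* (a + b) and (a + ib)^* (a + ib) real,
    which fixes the imaginary and the real part. Without a unit only products are reached in this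
    way. *)
Lemma tau_conj a b : tau (star b ** a) = conjc (tau (star a ** b)).
Proof.
have h1 : complex.Im (tau (star (a + b) ** (a + b))) = 0 by rewrite trace_sqrE.
have h2 : complex.Im (tau (star (a + 'i%C *: b) ** (a + 'i%C *: b))) = 0 by rewrite trace_sqrE.
have e1 : star (a + b) ** (a + b) =
  star a ** a + star b ** b + (star a ** b + star b ** a) by salg.
have e2 : star (a + 'i%C *: b) ** (a + 'i%C *: b) =
  star a ** a + star b ** b + 'i%C *: (star a ** b - star b ** a).
  by salg; ring: (mulii R).
move: h1 h2; rewrite e1 e2 !(tauD, tauZ, tauN) !trace_sqrE.
case: (tau (star a ** b)) => x y; case: (tau (star b ** a)) => z w /=.
rewrite !add0r !mul0r !mul1r !add0r => h1 h2.
by apply/eqP; rewrite eq_complex /=; apply/andP; split; apply/eqP; lra.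
Qed.

Lemma trace_CS a b : cabs (tau (star a ** b)) ^+ 2 <= sq a * sq b.
Proof.
set z := tau (star a ** b).
(* Positivity at s a - t conj(z) b. The choice s = [sq b], t = 1 gives the inequality; if [sq b] is
   0, then s = 1 and a large t give a negative value unless z = 0. *)
have key (s t : R) : 0 <= s ^+ 2 * sq a - 2 * s * t * cabs z ^+ 2 + t ^+ 2 * cabs z ^+ 2 * sq b.
  have := trace_sqr_ge0 (s%:C *: a - (t%:C * conjc z) *: b).
  rewrite /trace_sqr.
  have -> : star (s%:C *: a - (t%:C * conjc z) *: b) ** (s%:C *: a - (t%:C * conjc z) *: b) =
    (s ^+ 2)%:C *: (star a ** a) - (s * t)%:C *: (conjc z *: (star a ** b) + z *: (star b ** a))
    + (t ^+ 2)%:C *: ((z * conjc z) *: (star b ** b)).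
    by salg; rewrite !(rmorphM, rmorphXn) /=; ring.
  rewrite !(tauD, tauN, tauZ) (tau_conj a b) -/z !trace_sqrE -sqr_normc cabsE.
  rewrite [conjc z * z]mulrC -sqr_normc cabsE -!(rmorphM, rmorphXn, rmorphD, rmorphN) /=.
  by move/le_trans; apply; apply: eq_le_num; ring.
have sa := trace_sqr_ge0 a; have sb := trace_sqr_ge0 b.
move: (sb); rewrite le_eqVlt => /predU1P[b0|b0].
  rewrite -b0 mulr0 leNgt; apply/negP => z0.
  have zn : cabs z != 0 by apply: contraTneq z0 => ->; rewrite expr0n /= ltxx.
  have := key 1 ((sq a + 1) / (2 * cabs z ^+ 2)).
  rewrite -b0 !mulr0 addr0 expr1n mul1r mulr1.
  have -> : sq a - 2 * ((sq a + 1) / (2 * cabs z ^+ 2)) * cabs z ^+ 2 = -1 by field.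
  by rewrite ler0N1.
have := key (sq b) 1.
have -> : sq b ^+ 2 * sq a - 2 * sq b * 1 * cabs z ^+ 2 + 1 ^+ 2 * cabs z ^+ 2 * sq b =
  sq b * (sq a * sq b - cabs z ^+ 2) by ring.
by rewrite pmulr_rge0 // subr_ge0.
Qed.

Lemma trace_norm2_ge0 a : 0 <= n2 a. Proof. exact: sqrtr_ge0. Qed.
Lemma trace_norm2_sqr a : n2 a ^+ 2 = sq a.
Proof. by rewrite sqr_sqrtr // trace_sqr_ge0. Qed.
Lemma trace_norm2_le a (c : R) : 0 <= c -> (n2 a <= c) = (sq a <= c ^+ 2).
Proof.
by move=> c0; rewrite -trace_norm2_sqr ler_pXn2r // nnegrE // trace_norm2_ge0.
Qed.
Lemma trace_CS2 a b : cabs (tau (star a ** b)) <= n2 a * n2 b.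
Proof.
rewrite -(@ler_pXn2r _ 2) // ?nnegrE ?cabs_ge0 ?mulr_ge0 ?trace_norm2_ge0 //.
by rewrite exprMn !trace_norm2_sqr trace_CS.
Qed.
Lemma trace_sqrD a b : sq (a + b) = sq a + complex.Re (tau (star a ** b)) *+ 2 + sq b.
Proof.
rewrite /trace_sqr.
have -> : star (a + b) ** (a + b) = star a ** a + (star a ** b + star b ** a) + star b ** b by salg.
by rewrite !tauD (tau_conj a b) !ReD Re_conjc mulr2n.
Qed.
Lemma trace_norm2D a b : n2 (a + b) <= n2 a + n2 b.
Proof.
rewrite trace_norm2_le ?addr_ge0 ?trace_norm2_ge0 // sqrrD !trace_norm2_sqr trace_sqrD.
rewrite lerD2r lerD2l lerMn2r /= (le_trans (ler_norm _)) //.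
exact: le_trans (Re_le_cabs _) (trace_CS2 _ _).
Qed.
Lemma trace_sqrZ c a : sq (c *: a) = cabs c ^+ 2 * sq a.
Proof.
rewrite /trace_sqr.
have -> : star (c *: a) ** (c *: a) = (c * conjc c) *: (star a ** a) by salg.
by rewrite tauZ -sqr_normc cabsE -rmorphXn ReRM.
Qed.
Lemma trace_norm2Z c a : n2 (c *: a) = cabs c * n2 a.
Proof. by rewrite /trace_norm2 trace_sqrZ sqrtrM ?sqr_ge0 // sqrtr_sqr ger0_norm ?cabs_ge0. Qed.
Lemma trace_norm2N a : n2 (- a) = n2 a.
Proof. by rewrite -scaleN1r trace_norm2Z cabsN cabs1 mul1r. Qed.
Lemma trace_norm2_star a : n2 (star a) = n2 a.
Proof. by rewrite /trace_norm2 trace_sqr_star. Qed.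

Lemma tau_bound a : cabs (tau a) <= rnorm a.
Proof.
pose E := [set complex.Re `|tau b| | b in [set b : A | `|b| <= 1]].
have E1 : sup E = 1 := trace_norm1 htau.
have hE : has_sup E.
  by apply: contrapT => nE; move: E1; rewrite sup_out // => /eqP; rewrite eq_sym oner_eq0.
have [->|a0] := eqVneq a 0; first by rewrite tau0 cabs0 rnorm0.
have ap : 0 < rnorm a.
  by rewrite lt_def rnorm_ge0 andbT; apply: contraNneq a0 => /rnorm_eq0 ->.
have : cabs (tau ((rnorm a)^-1%:C *: a)) <= 1.
  rewrite -E1; apply: ub_le_sup; first by case: hE.
  exists ((rnorm a)^-1%:C *: a) => //=.
  rewrite rnormE rnormZ cabsR ger0_norm ?invr_ge0 ?(ltW ap) // mulVf ?gt_eqF //.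
by rewrite tauZ cabsM cabsR ger0_norm ?invr_ge0 ?(ltW ap) // ler_pdivrMl // mulr1.
Qed.

Lemma trace_norm_approx (e : R) : 0 < e ->
  exists2 a, rnorm a <= 1 & 1 - e < cabs (tau a).
Proof.
move=> e0; pose E := [set complex.Re `|tau b| | b in [set b : A | `|b| <= 1]].
have E1 : sup E = 1 := trace_norm1 htau.
have hE : has_sup E.
  by apply: contrapT => nE; move: E1; rewrite sup_out // => /eqP; rewrite eq_sym oner_eq0.
have [_ [a /= a1 <-]] := sup_adherent e0 hE.
by rewrite -/E E1 => h; exists a => //; move: a1; rewrite rnormE lecR.
Qed.

(** In place of the order relation c <= ||c||, Cauchy-Schwarz is iterated: s_k = |tau(x^* c^(2^k)
    x)| satisfies s_k^2 <= tau(x^* x) s_(k+1). The crude bound s_k <= ||x||^2 ||c||^(2^k) then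
    suffices, since its constant disappears under 2^k-th roots. *)
Lemma trace_sandwich_sa c x : star c = c ->
  cabs (tau (star x ** c ** x)) <= rnorm c * sq x.
Proof.
move=> cc; pose u := fix u k := if k is k'.+1 then u k' ** u k' else c.
have hu := @rnorm_iter_sqr R A u (fun=> erefl) cc.
pose s k := cabs (tau (star x ** u k ** x)).
have s_sqr k : s k ^+ 2 <= sq x * s k.+1.
  rewrite /s -cmulA; apply: le_trans (trace_CS _ _) _.
  rewrite ler_wpM2l ?trace_sqr_ge0 // /trace_sqr starM (proj1 (hu k)) /=.
  rewrite -!cmulA; exact: le_trans (ler_norm _) (Re_le_cabs _).
have s_le k : s 0%N ^+ (2 ^ k) <= sq x ^+ (2 ^ k).-1 * s k.
  elim: k => [|k IH]; first by rewrite expn0 expr0 mul1r.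
  rewrite expnS mulnC exprM.
  apply: le_trans (_ : (sq x ^+ (2 ^ k).-1 * s k) ^+ 2 <= _).
    by rewrite ler_pXn2r // ?nnegrE ?exprn_ge0 ?cabs_ge0 ?mulr_ge0 ?trace_sqr_ge0 ?exprn_ge0 ?trace_sqr_ge0 ?cabs_ge0.
  rewrite exprMn; apply: le_trans (ler_wpM2l _ (s_sqr k)) _; first by rewrite sqr_ge0.
  rewrite mulrA; apply: eq_le_num; congr (_ * _); rewrite -exprM -exprSr; congr (_ ^+ _).
  have := expn_gt0 2 k; lia.
have xs : 0 <= sq x := trace_sqr_ge0 x.
rewrite -[X in X <= _]/(s 0%N); move: xs; rewrite le_eqVlt => /predU1P[x0|x0].
  have := s_sqr 0%N; rewrite -x0 mul0r mulr0 => h.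
  by rewrite -(@ler_pXn2r _ 2) ?nnegrE ?cabs_ge0 // expr0n.
apply: (@le_of_pow2 R _ (rnorm x ^+ 2 / sq x)); rewrite ?cabs_ge0 ?mulr_ge0 ?rnorm_ge0 ?(ltW x0) //.
move=> k; apply: le_trans (s_le k) _.
have -> : rnorm x ^+ 2 / sq x * (rnorm c * sq x) ^+ (2 ^ k) =
  sq x ^+ (2 ^ k).-1 * (rnorm x * rnorm c ^+ (2 ^ k) * rnorm x).
  have E : sq x ^+ (2 ^ k) = sq x * sq x ^+ (2 ^ k).-1 by rewrite -exprS prednK ?expn_gt0.
  rewrite exprMn E; move: (rnorm c ^+ _) (sq x ^+ _) => u1 u2; field; rewrite gt_eqF //.
rewrite ler_wpM2l //; first by rewrite exprn_ge0 // ltW.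
apply: le_trans (tau_bound _) _; apply: le_trans (rnormM _ _) _; rewrite ler_wpM2r ?rnorm_ge0 //.
by apply: le_trans (rnormM _ _) _; rewrite rnorm_star (proj2 (hu k)).
Qed.

Lemma trace_norm2Ml a b : n2 (a ** b) <= rnorm a * n2 b.
Proof.
rewrite trace_norm2_le ?mulr_ge0 ?rnorm_ge0 ?trace_norm2_ge0 // exprMn trace_norm2_sqr.
rewrite -rnorm_cstar; apply: le_trans (trace_sandwich_sa b _); last by rewrite starM starK.
rewrite /trace_sqr starM -!cmulA; exact: le_trans (ler_norm _) (Re_le_cabs _).
Qed.
Lemma trace_norm2_rnorm a : n2 a <= rnorm a.
Proof.
rewrite trace_norm2_le ?rnorm_ge0 // -rnorm_cstar.
by apply: le_trans (tau_bound _); apply: le_trans (Re_le_cabs _); exact: ler_norm.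
Qed.
End Trace.

(** * The uniform 2-norm and norm-bounded convergence *)

Section UniformNorm.
Variables (R : realType) (M : tcAlgebra R).
Local Notation X := (@tc_traces R M).
Local Notation N := (norm2 X).
Implicit Types a b : M.

Lemma tcX tau : X tau -> is_trace tau. Proof. exact: tc_trace (@tcP R M) tau. Qed.

(** Nonnegativity of [c] covers the case of empty [X], where the supremum is 0 by convention. *)
Lemma norm2_le a (c : R) : 0 <= c -> (forall tau, X tau -> trace_norm2 tau a <= c) -> N a <= c.
Proof.
move=> c0 H; rewrite /norm2; set E := [set _ | _ in _].
have [[t Et]|E0] := pselect (E !=set0).
  by apply: ge_sup; [exists t|move=> _ [tau Xt <-]; exact: H].
have -> : E = set0 by apply/seteqP; split=> // t Et; case: E0; exists t.
by rewrite sup0.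
Qed.

Lemma norm2_ub tau a : X tau -> trace_norm2 tau a <= N a.
Proof.
move=> Xt; apply: ub_le_sup; last by exists tau.
exists (rnorm a) => _ [s Xs <-]; exact: (trace_norm2_rnorm (tcX Xs)).
Qed.

Lemma norm2_ge0 a : 0 <= N a.
Proof.
rewrite /norm2; set E := [set _ | _ in _].
have [hE|nE] := pselect (has_sup E); last by rewrite sup_out.
case: (hE) => -[x [tau Xt _]] _; apply: le_trans (norm2_ub a Xt); exact: sqrtr_ge0.
Qed.
Lemma norm2_eq0 a : N a = 0 -> a = 0.
Proof. by have [_ _ h] := tc_norm (@tcP R M); exact: h. Qed.
Lemma norm2D a b : N (a + b) <= N a + N b.
Proof. by have [h _ _] := tc_norm (@tcP R M); exact: h. Qed.
Lemma norm2Z c a : N (c *: a) = cabs c * N a.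
Proof. by have [_ h _] := tc_norm (@tcP R M); exact: h. Qed.
Lemma norm20 : N 0 = 0.
Proof. by rewrite -(scale0r 0) norm2Z cabs0 mul0r. Qed.
Lemma norm2N a : N (- a) = N a.
Proof. by rewrite -scaleN1r norm2Z cabsN cabs1 mul1r. Qed.
Lemma norm2BC a b : N (a - b) = N (b - a).
Proof. by rewrite -norm2N opprB. Qed.
Lemma norm2_tri b a c : N (a - c) <= N (a - b) + N (b - c).
Proof. by have := norm2D (a - b) (b - c); rewrite addrA subrK. Qed.
Lemma norm2_star a : N (star a) = N a.
Proof.
suff H b : N (star b) <= N b by apply/eqP; rewrite eq_le H -{1}(starK a) H.
apply: norm2_le (norm2_ge0 b) _ => tau Xt.
by rewrite (trace_norm2_star (tcX Xt)) norm2_ub.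
Qed.
Lemma norm2_rnorm a : N a <= rnorm a.
Proof.
by apply: norm2_le (rnorm_ge0 _) _ => tau Xt; exact: (trace_norm2_rnorm (tcX Xt)).
Qed.
Lemma norm2Ml a b : N (a ** b) <= rnorm a * N b.
Proof.
apply: norm2_le; first by rewrite mulr_ge0 ?rnorm_ge0 ?norm2_ge0.
move=> tau Xt; apply: le_trans (trace_norm2Ml (tcX Xt) _ _) _.
by rewrite ler_wpM2l ?rnorm_ge0 ?norm2_ub.
Qed.
Lemma norm2Mr a b : N (a ** b) <= N a * rnorm b.
Proof. by rewrite -norm2_star starM mulrC -(rnorm_star b) -(norm2_star a) norm2Ml. Qed.
Lemma norm2_sum (I : Type) (r : seq I) (P : pred I) (F : I -> M) :
  N (\sum_(i <- r | P i) F i) <= \sum_(i <- r | P i) N (F i).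
Proof.
elim/big_ind2 : _ => [|x1 x2 y1 y2 h1 h2|//]; first by rewrite norm20.
by apply: le_trans (norm2D _ _) (lerD h1 h2).
Qed.

Definition bounded_seq (u : nat -> M) : Prop := exists C : R, forall n, rnorm (u n) <= C.
Definition null_seq (u : nat -> M) : Prop :=
  forall e : R, 0 < e -> exists n0 : nat, forall n, (n0 <= n)%N -> N (u n) < e.
(** The operator norm bound is built in because multiplication is jointly continuous for the 2-norm
    only on norm-bounded sets. *)
Definition bcvg (u : nat -> M) (a : M) : Prop :=
  bounded_seq u /\ null_seq (fun n => u n - a).

Lemma bounded_seqP u : bounded_seq u -> exists2 C : R, 0 < C & forall n, rnorm (u n) <= C.
Proof.
move=> [C uC]; exists (Num.max C 1); first by rewrite lt_max ltr01 orbT.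
by move=> n; rewrite le_max uC.
Qed.
Lemma null_seq_le (K : R) u v : (forall n, N (v n) <= K * N (u n)) -> null_seq u -> null_seq v.
Proof.
move=> H u0 e e0.
have K0 : 0 < `|K| + 1 by rewrite ltr_wpDl.
have [n0 h] := u0 (e / (`|K| + 1)) (divr_gt0 e0 K0); exists n0 => n /h.
rewrite ltr_pdivlMr // mulrC; apply: le_lt_trans; apply: le_trans (H n) _.
by rewrite ler_wpM2r ?norm2_ge0 // (le_trans (ler_norm K)) // lerDl.
Qed.
Lemma null_seqD u v : null_seq u -> null_seq v -> null_seq (fun n => u n + v n).
Proof.
move=> u0 v0 e e0; have e2 : 0 < e / 2 by rewrite divr_gt0.
have [n1 h1] := u0 _ e2; have [n2 h2] := v0 _ e2.
exists (maxn n1 n2) => n; rewrite geq_max => /andP[/h1 k1 /h2 k2].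
by apply: le_lt_trans (norm2D _ _) _; rewrite [ltRHS](splitr e) ltrD.
Qed.
Lemma null_seq_cst a : null_seq (fun=> a) -> a = 0.
Proof.
move=> h; apply: norm2_eq0; apply/eqP; rewrite eq_le norm2_ge0 andbT leNgt.
by apply/negP => /h [n0 /(_ n0 (leqnn _))]; rewrite ltxx.
Qed.
Lemma bounded_seqM u v : bounded_seq u -> bounded_seq v -> bounded_seq (fun n => u n ** v n).
Proof.
move=> /bounded_seqP[C C0 uC] [D vD]; exists (C * D) => n.
by apply: le_trans (rnormM _ _) _; apply: ler_pM => //; exact: rnorm_ge0.
Qed.
Lemma bounded_seqD u v : bounded_seq u -> bounded_seq v -> bounded_seq (fun n => u n + v n).
Proof.
move=> [C uC] [D vD]; exists (C + D) => n.
by apply: le_trans (rnormD _ _) _; apply: lerD.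
Qed.
Lemma bounded_seqZ c u : bounded_seq u -> bounded_seq (fun n => c *: u n).
Proof. by move=> [C uC]; exists (cabs c * C) => n; rewrite rnormZ ler_wpM2l ?cabs_ge0. Qed.
Lemma bounded_seq_star u : bounded_seq u -> bounded_seq (fun n => star (u n)).
Proof. by move=> [C uC]; exists C => n; rewrite rnorm_star. Qed.

Lemma bcvg_bounded u a : bcvg u a -> bounded_seq u. Proof. by case. Qed.
Lemma bcvg_cst a : bcvg (fun=> a) a.
Proof.
by split; [exists (rnorm a)|move=> e e0; exists 0%N => n _; rewrite subrr norm20].
Qed.
Lemma bcvgD u v a b : bcvg u a -> bcvg v b -> bcvg (fun n => u n + v n) (a + b).
Proof.
move=> [bu u0] [bv v0]; split; first exact: bounded_seqD.
by move=> e /(null_seqD u0 v0) [n0 h]; exists n0 => n /h; rewrite opprD addrACA.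
Qed.
Lemma bcvgZ c u a : bcvg u a -> bcvg (fun n => c *: u n) (c *: a).
Proof.
move=> [bu u0]; split; first exact: bounded_seqZ.
by apply: null_seq_le u0 => n; rewrite -scalerBr norm2Z.
Qed.
Lemma bcvgN u a : bcvg u a -> bcvg (fun n => - u n) (- a).
Proof.
by move=> /(bcvgZ (-1)); rewrite scaleN1r (_ : (fun n => -1 *: u n) = (fun n => - u n)) //;
  apply/funext => n; rewrite scaleN1r.
Qed.
Lemma bcvgB u v a b : bcvg u a -> bcvg v b -> bcvg (fun n => u n - v n) (a - b).
Proof. by move=> hu /bcvgN; exact: bcvgD. Qed.
Lemma bcvgM u v a b : bcvg u a -> bcvg v b -> bcvg (fun n => u n ** v n) (a ** b).
Proof.
move=> [bu u0] [bv v0]; split; first exact: bounded_seqM.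
have [C C0 uC] := bounded_seqP bu.
have h1 : null_seq (fun n => u n ** (v n - b)).
  apply: (@null_seq_le C) v0 => n; apply: le_trans (norm2Ml _ _) _.
  by rewrite ler_wpM2r ?norm2_ge0.
have h2 : null_seq (fun n => (u n - a) ** b).
  by apply: (@null_seq_le (rnorm b)) u0 => n; rewrite mulrC norm2Mr.
move=> e /(null_seqD h1 h2) [n0 h]; exists n0 => n /h.
by rewrite cmulBr cmulBl addrA subrK.
Qed.
Lemma bcvg_star u a : bcvg u a -> bcvg (fun n => star (u n)) (star a).
Proof.
move=> [bu u0]; split; first exact: bounded_seq_star.
by move=> e /u0 [n0 h]; exists n0 => n /h; rewrite -starB norm2_star.
Qed.
Lemma bcvg_sum (I : Type) (r : seq I) (P : pred I) (F : nat -> I -> M) (G : I -> M) :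
  (forall i, P i -> bcvg (F^~ i) (G i)) ->
  bcvg (fun n => \sum_(i <- r | P i) F n i) (\sum_(i <- r | P i) G i).
Proof.
move=> h; elim: r => [|i r IH].
  by rewrite big_nil (_ : (fun n => _) = (fun=> 0)); [exact: bcvg_cst|apply/funext => n; rewrite big_nil].
rewrite big_cons (_ : (fun n => _) = (fun n => if P i then F n i + \sum_(j <- r | P j) F n j
   else \sum_(j <- r | P j) F n j)); last by apply/funext => n; rewrite big_cons.
by case: ifP => // Pi; apply: bcvgD => //; exact: h.
Qed.
Lemma bcvg_unique u a b : bcvg u a -> bcvg u b -> a = b.
Proof.
move=> [_ ua] [_ ub]; apply/eqP; rewrite -subr_eq0; apply/eqP; apply: null_seq_cst.
have h1 : null_seq (fun n => a - u n) by move=> e /ua [n0 h]; exists n0 => n /h; rewrite norm2BC.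
by move=> e /(null_seqD h1 ub) [n0 h]; exists n0 => n /h; rewrite addrA subrK.
Qed.
Lemma bcvg_near u v a : bcvg u a -> bounded_seq v -> null_seq (fun n => v n - u n) -> bcvg v a.
Proof.
move=> [_ ua] bv vu; split=> //.
by move=> e /(null_seqD vu ua) [n0 h]; exists n0 => n /h; rewrite addrA subrK.
Qed.
Lemma bcvg_ext u v a : (forall n, u n = v n) -> bcvg u a -> bcvg v a.
Proof. by move=> /funext ->. Qed.
Lemma bcvg_shift u a : bcvg u a -> bcvg (fun n => u n.+1) a.
Proof.
move=> [[C uC] ua]; split; first by exists C.
by move=> e /ua [n0 h]; exists n0 => n nn; apply: h; exact: leqW.
Qed.

Lemma bcvg_complete (C : R) u : 0 < C -> (forall n, rnorm (u n) <= C) -> norm2_cauchy X u ->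
  exists2 a, rnorm a <= C & bcvg u a.
Proof.
move=> C0 uC uc.
have Ci : 0 < C^-1 by rewrite invr_gt0.
have [||a a1 va] := @tc_ball_complete R M X (@tcP R M) (fun n => C^-1%:C *: u n).
- by move=> n; rewrite rnormZ cabsR gtr0_norm // ler_pdivrMl // mulr1.
- move=> e e0; have [n0 h] := uc (e * C) (mulr_gt0 e0 C0).
  exists n0 => m n hm hn; rewrite -scalerBr norm2Z cabsR gtr0_norm //.
  by rewrite ltr_pdivrMl // mulrC h.
exists (C%:C *: a); first by rewrite rnormZ cabsR gtr0_norm // -{2}(mulr1 C) ler_pM2l.
split; first by exists C.
move=> e e0; move/cvgrPdist_lt : va => /(_ (e / C) (divr_gt0 e0 C0)) [n0 _ h].
exists n0 => n /h; rewrite sub0r normrN ger0_norm ?norm2_ge0 // ltr_pdivlMr // => h2.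
have -> : u n - C%:C *: a = C%:C *: (C^-1%:C *: u n - a).
  by rewrite scalerBr scalerA -rmorphM divff ?gt_eqF // scale1r.
by rewrite norm2Z cabsR gtr0_norm // mulrC.
Qed.

Lemma bcvg_cauchy u a : bcvg u a -> norm2_cauchy X u.
Proof.
move=> [_ ua] e e0; have [n0 h] := ua _ (divr_gt0 e0 (ltr0Sn R 1)).
exists n0 => m n hm hn; apply: le_lt_trans (norm2_tri a _ _) _.
by rewrite [ltRHS](splitr e) (norm2BC a); apply: ltrD; exact: h.
Qed.


Lemma bcvg_norm2_cvg u a : bounded_seq u -> bcvg u a <-> norm2_cvg X u a.
Proof.
move=> bu; split.
  move=> [_ ua]; apply/cvgrPdist_lt => e /ua [n0 h]; exists n0 => // n /h.
  by rewrite sub0r normrN ger0_norm ?norm2_ge0.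
move=> /cvgrPdist_lt ua; split=> // e /ua [n0 _ h]; exists n0 => n /h.
by rewrite sub0r normrN ger0_norm ?norm2_ge0.
Qed.

End UniformNorm.

(** * Spectral theory in finite dimensional subalgebras *)

Section Spectral.
Variables (R : realType) (A : cstarType R) (F : set A).
Hypothesis fdF : fd_cstar_subalgebra F.
Implicit Types x y : A.

Lemma fdN a : F a -> F (- a).
Proof. by move=> Fa; rewrite -scaleN1r; exact: fdsZ fdF _ _ Fa. Qed.
Lemma fdB a b : F a -> F b -> F (a - b).
Proof. by move=> Fa Fb; apply: (fdsD fdF) => //; exact: fdN. Qed.
Lemma fd_sum (I : eqType) (r : seq I) (P : pred I) (G : I -> A) :
  (forall i, i \in r -> P i -> F (G i)) -> F (\sum_(i <- r | P i) G i).
Proof.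
move=> h; rewrite big_seq_cond; apply: big_ind => [|a b|i /andP[]].
- exact: fds0 fdF.
- exact: fdsD fdF a b.
- exact: h.
Qed.

(** A spanning list of length d gives an n by d coefficient matrix; for n > d it has a nonzero left
    kernel. *)
Lemma fd_lin_dep : exists d : nat, forall n (x : 'I_n -> A), (d < n)%N -> (forall i, F (x i)) ->
  exists2 v : 'rV[R[i]]_n, v != 0 & \sum_i v 0 i *: x i = 0.
Proof.
have [s sF] := fds_span fdF; exists (size s) => n x dn Fx.
have [c cE] := choice (fun i => sF _ (Fx i)).
pose C : 'M[R[i]]_(n, size s) := \matrix_(i, j) c i j.
have : kermx C != 0.
  by rewrite -mxrank_eq0 mxrank_ker subn_eq0 -ltnNge; apply: leq_ltn_trans (rank_leq_col _) dn.
move=> /rowV0Pn [v /sub_kermxP vC v0]; exists v => //.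
under eq_bigr do rewrite cE scaler_sumr.
rewrite exchange_big big1 // => j _.
have E : \sum_i v 0 i * c i j = 0.
  have /matrixP /(_ 0 j) := vC; rewrite !mxE => vCj; rewrite -[RHS]vCj.
  by apply: eq_bigr => i _; rewrite mxE.
by under eq_bigr do rewrite scalerA; rewrite -scaler_suml E scale0r.
Qed.

Variable h : A.
Hypotheses (Fh : F h) (hsa : star h = h).

(** The algebra need not have a unit to carry the constant term of a polynomial p, so [pact p y]
    stands for p(h)y: polynomials in h act on elements. *)
Let hp k y := iter k (fun y => h ** y) y.
Let pact (p : {poly R[i]}) y := \sum_(k < size p) p`_k *: hp k y.

Let hpF k y : F y -> F (hp k y).
Proof. by move=> Fy; elim: k => //= k IH; exact: (fdsM fdF). Qed.

Let pactE n (p : {poly R[i]}) y : (size p <= n)%N -> pact p y = \sum_(k < n) p`_k *: hp k y.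
Proof.
move=> pn; rewrite /pact (big_ord_widen _ (fun k => p`_k *: hp k y) pn) big_mkcond /=.
by apply: eq_bigr => k _; case: ifPn => // kp; rewrite nth_default ?scale0r // leqNgt.
Qed.

Let pactM (z : R[i]) (q : {poly R[i]}) y : pact (('X - z%:P) * q) y = pact q (h ** y - z *: y).
Proof.
have hpD k a b : hp k (a - z *: b) = hp k a - z *: hp k b.
  by elim: k => //= k ->; rewrite cmulBr cmulZr.
rewrite (@pactE (size q).+1); last first.
  by apply: leq_trans (size_polyMleq _ _) _; rewrite size_XsubC.
under eq_bigr do rewrite mulrBl coefB coefXM coefCM scalerBl.
rewrite sumrB big_ord_recl /= scale0r add0r big_ord_recr /= [q`_(size q)]nth_default //.
rewrite mulr0 scale0r addr0 -sumrB; apply: eq_bigr => k _.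
rewrite /= hpD scalerBr scalerA [q`_k * z]mulrC; congr (_ *: _ - _).
by rewrite /hp -iterS iterSr.
Qed.

Let pactZ c (q : {poly R[i]}) y : pact (c *: q) y = c *: pact q y.
Proof.
rewrite (@pactE (size q)) ?size_scale_leq // /pact scaler_sumr.
by apply: eq_bigr => k _; rewrite coefZ scalerA.
Qed.

Let opl y (s : seq R[i]) := foldl (fun y z => h ** y - z *: y) y s.

Let pact_prod s y : pact (\prod_(z <- s) ('X - z%:P)) y = opl y s.
Proof.
elim: s y => [|z s IH] y; last by rewrite big_cons pactM IH.
by rewrite big_nil /pact size_poly1 big_ord1 coefC eqxx scale1r.
Qed.

(** The d + 1 elements h, h^2, ... are linearly dependent, so p(h)h = 0 for some nonzero p; over the
    algebraically closed scalars p splits, and s lists its roots. *)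
Let annihilator : exists s, opl h s = 0.
Proof.
have [d hd] := fd_lin_dep.
have [|v v0 hv] := hd d.+1 (fun k : 'I_d.+1 => hp k h) (leqnn _); first by move=> i; exact: hpF.
pose p := rVpoly v; have [s pE] := closed_field_poly_normal p.
have p0 : p != 0.
  by apply: contraNneq v0 => p0; rewrite -(rVpolyK v) -/p p0 raddf0.
exists s; rewrite -pact_prod.
have : pact p h = 0.
  rewrite (@pactE d.+1) ?size_poly // -[RHS]hv; apply: eq_bigr => i _.
  by rewrite coef_rVpoly_ord.
have l0 : lead_coef p != 0 by rewrite lead_coef_eq0.
by rewrite pE pactZ => /eqP; rewrite scaler_eq0 (negPf l0) => /eqP.
Qed.

Definition eigen_dec y (ls : seq R) (Y : R -> A) := [/\ uniq ls, forall l, F (Y l),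
  forall l, l \in ls -> h ** Y l = l%:C *: Y l & y = \sum_(l <- ls) Y l].

Let eigen_orth l m a b : h ** a = l%:C *: a -> h ** b = m%:C *: b -> l != m -> star a ** b = 0.
Proof.
move=> ha hb lm; have : (l - m)%:C *: (star a ** b) = 0.
  rewrite rmorphB scalerBl.
  have -> : l%:C *: (star a ** b) = star (l%:C *: a) ** b by rewrite starZ_conjc conjcR cmulZl.
  have -> : m%:C *: (star a ** b) = star a ** (m%:C *: b) by rewrite cmulZr.
  by rewrite -ha -hb starM hsa cmulA subrr.
by move/eqP; rewrite scaler_eq0 => /orP[|/eqP //]; rewrite -(rmorph0 (real_complex R)) (inj_eq (@complexI R)) subr_eq0 (negPf lm).
Qed.

(** Induction on the roots: (h - z)y is already decomposed, and h - z is inverted on the components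
    whose eigenvalue is not z. The remainder [y0'] is mapped by h - z to the component at z, which
    self-adjointness of h forces to vanish. *)
Let eigen_exists s y : F y -> opl y s = 0 -> exists ls Y, eigen_dec y ls Y.
Proof.
elim: s y => [|z s IH] y Fy /= y0.
  by exists [::], (fun=> 0); split=> //; [move=> _; exact: fds0 fdF|rewrite big_nil].
have Fy' : F (h ** y - z *: y) by apply: fdB; [exact: (fdsM fdF)|exact: (fdsZ fdF)].
have [ls [Y [uls FY hY yE]]] := IH _ Fy' y0.
pose Z l := (l%:C - z)^-1 *: Y l.
have FZ l : F (Z l) by apply: (fdsZ fdF).
pose rest := \sum_(l <- ls | l%:C != z) Z l.
have Frest : F rest by apply: fd_sum.
have hZ l : l \in ls -> l%:C != z -> h ** Z l - z *: Z l = Y l.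
  move=> lls lz; rewrite /Z cmulZr hY // !scalerA -scalerBl [z * _]mulrC -mulrBr.
  by rewrite mulVf ?scale1r // subr_eq0.
pose y0' := y - rest.
have Fy0 : F y0' by exact: fdB.
pose Yz := \sum_(l <- ls | l%:C == z) Y l.
have hy0 : h ** y0' - z *: y0' = Yz.
  have -> : h ** y0' - z *: y0' = (h ** y - z *: y) - (h ** rest - z *: rest) by rewrite /y0'; salg.
  have -> : h ** rest - z *: rest = \sum_(l <- ls | l%:C != z) Y l.
    rewrite /rest cmul_sumr scaler_sumr -sumrB big_seq_cond [RHS]big_seq_cond.
    by apply: eq_bigr => l /andP[lls lz]; exact: hZ.
  by rewrite yE (bigID (fun l : R => l%:C == z)) /= addrK.
(* If z is not real, there is no component at z, and h y0' = z y0' implies (z - conj z) y0'^* y0' =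
   0, hence [y0'] is 0. *)
have [zr|znr] := pselect (exists r : R, z = r%:C); last first.
  have Yz0 : Yz = 0.
    by rewrite /Yz big1 // => l /eqP lz; case: znr; exists l.
  have yr : y = rest.
    apply/eqP; rewrite -subr_eq0; apply/eqP/star_mul_eq0; rewrite -/y0'.
    move: hy0; rewrite Yz0 => /eqP; rewrite subr_eq0 => /eqP hz.
    have : (z - conjc z) *: (star y0' ** y0') = 0.
      rewrite scalerBl.
      have -> : z *: (star y0' ** y0') = star y0' ** (z *: y0') by rewrite cmulZr.
      have -> : conjc z *: (star y0' ** y0') = star (z *: y0') ** y0'.
        by rewrite starZ_conjc cmulZl.
      by rewrite -hz starM hsa cmulA subrr.
    move/eqP; rewrite scaler_eq0 => /orP[|/eqP //]; rewrite subr_eq0 => /eqP zz.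
    by case: znr; exists (complex.Re z); move: zz; case: (z) => a b [] /eqP; rewrite -addr_eq0 -mulr2n mulrn_eq0 /= => /eqP ->.
  exists [seq l <- ls | l%:C != z], Z; split=> //; first exact: filter_uniq.
    by move=> l; rewrite mem_filter => /andP[lz lls]; rewrite /Z cmulZr hY // !scalerA mulrC.
  by rewrite big_filter.
have [r zE] := zr.
(* This excludes Jordan blocks: [Yz] is (h - z) y0', so Yz^* Yz = ((h - z) Yz)^* y0' = 0. *)
have Yz0 : Yz = 0.
  have [rls|rls] := boolP (r \in ls); last first.
    rewrite /Yz big_seq_cond big1 // => l /andP[lls /eqP]; rewrite zE => /complexI lr.
    by rewrite -lr lls in rls.
  have YzE : Yz = Y r.
    rewrite /Yz zE big_mkcond (bigD1_seq r) //= eqxx big1 ?addr0 // => l lr.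
    by rewrite (inj_eq (@complexI R)) (negPf lr).
  rewrite YzE; apply: star_mul_eq0; rewrite -{2}YzE -hy0 cmulBr cmulA -{1}hsa -starM hY //.
  by rewrite starZ_conjc conjcR cmulZl cmulZr zE subrr.
exists (r :: [seq l <- ls | l%:C != z]), (fun l => if l == r then y0' else Z l); split.
- by rewrite /= filter_uniq // andbT mem_filter zE eqxx.
- by move=> l; case: ifP.
- move=> l; rewrite inE; case: eqVneq => [->|lr] /=.
    by move=> _; move: hy0; rewrite Yz0 zE => /eqP; rewrite subr_eq0 => /eqP.
  by rewrite mem_filter => /andP[lz lls]; rewrite /Z cmulZr hY // !scalerA mulrC.
- rewrite big_cons eqxx big_filter.
  rewrite (eq_bigr Z); last first.
    by move=> l; rewrite zE (inj_eq (@complexI R)) => /negPf ->.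
  by rewrite -/rest subrK.
Qed.

(** The value 0 is left out because its projection would involve a unit. Functions are accordingly
    evaluated in [fcalc] as if they vanished at 0. *)
Definition spectral_dec (g : A) (ls : seq R) (P : R -> A) := [/\ uniq ls, 0 \notin ls,
  forall l, l \in ls -> [/\ F (P l), star (P l) = P l & P l ** P l = P l],
  forall l m, l \in ls -> m \in ls -> l != m -> P l ** P m = 0
  & g = \sum_(l <- ls) l%:C *: P l].

(** In the eigenvector decomposition of h itself, orthogonality gives Y_l^* Y_l = l Y_l^*. So Y_l is
    self-adjoint and l^-1 Y_l is a projection for l != 0, while Y_0 vanishes. *)
Theorem fd_spectral : exists ls P, spectral_dec h ls P.
Proof.
have [s hs] := annihilator.
have [ls [Y [uls FY hY yE]]] := eigen_exists Fh hs.
have YY l : l \in ls -> l%:C *: star (Y l) = star (Y l) ** Y l.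
  move=> lls; rewrite -(conjcR l) -starZ_conjc -hY // starM hsa {1}yE cmul_sumr.
  rewrite (bigD1_seq l) //= big1_seq ?addr0 // => m /andP[ml mls].
  by apply: (eigen_orth (hY _ lls) (hY _ mls)); rewrite eq_sym.
have Ysa l : l \in ls -> l != 0 -> star (Y l) = Y l.
  move=> lls l0; have E : star (Y l) = l^-1%:C *: (star (Y l) ** Y l).
    by rewrite -YY // scalerA -rmorphM mulVf // scale1r.
  by rewrite -[RHS]starK E starZ_conjc conjcR starM starK.
have YY2 l : l \in ls -> l != 0 -> Y l ** Y l = l%:C *: Y l.
  by move=> lls l0; rewrite -{1}(Ysa l) // -YY // Ysa.
exists [seq l <- ls | l != 0], (fun l => l^-1%:C *: Y l); split.
- exact: filter_uniq.
- by rewrite mem_filter eqxx.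
- move=> l; rewrite mem_filter => /andP[l0 lls]; split.
  + exact: (fdsZ fdF).
  + by rewrite starZ_conjc conjcR Ysa.
  + rewrite cmulZl cmulZr YY2 // !scalerA; congr (_ *: _).
    by rewrite -!rmorphM; congr (_ %:C); field.
- move=> l m; rewrite !mem_filter => /andP[l0 lls] /andP[m0 mls] lm.
  by rewrite cmulZl cmulZr -{1}(Ysa l) // (eigen_orth (hY _ lls) (hY _ mls) lm) !scaler0.
- rewrite {1}yE (bigID (fun l => l != 0)) /= [X in _ + X]big_seq_cond [X in _ + X]big1 ?addr0.
    rewrite big_filter; apply: eq_bigr => l l0.
    by rewrite scalerA -rmorphM divff // scale1r.
  move=> l /andP[lls /negPn/eqP l0]; apply: star_mul_eq0.
  by rewrite -YY // l0 scale0r.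
Qed.
End Spectral.

(** * Functional calculus of a self-adjoint element *)

Section FunCalc.
Variables (R : realType) (A : cstarType R) (F : set A).
Hypothesis fdF : fd_cstar_subalgebra F.
Variables (h : A) (ls : seq R) (P : R -> A).
Hypothesis hP : spectral_dec F h ls P.

Definition fcalc (f : R -> R) : A := \sum_(l <- ls) (f l)%:C *: P l.

Lemma fcalcF f : F (fcalc f).
Proof.
by apply: (fd_sum fdF) => l lls _; apply: (fdsZ fdF); case: hP => _ _ /(_ l lls)[].
Qed.
Lemma fcalc_star f : star (fcalc f) = fcalc f.
Proof.
rewrite /fcalc star_sum !big_seq; apply: eq_bigr => l lls.
by rewrite starZ_conjc conjcR; case: hP => _ _ /(_ l lls)[_ ->].
Qed.
Lemma fcalc_mulP f l : l \in ls -> fcalc f ** P l = (f l)%:C *: P l.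
Proof.
case: hP => uls _ h1 h2 _ lls; rewrite /fcalc cmul_suml (bigD1_seq l) //=.
have [_ _ pp] := h1 _ lls; rewrite cmulZl pp big1_seq ?addr0 // => m /andP[ml mls].
by rewrite cmulZl h2 // scaler0.
Qed.
Lemma fcalcM f g : fcalc f ** fcalc g = fcalc (fun l => f l * g l).
Proof.
rewrite [fcalc g]/fcalc cmul_sumr [RHS]/fcalc !big_seq; apply: eq_bigr => l lls.
by rewrite cmulZr fcalc_mulP // scalerA -rmorphM mulrC.
Qed.
Lemma fcalcB f g : fcalc f - fcalc g = fcalc (fun l => f l - g l).
Proof. by rewrite /fcalc -sumrB; apply: eq_bigr => l _; rewrite rmorphB scalerBl. Qed.
Lemma fcalc_id : fcalc id = h. Proof. by case: hP. Qed.
Lemma eq_fcalc f g : {in ls, f =1 g} -> fcalc f = fcalc g.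
Proof. by move=> fg; rewrite /fcalc !big_seq; apply: eq_bigr => l /fg ->. Qed.
Lemma proj_rnorm (p : A) : star p = p -> p ** p = p -> rnorm p <= 1.
Proof.
move=> ps pp; have := rnorm_cstar p; rewrite ps pp => /eqP.
rewrite expr2 -subr_eq0 -{1}(mulr1 (rnorm p)) -mulrBr mulf_eq0 subr_eq0.
by move=> /orP[/eqP ->|/eqP ->].
Qed.
(** The triangle inequality gives the bound with the factor [size ls], for every power of f;
    repeated squaring removes the factor. *)
Lemma fcalc_rnorm f (K : R) : 0 <= K -> {in ls, forall l, `|f l| <= K} -> rnorm (fcalc f) <= K.
Proof.
move=> K0 fK; pose u k := fcalc (fun l => f l ^+ (2 ^ k)).
have u0 : u 0%N = fcalc f by apply: eq_fcalc.
rewrite -u0; apply: (@rnorm_le_iter_sqr R A u (size ls)%:R) => //.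
- by move=> k; rewrite /u fcalcM; apply: eq_fcalc => l _; rewrite expnS mul2n -addnn exprD.
- exact: fcalc_star.
- move=> k; apply: le_trans (rnorm_sum _ _ _) _.
  rewrite mulr_natl -[size ls]count_predT -iter_addr_0 -big_const_seq big_seq [leRHS]big_seq.
  apply: ler_sum => l lls; rewrite rnormZ cabsR normrX -[leRHS]mulr1.
  apply: ler_pM; rewrite ?exprn_ge0 ?rnorm_ge0 //.
    by apply: lerXn2r; rewrite ?nnegrE ?normr_ge0 // fK.
  by case: hP => _ _ /(_ l lls)[_ ps pp] _ _; exact: proj_rnorm.
Qed.
End FunCalc.

(** * Norm bounds by truncation of the spectrum *)

Section Truncation.
Variables (R : realType) (A : cstarType R) (F : set A).
Hypothesis fdF : fd_cstar_subalgebra F.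

(* Truncating the spectrum of [a] is the metric projection onto the ball of radius [C],
   simultaneously for all tracial 2-norms. *)
Lemma truncate_sa (C : R) (a b : A) : 0 <= C -> F a -> star a = a -> star b = b -> rnorm b <= C ->
  exists a', [/\ F a', rnorm a' <= C
    & forall tau, is_trace tau -> trace_norm2 tau (a' - b) <= trace_norm2 tau (a - b)].
Proof.
move=> C0 Fa sa sb bC; have [ls [P hP]] := fd_spectral fdF Fa sa.
pose f (l : R) := Num.max (- C) (Num.min l C); pose d (l : R) := l - f l.
(* The variational inequality of the projection of the line onto [-C, C]. It is used with t the
   average of b over [P l], which lies in [-C, C] by [trace_sandwich_sa]. *)
have dP (l t : R) : `|t| <= C -> 0 <= d l * (f l - t).
  rewrite ler_norml => /andP[t1 t2]; rewrite /d /f.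
  rewrite /Num.max /Num.min; case: (ltP l C) => lC; case: ltP => h; nra.
exists (fcalc ls P f); split.
- exact: (fcalcF fdF hP).
- apply: (fcalc_rnorm hP) => // l _; rewrite ler_norml /f.
  rewrite /Num.max /Num.min; case: (ltP l C) => lC; case: ltP => h; lra.
- move=> tau ht; rewrite ler_sqrt ?trace_sqr_ge0 //.
  have -> : a - b = fcalc ls P d + (fcalc ls P f - b).
    by rewrite /d -(fcalcB ls P id f) (fcalc_id hP) addrA subrK.
  rewrite [leRHS]trace_sqrD // -[leLHS]add0r lerD2r addr_ge0 ?trace_sqr_ge0 // mulrn_wge0 //.
  rewrite (fcalc_star hP) cmulBr (fcalcM hP) /fcalc cmul_suml -sumrB.
  rewrite (tau_sum ht) raddf_sum /= big_seq; apply: sumr_ge0 => l lls.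
  case: hP => _ _ /(_ l lls) [_ Ps PP] _ _.
  have tP : tau (P l) = (trace_sqr tau (P l))%:C by rewrite -trace_sqrE // Ps PP.
  have tPb : tau (P l ** b) = tau (star (P l) ** b ** P l).
    by rewrite (tauC ht (_ ** _)) cmulA Ps PP.
  rewrite cmulZl (tauB ht) !(tauZ ht) tP tPb ReD ReN !ReRM /=.
  set q := trace_sqr tau (P l).
  have : `|complex.Re (tau (star (P l) ** b ** P l))| <= C * q.
    apply: le_trans (Re_le_cabs _) _; apply: le_trans (trace_sandwich_sa ht _ sb) _.
    by rewrite ler_wpM2r // trace_sqr_ge0.
  set t := complex.Re _ => tq; have : 0 <= q by exact: trace_sqr_ge0.
  rewrite le_eqVlt => /predU1P[q0|q0].
    move: tq; rewrite -q0 !mulr0 normr_le0 => /eqP ->; rewrite !mulr0 subr0 ?mul0r //.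
  have := @dP l (t / q); rewrite normf_div (gtr0_norm q0) ler_pdivrMr // => /(_ tq).
  rewrite -(pmulr_lge0 _ q0) => /le_trans; apply; apply: eq_le_num.
  by rewrite /=; field; rewrite gt_eqF.
Qed.

(** Real and imaginary parts are truncated separately, which costs the factor 2 in both
    estimates. *)
Lemma truncate (C : R) (a b : A) : 0 <= C -> F a -> rnorm b <= C ->
  exists a', [/\ F a', rnorm a' <= C * 2
    & forall tau, is_trace tau -> trace_norm2 tau (a' - b) <= 2 * trace_norm2 tau (a - b)].
Proof.
move=> C0 Fa bC.
pose re (x : A) := (2^-1)%:C *: (x + star x).
pose im (x : A) := (2^-1)%:C *: ('i%C *: (star x - x)).
have re_sa x : star (re x) = re x by rewrite /re; salg.
have im_sa x : star (im x) = im x by rewrite /im; salg.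
have reimE x : x = re x + 'i%C *: im x.
  have h2 : (2^-1)%:C + (2^-1)%:C = 1 :> R[i] by rewrite -rmorphD -(rmorph1 (real_complex R)); congr (_%:C); lra.
  by rewrite -{1}(scale1r x) -h2 /re /im; salg; ring: (mulii R).
have Fre x : F x -> F (re x).
  by move=> Fx; apply: (fdsZ fdF); apply: (fdsD fdF) => //; exact: (fds_star fdF).
have Fim x : F x -> F (im x).
  move=> Fx; apply: (fdsZ fdF); apply: (fdsZ fdF); apply: (fdB fdF) => //.
  exact: (fds_star fdF).
have half0 : cabs (2^-1)%:C = 2^-1 :> R by rewrite cabsR ger0_norm.
have re_le x : rnorm (re x) <= rnorm x.
  rewrite /re rnormZ half0; have := rnormD x (star x); rewrite rnorm_star; lra.
have im_le x : rnorm (im x) <= rnorm x.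
  rewrite /im !rnormZ half0 cabsi; have := rnormB (star x) x; rewrite rnorm_star; lra.
have reB x y : re x - re y = re (x - y) by rewrite /re; salg.
have imB x y : im x - im y = im (x - y) by rewrite /im; salg.
have [a1 [Fa1 a1C h1]] := truncate_sa C0 (Fre _ Fa) (re_sa a) (re_sa b) (le_trans (re_le b) bC).
have [a2 [Fa2 a2C h2]] := truncate_sa C0 (Fim _ Fa) (im_sa a) (im_sa b) (le_trans (im_le b) bC).
exists (a1 + 'i%C *: a2); split.
- by apply: (fdsD fdF) => //; exact: (fdsZ fdF).
- by apply: le_trans (rnormD _ _) _; rewrite rnormZ cabsi; lra.
- move=> tau ht; have -> : a1 + 'i%C *: a2 - b = (a1 - re b) + 'i%C *: (a2 - im b).
    by rewrite {1}(reimE b) scalerBr opprD addrACA.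
  apply: le_trans (trace_norm2D ht _ _) _; rewrite trace_norm2Z // cabsi mul1r.
  rewrite mulr_natl mulr2n; apply: lerD.
    apply: le_trans (h1 _ ht) _; rewrite reB /re trace_norm2Z // half0.
    have := trace_norm2D ht (a - b) (star (a - b)); rewrite trace_norm2_star //; lra.
  apply: le_trans (h2 _ ht) _; rewrite imB /im !trace_norm2Z // half0 cabsi.
  have := trace_norm2D ht (star (a - b)) (- (a - b)); rewrite trace_norm2N // trace_norm2_star //; lra.
Qed.
End Truncation.

(** * From almost idempotent elements to projections *)

Section AlmostProjection.
Variables (R : realType) (M : tcAlgebra R) (F : set M).
Hypothesis fdF : fd_cstar_subalgebra F.
Local Notation N := (norm2 (@tc_traces R M)).

Lemma truncate_norm2 (C : R) (a b : M) : 0 <= C -> F a -> rnorm b <= C ->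
  exists a', [/\ F a', rnorm a' <= C * 2 & N (a' - b) <= 2 * N (a - b)].
Proof.
move=> C0 Fa bC; have [a' [Fa' a'C h]] := truncate fdF C0 Fa bC; exists a'; split=> //.
apply: norm2_le; first by rewrite mulr_ge0 ?norm2_ge0.
move=> tau Xt; apply: le_trans (h _ (tcX Xt)) _; rewrite ler_wpM2l //; exact: norm2_ub.
Qed.

(** On the part of the spectrum above 1/2, g is 1, k is h^(-1/2) and g' is h^(-1); all three are 0
    elsewhere. The relation g = h g' passes left annihilators of h on to g. For h = y^* y, the
    relation k h k = g says that y k is a partial isometry with source g. *)
Lemma almost_projection (h : M) : F h -> star h = h -> exists g k g' : M,
  [/\ F g, F k & g = h ** g'] /\ [/\ star g = g, g ** g = g, star k = k & k ** h ** k = g] /\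
  [/\ rnorm k <= 2, N (g - h) <= 5 * N (h ** h - h) & N (k - h) <= 5 * N (h ** h - h)].
Proof.
move=> Fh sh; have [ls [P hP]] := fd_spectral fdF Fh sh.
have half : (0 : R) < 1/2 by lra.
pose fg (l : R) : R := if 1/2 < l then 1 else 0.
pose fk (l : R) : R := if 1/2 < l then (Num.sqrt l)^-1 else 0.
pose fi (l : R) : R := if 1/2 < l then l^-1 else 0.
(* The quotients (f(l) - l) / (l^2 - l) stay below 5 in absolute value for [fg] and for [fk],
   because l^2 - l vanishes only at 0 and 1, where both functions agree with l. *)
have est (f : R -> R) : (forall l, exists2 m : R, `|m| <= 5 & f l - l = m * (l * l - l)) ->
    N (fcalc ls P f - h) <= 5 * N (h ** h - h).
  move=> H; have /choice [m mE] : forall l, exists m : R, `|m| <= 5 /\ f l - l = m * (l * l - l).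
    by move=> l; have [m] := H l; exists m.
  have -> : fcalc ls P f - h = fcalc ls P m ** (h ** h - h).
    have hE := fcalc_id hP.
    have -> : fcalc ls P f - h = fcalc ls P (fun l => f l - l).
      by rewrite -(fcalcB ls P f id) hE.
    have -> : h ** h - h = fcalc ls P (fun l => l * l - l).
      by rewrite -(fcalcB ls P (fun l => l * l) id) -(fcalcM hP id id) hE.
    rewrite (fcalcM hP).
    by apply: eq_fcalc => l _; have [_ ->] := mE l.
  apply: le_trans (norm2Ml _ _) _; rewrite ler_wpM2r ?norm2_ge0 //.
  by apply: (fcalc_rnorm hP) => // l _; have [] := mE l.
have sq (l : R) : 1/2 < l -> 1/2 < Num.sqrt l /\ Num.sqrt l ^+ 2 = l.
  move=> hl; have l0 : 0 <= l by lra.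
  have E := sqr_sqrtr l0; have s0 := sqrtr_ge0 l; split=> //; nra.
exists (fcalc ls P fg), (fcalc ls P fk), (fcalc ls P fi); split; [split|split; split].
- exact: (fcalcF fdF hP).
- exact: (fcalcF fdF hP).
- rewrite -[X in X ** _](fcalc_id hP) (fcalcM hP); apply: eq_fcalc => l _; rewrite /fg /fi.
  by case: ifP => hl; rewrite ?mulr0 // divff // gt_eqF //; lra.
- exact: (fcalc_star hP).
- rewrite (fcalcM hP); apply: eq_fcalc => l _; rewrite /fg; case: ifP; lra.
- exact: (fcalc_star hP).
- rewrite -[X in _ ** X ** _](fcalc_id hP) !(fcalcM hP); apply: eq_fcalc => l _; rewrite /fg /fk.
  case: ifP => hl; rewrite ?mulr0 //; have [s0 sE] := sq _ hl.
  by rewrite -{2}sE; field; rewrite gt_eqF //; lra.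
- apply: (fcalc_rnorm hP) => // l _; rewrite /fk; case: ifP => hl; last by rewrite normr0.
  have [s0 sE] := sq _ hl; rewrite normfV gtr0_norm; last by lra.
  by rewrite -(invrK 2) lef_pV2 ?posrE //; lra.
- apply: est => l; rewrite /fg; case: ifP => hl.
    exists (- l^-1); last by field; rewrite gt_eqF //; lra.
    rewrite normrN normfV gtr0_norm; last by lra.
    by rewrite -(invrK 5) lef_pV2 ?posrE ?invr_gt0 //; lra.
  have hl' : l <= 1/2 by rewrite leNgt hl.
  exists (1 - l)^-1; last by field; rewrite gt_eqF //; lra.
  rewrite normfV gtr0_norm; last by lra.
  by rewrite -(invrK 5) lef_pV2 ?posrE ?invr_gt0 //; lra.
- apply: est => l; rewrite /fk; case: ifP => hl.
    have [s0 sE] := sq _ hl; move: s0 sE; set s := Num.sqrt l => s0 sE.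
    exists (- ((1 + s + s ^+ 2) / (s ^+ 3 * (1 + s)))); last first.
      by rewrite -sE; field; rewrite !gt_eqF //; lra.
    have d0 : 0 < s ^+ 3 * (1 + s) by rewrite mulr_gt0 ?exprn_gt0 //; lra.
    rewrite normrN ger0_norm; last by rewrite divr_ge0 ?(ltW d0) //; nra.
    rewrite ler_pdivrMr //; nra.
  have hl' : l <= 1/2 by rewrite leNgt hl.
  exists (1 - l)^-1; last by field; rewrite gt_eqF //; lra.
  rewrite normfV gtr0_norm; last by lra.
  by rewrite -(invrK 5) lef_pV2 ?posrE ?invr_gt0 //; lra.
Qed.
End AlmostProjection.

(** * Matrix units *)

Section MatrixUnits.
Variables (R : realType) (A : cstarType R).

(* A block system of matrix units: the units of row and column indices in the same class of [rho]
   are [v i ** star (v j)], and [v (rho i)] is the diagonal unit chosen in the class of [i]. *)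
Definition msys (r : nat) (rho : nat -> nat) (v : nat -> A) : Prop :=
  forall i j, (i < r)%N -> (j < r)%N -> star (v i) ** v j = if i == j then v (rho i) else 0.
(** A representative does not exceed the members of its class, so every initial segment of the
    indices is again a block system; this permits induction on the number of units. *)
Definition blocks (r : nat) (rho : nat -> nat) : Prop :=
  forall i, (i < r)%N -> (rho i <= i)%N /\ rho (rho i) = rho i.
Definition mspan (r : nat) (rho : nat -> nat) (v : nat -> A) : set A :=
  [set x | exists c : nat -> nat -> R[i],
    x = \sum_(i < r) \sum_(j < r | rho i == rho j) c i j *: (v i ** star (v j))].
End MatrixUnits.

(** * Structure of finite dimensional subalgebras *)

Section Structure.
Variables (R : realType) (M : tcAlgebra R) (F : set M).
Hypothesis fdF : fd_cstar_subalgebra F.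
Implicit Types (x y h : M) (p q : nat -> M).

Definition proj_family (n : nat) p : Prop :=
  (forall i, (i < n)%N -> [/\ F (p i), star (p i) = p i, p i ** p i = p i & p i != 0]) /\
  (forall i j, (i < n)%N -> (j < n)%N -> i != j -> p i ** p j = 0).

(** Nonzero orthogonal projections are linearly independent, which bounds n. Maximal length, rather
    than maximality under inclusion, also makes the members minimal projections: splitting one would
    lengthen the family. *)
Lemma proj_family_max : exists n p, proj_family n p /\ forall m q, proj_family m q -> (m <= n)%N.
Proof.
have [d hd] := fd_lin_dep fdF.
pose E n := `[< exists p, proj_family n p >].
have E0 : exists n, E n by exists 0%N; apply/asboolP; exists (fun=> 0); split.
have Eb n : E n -> (n <= d)%N.
  move=> /asboolP [p [h1 h2]]; rewrite leqNgt; apply/negP => dn.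
  have [|v v0 hv] := hd n (fun i : 'I_n => p i) dn; first by move=> i; have [] := h1 _ (ltn_ord i).
  case/eqP: v0; apply/rowP => j; rewrite mxE.
  have : (\sum_(i < n) v 0 i *: p i) ** p j = 0 by rewrite hv cmul0r.
  rewrite cmul_suml (bigD1 j) //= big1 ?addr0.
    have [_ _ pp p0] := h1 _ (ltn_ord j).
    by rewrite cmulZl pp => /eqP; rewrite scaler_eq0 (negPf p0) orbF => /eqP.
  by move=> i ij; rewrite cmulZl h2 ?scaler0.
have [n /asboolP [p hp] nmax] := ex_maxnP E0 Eb; exists n, p; split=> // m q hq.
by apply: nmax; apply/asboolP; exists q.
Qed.

Section Max.
Variables (r : nat) (p : nat -> M).
Hypotheses (hp : proj_family r p) (rmax : forall m q, proj_family m q -> (m <= r)%N).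

Let Fp i : (i < r)%N -> F (p i). Proof. by case/(proj1 hp). Qed.
Let ps i : (i < r)%N -> star (p i) = p i. Proof. by case/(proj1 hp). Qed.
Let pp i : (i < r)%N -> p i ** p i = p i. Proof. by case/(proj1 hp). Qed.
Let p0 i : (i < r)%N -> p i != 0. Proof. by case/(proj1 hp). Qed.
Let porth i j : (i < r)%N -> (j < r)%N -> i != j -> p i ** p j = 0.
Proof. exact: (proj2 hp). Qed.
Let pE i j : (i < r)%N -> (j < r)%N -> p i ** p j = if i == j then p i else 0.
Proof. by move=> ir jr; case: eqVneq => [<-|ij]; [exact: pp|exact: porth]. Qed.

Let spectral_nonzero h : F h -> star h = h -> h != 0 -> exists ls P l,
  [/\ spectral_dec F h ls P, l \in ls, P l != 0 & l != 0].
Proof.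
move=> Fh sh h0; have [ls [P hP]] := fd_spectral fdF Fh sh; exists ls, P.
have [[l lls Pl]|nl] := pselect (exists2 l, l \in ls & P l != 0).
  by exists l; split=> //; case: hP => _ l0 _ _ _; apply: contraNneq l0 => <-.
case/eqP: h0; case: (hP) => _ _ _ _ ->; rewrite big1_seq // => l /andP[_ lls].
by have [->|Pl] := eqVneq (P l) 0; [rewrite scaler0|case: nl; exists l].
Qed.

Let spectral_mul h ls P l : spectral_dec F h ls P -> l \in ls ->
  l%:C *: P l = h ** P l /\ l%:C *: P l = P l ** h.
Proof.
move=> hP lls; have e : h ** P l = l%:C *: P l by rewrite -{1}(fcalc_id hP) (fcalc_mulP hP).
have sh : star h = h by rewrite -(fcalc_id hP) (fcalc_star hP).
split=> //; case: hP => _ _ /(_ l lls) [_ Ps _] _ _.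
by rewrite -{2}Ps -sh -starM e starZ_conjc conjcR Ps.
Qed.

Let orth_zero h : F h -> star h = h -> (forall i, (i < r)%N -> h ** p i = 0) -> h = 0.
Proof.
move=> Fh sh hp0; apply/eqP; apply: contraT => /(spectral_nonzero Fh sh) [ls [P [l [hP lls Pl0 l0]]]].
have [e1 e2] := spectral_mul hP lls.
have [FP Ps PP] : [/\ F (P l), star (P l) = P l & P l ** P l = P l] by case: hP => _ _ /(_ l lls).
have Pp i : (i < r)%N -> P l ** p i = 0.
  move=> ir; have : l%:C *: (P l ** p i) = 0 by rewrite -cmulZl e2 -cmulA hp0 // cmulr0.
  by move/eqP; rewrite scaler_eq0 -(rmorph0 (real_complex R)) (inj_eq (@complexI R)) (negPf l0) => /eqP.
have pP i : (i < r)%N -> p i ** P l = 0.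
  by move=> ir; rewrite -(ps ir) -Ps -starM Pp // star0.
suff /rmax : proj_family r.+1 (fun i => if (i < r)%N then p i else P l) by rewrite ltnn.
split=> [i _|i j]; first by case: ifP => ir; split=> //; [exact: Fp|exact: ps|exact: pp|exact: p0].
rewrite !ltnS; case: (ltnP i r) => [ir _|ri ir]; case: (ltnP j r) => [jr _|rj jr] ij //.
- exact: porth.
- exact: pP.
- exact: Pp.
- by case/eqP: ij; apply/eqP; rewrite eqn_leq (leq_trans ir rj) (leq_trans jr ri).
Qed.

Let e := \sum_(i < r) p i.

Let e_p i : (i < r)%N -> e ** p i = p i.
Proof.
move=> ir; rewrite /e cmul_suml (bigD1 (Ordinal ir)) //= pp // big1 ?addr0 // => j ji.
by rewrite porth.
Qed.

(** With z = y - ye, the element z^* z annihilates every [p i]; a spectral projection of it could be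
    added to the family, so it is 0. *)
Lemma max_family_unit x : F x -> x ** e = x /\ e ** x = x.
Proof.
have Fe : F e by apply: (fd_sum fdF) => i _ _; exact: Fp.
have se : star e = e by rewrite /e star_sum; apply: eq_bigr => i _; exact: ps.
suff H y : F y -> y ** e = y.
  by move=> Fx; split; [exact: H|rewrite -(starK x) -{1}se -starM H //; exact: (fds_star fdF)].
move=> Fy; apply/eqP; rewrite -subr_eq0 -opprB oppr_eq0; apply/eqP/star_mul_eq0.
have Fz : F (y - y ** e) by apply: (fdB fdF) => //; exact: (fdsM fdF).
apply: orth_zero; first by apply: (fdsM fdF) => //; exact: (fds_star fdF).
  by rewrite starM starK.
by move=> i ir; rewrite -cmulA cmulBl -(cmulA y) e_p // subrr cmulr0.
Qed.

(** Spectral projections of h lie under [p i]. If one differed from [p i], it and the complement in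
    [p i] would replace [p i] in a longer family. *)
Let corner_sa i h : (i < r)%N -> F h -> star h = h -> p i ** h = h -> exists c : R, h = c%:C *: p i.
Proof.
move=> ir Fh sh ph.
have [->|/(spectral_nonzero Fh sh) [ls [P [l [hP lls Pl0 l0]]]]] := eqVneq h 0.
  by exists 0; rewrite scale0r.
have lC : l%:C != 0 by rewrite -(rmorph0 (real_complex R)) (inj_eq (@complexI R)).
have pP m : m \in ls -> p i ** P m = P m /\ P m ** p i = P m.
  move=> mls; have [e1 e2] := spectral_mul hP mls.
  have mC : m%:C != 0.
    rewrite -(rmorph0 (real_complex R)) (inj_eq (@complexI R)).
    by case: hP => _ m0 _ _ _; apply: contraNneq m0 => <-.
  have E : p i ** P m = P m.
    by apply: (scalerI mC); rewrite -cmulZr e1 cmulA ph.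
  split=> //; case: hP => _ _ /(_ m mls) [_ Ps _] _ _.
  by rewrite -{1}Ps -(ps ir) -starM E Ps.
have [FP Ps PP] : [/\ F (P l), star (P l) = P l & P l ** P l = P l] by case: hP => _ _ /(_ l lls).
have [pP1 pP2] := pP _ lls.
have Pp : P l = p i.
  apply/eqP; apply: contraT => Plp.
  suff /rmax : proj_family r.+1 (fun j => if (j < r)%N then (if j == i then p i - P l else p j) else P l).
    by rewrite ltnn.
  have op j : (j < r)%N -> j != i -> P l ** p j = 0 /\ p j ** P l = 0.
    move=> jr ji; split; first by rewrite -pP2 -cmulA porth ?cmulr0 // eq_sym.
    by rewrite -pP1 cmulA porth ?cmul0r.
  split=> [j _|j k].
    case: ifP => jr //; case: eqVneq => ji; last by split; [exact: Fp|exact: ps|exact: pp|exact: p0].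
    split; first by apply: (fdB fdF) => //; exact: Fp.
    - by rewrite starB Ps ps.
    - by rewrite cmulBl !cmulBr pp // PP pP1 pP2 subrr subr0.
    - by rewrite subr_eq0 eq_sym.
  rewrite !ltnS; case: (ltnP j r) => [jr _|rj jr]; case: (ltnP k r) => [kr _|rk kr] jk //.
  - case: (eqVneq j i) => ji; case: (eqVneq k i) => ki.
    + by rewrite ji ki eqxx in jk.
    + by rewrite cmulBl porth // ?sub0r; [have [-> _] := op _ kr ki; rewrite oppr0|rewrite eq_sym].
    + by rewrite cmulBr porth // ?sub0r; have [_ ->] := op _ jr ji; rewrite oppr0.
    + exact: porth.
  - case: (eqVneq j i) => ji; first by rewrite cmulBl pP1 PP subrr.
    by have [_ ->] := op _ jr ji.
  - case: (eqVneq k i) => ki; first by rewrite cmulBr pP2 PP subrr.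
    by have [-> _] := op _ kr ki.
  - by case/eqP: jk; apply/eqP; rewrite eqn_leq (leq_trans jr rk) (leq_trans kr rj).
exists l; rewrite -Pp; case: (hP) => uls _ _ orth {1}->.
rewrite (bigD1_seq l) //= big1_seq ?addr0 // => m /andP[ml mls].
by have [<- _] := pP _ mls; rewrite -Pp orth ?scaler0 // eq_sym.
Qed.

Let corner i x : (i < r)%N -> F x -> p i ** x = x -> x ** p i = x -> exists c : R[i], x = c *: p i.
Proof.
move=> ir Fx px xp; have Fs := fds_star fdF Fx.
have psx : p i ** star x = star x by rewrite -{1}(ps ir) -starM xp.
have [||a aE] := @corner_sa i (x + star x) ir (fdsD fdF Fx Fs).
- by salg.
- by rewrite cmulDr px psx.
have [|||b bE] := @corner_sa i ('i%C *: (star x - x)) ir.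
- by apply: (fdsZ fdF); exact: (fdB fdF).
- by salg.
- by rewrite cmulZr cmulBr px psx.
exists (2^-1 * (a%:C + 'i%C * b%:C)); rewrite -scalerA scalerDl -[('i%C * _) *: _]scalerA -aE -bE.
rewrite scalerA mulii scaleN1r opprB addrACA addrC subrr add0r.
by rewrite scalerDr -scalerDl (_ : 2^-1 + 2^-1 = 1) ?scale1r //; field.
Qed.

Let piso i j (v : M) := [/\ F v, star v ** v = p j & v ** star v = p i].

Let piso_mul i j v : (i < r)%N -> (j < r)%N -> piso i j v ->
  [/\ v ** p j = v, p i ** v = v, p j ** star v = star v & star v ** p i = star v].
Proof.
move=> ir jr [_ h1 h2].
have vp : v ** p j = v.
  apply/eqP; rewrite -subr_eq0; apply/eqP/star_mul_eq0.
  have -> : star (v ** p j - v) ** (v ** p j - v) = star (p j) ** (star v ** v) ** p j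
     - star (p j) ** (star v ** v) - (star v ** v) ** p j + star v ** v by salg.
  by rewrite h1 ps // !pp // !subrr sub0r addNr.
have pv : p i ** v = v by rewrite -h2 -cmulA h1.
split=> //; first by rewrite -(ps jr) -starM vp.
by rewrite -(ps ir) -starM pv.
Qed.

(** The sign of c is read off from a trace in X that does not vanish at [p j]; one exists since the
    uniform 2-norm is a norm. *)
Let positive_coeff x j c : (j < r)%N -> star x ** x = c%:C *: p j -> x != 0 -> 0 < c.
Proof.
move=> jr xx x0.
have [[tau Xt tp]|nt] := pselect (exists2 tau, tc_traces tau & trace_sqr tau (p j) != 0).
  have ht := tcX Xt; have tp0 : 0 < trace_sqr tau (p j) by rewrite lt_def tp trace_sqr_ge0.
  have : 0 <= c * trace_sqr tau (p j).
    have := trace_sqr_ge0 ht x; rewrite /trace_sqr xx tauZ //.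
    by rewrite -{1}(pp jr) -{1}(ps jr) trace_sqrE // -rmorphM.
  rewrite pmulr_lge0 // le_eqVlt => /predU1P[c0|//].
  by case/eqP: x0; apply: star_mul_eq0; rewrite xx -c0 scale0r.
case/eqP: (p0 jr); apply: norm2_eq0; apply/eqP; rewrite eq_le norm2_ge0 andbT.
apply: norm2_le => // tau Xt; rewrite /trace_norm2.
have [->|h] := eqVneq (trace_sqr tau (p j)) 0; first by rewrite sqrtr0.
by case: nt; exists tau.
Qed.

Let corner_piso i j x : (i < r)%N -> (j < r)%N -> F x -> p i ** x = x -> x ** p j = x -> x != 0 ->
  exists v, piso i j v.
Proof.
move=> ir jr Fx px xp x0; have Fs := fds_star fdF Fx.
have [|||c cE] := @corner_sa j (star x ** x) jr; first exact: (fdsM fdF).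
- by rewrite starM starK.
- by rewrite -{1}(ps jr) cmulA -starM xp.
have c0 := positive_coeff jr cE x0.
have s0 : 0 < Num.sqrt c by rewrite sqrtr_gt0.
pose v := (Num.sqrt c)^-1%:C *: x.
have Fv : F v by exact: (fdsZ fdF).
have vv : star v ** v = p j.
  rewrite /v starZ_conjc conjcR cmulZl cmulZr cE !scalerA -!rmorphM.
  rewrite -{3}(sqr_sqrtr (ltW c0)) (_ : _ * _ = 1) ?scale1r //.
  by field; rewrite gt_eqF.
have v0 : v != 0 by apply: contraNneq (p0 jr) => v0; rewrite -vv v0 cmulr0.
have [|||d dE] := @corner_sa i (v ** star v) ir; first by apply: (fdsM fdF) => //; exact: (fds_star fdF).
- by rewrite starM starK.
- by rewrite cmulA /v cmulZr px.
exists v; split=> //; rewrite dE.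
have vp : v ** p j = v by rewrite /v cmulZl xp.
have : (v ** star v) ** (v ** star v) = v ** star v by rewrite cmulA -(cmulA v) vv vp.
rewrite dE cmulZl cmulZr pp // scalerA => /eqP; rewrite -subr_eq0 -scalerBl scaler_eq0 (negPf (p0 ir)) orbF.
rewrite -rmorphM -rmorphB -(rmorph0 (real_complex R)) (inj_eq (@complexI R)).
rewrite (_ : d * d - d = d * (d - 1)); last by ring.
rewrite mulf_eq0 subr_eq0.
case/orP => [/eqP d0|/eqP ->]; last by rewrite scale1r.
by case/eqP: v0; rewrite -(starK v) (_ : star v = 0) ?star0 //; apply: star_mul_eq0; rewrite starK dE d0 scale0r.
Qed.

(** The blocks are the classes of Murray-von Neumann equivalence among the minimal projections. A
    corner p_i x p_j is 0 between different classes, since a nonzero one would yield a partial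
    isometry, and a multiple of the matrix unit within a class. *)
Theorem structure_of_max : exists rho v, [/\ blocks r rho, msys r rho v, forall i, (i < r)%N -> v i != 0,
  forall i, (i < r)%N -> v i ** star (v i) = p i & forall x, F x <-> mspan r rho v x].
Proof.
pose rel i j := `[< exists v, piso i j v >].
have relxx i : (i < r)%N -> rel i i.
  by move=> ir; apply/asboolP; exists (p i); split; rewrite ?ps ?pp //; exact: Fp.
have rel_sym i j : rel i j -> rel j i.
  move=> /asboolP [v [Fv h1 h2]]; apply/asboolP; exists (star v).
  by split; rewrite ?starK //; exact: (fds_star fdF).
have rel_trans i j k : (i < r)%N -> (j < r)%N -> (k < r)%N -> rel i j -> rel j k -> rel i k.
  move=> ir jr kr /asboolP [v hv] /asboolP [w hw]; apply/asboolP; exists (v ** w).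
  have [vp pv psv svp] := piso_mul ir jr hv; have [wp pw psw swp] := piso_mul jr kr hw.
  case: hv hw => [Fv v1 v2] [Fw w1 w2].
  split; first exact: (fdsM fdF).
    by rewrite starM cmulA -(cmulA (star w)) v1 -cmulA pw.
  by rewrite starM cmulA -(cmulA v) w2 vp.
pose rho i := if (i < r)%N then find (rel i) (iota 0 r) else i.
have rhoP i : (i < r)%N -> [/\ (rho i <= i)%N, rel i (rho i) & forall j, (j < r)%N -> rel i j -> (rho i <= j)%N].
  move=> ir; rewrite /rho ir.
  have le j : (j < r)%N -> rel i j -> (find (rel i) (iota 0 r) <= j)%N.
    move=> jr rij; rewrite leqNgt; apply/negP => /(before_find 0%N).
    by rewrite nth_iota // add0n rij.
  split=> //; first by apply: le => //; exact: relxx.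
  have hh : has (rel i) (iota 0 r).
    by apply/hasP; exists i; rewrite ?mem_iota ?relxx.
  have := nth_find 0%N hh; rewrite nth_iota ?add0n //.
  by move: hh; rewrite has_find size_iota.
have rho_lt i : (i < r)%N -> (rho i < r)%N by move=> ir; have [h _ _] := rhoP _ ir; exact: leq_ltn_trans h ir.
have rho_eq i j : (i < r)%N -> (j < r)%N -> rel i j -> rho i = rho j.
  move=> ir jr rij; apply/eqP; rewrite eqn_leq.
  have [_ ri mi] := rhoP _ ir; have [_ rj mj] := rhoP _ jr.
  apply/andP; split.
    by apply: mi; [exact: rho_lt|exact: (rel_trans _ _ _ ir jr (rho_lt _ jr) rij rj)].
  by apply: mj; [exact: rho_lt|exact: (rel_trans _ _ _ jr ir (rho_lt _ ir) (rel_sym _ _ rij) ri)].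
have rho_rho i : (i < r)%N -> rho (rho i) = rho i.
  by move=> ir; apply/esym/rho_eq => //; [exact: rho_lt|have [] := rhoP _ ir].
(* At a representative the partial isometry has to be the projection itself, because [msys] uses
   [v (rho i)] as the common source projection of the class. *)
have /choice [v vP] : forall i, exists v, (i < r)%N -> piso i (rho i) v /\ (rho i = i -> v = p i).
  move=> i; case: (ltnP i r) => ir; last by exists 0.
  have [ri|ri] := eqVneq (rho i) i.
    by exists (p i); split=> //; rewrite ri; split; rewrite ?ps ?pp //; exact: Fp.
  have [_ /asboolP [v hv] _] := rhoP _ ir; exists v; split=> // h; by rewrite h eqxx in ri.
have vpiso i : (i < r)%N -> piso i (rho i) (v i) by case/vP.
have vmul i (ir : (i < r)%N) := piso_mul ir (rho_lt _ ir) (vpiso _ ir).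
have vrho i : (i < r)%N -> v (rho i) = p (rho i).
  by move=> ir; have [_ ->] := vP _ (rho_lt _ ir); rewrite ?rho_rho.
have Fv i : (i < r)%N -> F (v i) by case/vpiso.
exists rho, v; split.
- by move=> i ir; split; [have [] := rhoP _ ir|exact: rho_rho].
- move=> i j ir jr; case: eqVneq => [<-|ij]; first by rewrite vrho //; have [] := vpiso _ ir.
  have [_ _ _ <-] := vmul i ir; have [_ <- _ _] := vmul j jr.
  by rewrite cmulA -(cmulA _ (p i)) porth // cmulr0 cmul0r.
- move=> i ir; apply: contraNneq (p0 ir) => v0; have [_ _ <-] := vpiso _ ir.
  by rewrite v0 cmul0r.
- by move=> i ir; have [] := vpiso _ ir.
- move=> x; split; last first.
    move=> [c ->]; apply: (fd_sum fdF) => i _ _; apply: (fd_sum fdF) => j _ _.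
    by apply: (fdsZ fdF); apply: (fdsM fdF); [exact: Fv|apply: (fds_star fdF); exact: Fv].
  move=> Fx.
  have Fpxp i j : (i < r)%N -> (j < r)%N -> F (p i ** x ** p j).
    by move=> ir jr; exact: (fdsM fdF (fdsM fdF (Fp ir) Fx) (Fp jr)).
  have /choice [c cE] : forall ij : nat * nat, exists c : R[i], (ij.1 < r)%N -> (ij.2 < r)%N ->
      rho ij.1 = rho ij.2 -> p ij.1 ** x ** p ij.2 = c *: (v ij.1 ** star (v ij.2)).
    move=> [i j] /=; case: (ltnP i r) => ir; last by exists 0.
    case: (ltnP j r) => jr; last by exists 0.
    have [rij|rij] := eqVneq (rho i) (rho j); last by exists 0 => _ _ h; rewrite h eqxx in rij.
    have [_ _ q1 q2] := vmul i ir; have [q3 _ q5 q6] := vmul j jr.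
    have [||||c cE] := @corner (rho i) (star (v i) ** x ** v j).
    - exact: rho_lt.
    - exact: (fdsM fdF (fdsM fdF (fds_star fdF (Fv _ ir)) Fx) (Fv _ jr)).
    - by rewrite !cmulA q1.
    - by rewrite rij -!cmulA q3.
    exists c => _ _ _; have [_ _ <-] := vpiso _ ir; have [_ _ <-] := vpiso _ jr.
    have -> : v i ** star (v i) ** x ** (v j ** star (v j)) =
      v i ** (star (v i) ** x ** v j) ** star (v j) by rewrite !cmulA.
    rewrite cE cmulZr cmulZl; congr (_ *: _).
    by have [-> _ _ _] := vmul i ir.
  exists (fun i j => c (i, j)).
  have [xe ex] := max_family_unit Fx; rewrite -[LHS]xe -[X in X ** _]ex /e.
  rewrite cmul_suml cmul_suml; apply: eq_bigr => i _.
  rewrite cmul_sumr (bigID (fun j : 'I_r => rho i == rho j)) /= [X in _ + X]big1 ?addr0.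
    by apply: eq_bigr => j /eqP rij; exact: (cE (nat_of_ord i, nat_of_ord j) (ltn_ord i) (ltn_ord j) rij).
  move=> j rij; apply/eqP; apply: contraNT rij => n0; apply/eqP/rho_eq => //.
  apply/asboolP; apply: corner_piso n0 => //; first exact: Fpxp.
    by rewrite !cmulA pp.
  by rewrite -!cmulA pp.
Qed.
End Max.

Theorem fd_structure : exists r rho v, [/\ blocks r rho, msys r rho v,
  forall i, (i < r)%N -> v i != 0 & forall x, F x <-> mspan r rho v x].
Proof.
have [r [p [hp rmax]]] := proj_family_max.
have [rho [v [h1 h2 h3 _ h5]]] := structure_of_max hp rmax.
by exists r, rho, v; split.
Qed.

Theorem fd_unit : exists e, [/\ F e, star e = e & forall x, F x -> e ** x = x].
Proof.
have [r [p [hp rmax]]] := proj_family_max; exists (\sum_(i < r) p i); split.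
- by apply: (fd_sum fdF) => i _ _; case: (proj1 hp i (ltn_ord i)).
- by rewrite star_sum; apply: eq_bigr => i _; case: (proj1 hp i (ltn_ord i)).
- by move=> x Fx; case: (max_family_unit hp rmax Fx).
Qed.
End Structure.

(** * The unit *)

Section Geometric.
Variables (R : realType) (M : tcAlgebra R).
Local Notation N := (norm2 (@tc_traces R M)).

Lemma le_of_inv_nat (x y C : R) : (forall n : nat, x <= y + C / n.+1%:R) -> x <= y.
Proof.
move=> H; rewrite leNgt; apply/negP => yx.
have d0 : 0 < x - y by rewrite subr_gt0.
have C0 : 0 < C.
  by have := H 0%N; rewrite divr1; move: d0; set d := x - y => ? ?; lra.
have /archi_boundP : 0 <= C / (x - y) by rewrite divr_ge0 // ltW.
set n := Num.bound _ => hn; have := H n; rewrite -lerBlDl ler_pdivlMr ?ltr0Sn // mulrC => h1.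
have h2 : n%:R * (x - y) <= n.+1%:R * (x - y) by rewrite ler_pM2r // ler_nat.
move: hn; rewrite ltr_pdivrMr // => hn.
by have := lt_le_trans (lt_le_trans hn h2) h1; rewrite ltxx.
Qed.

Lemma inv_exp2_le (e C : R) : 0 < e -> exists n0 : nat, forall n, (n0 <= n)%N -> C / 2 ^+ n < e.
Proof.
move=> e0; have C0 : 0 <= `|C| / e by rewrite divr_ge0 // ltW.
have := archi_boundP C0; set n0 := Num.bound _ => hn; exists n0 => n nn.
rewrite ltr_pdivrMr ?exprn_gt0 //; apply: le_lt_trans (ler_norm C) _.
move: hn; rewrite ltr_pdivrMr // mulrC => /lt_le_trans; apply.
rewrite ler_wpM2l ?(ltW e0) // -natrX ler_nat; apply: leq_trans nn _.
exact/ltnW/ltn_expl.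
Qed.

Lemma inv_nat_lt (e : R) : 0 < e -> exists n0 : nat, forall n, (n0 <= n)%N -> n.+1%:R^-1 < e.
Proof.
move=> e0; have := archi_boundP (ltW (divr_gt0 ltr01 e0)); rewrite mul1r; set n0 := Num.bound _ => hn.
exists n0 => n nn; rewrite -(invrK e) ltf_pV2 ?posrE ?invr_gt0 //.
by apply: lt_le_trans hn _; rewrite ler_nat leqW.
Qed.

Lemma geometric_tail (C : R) (u : nat -> M) : 0 <= C -> (forall k, N (u k.+1 - u k) <= C / 2 ^+ k) ->
  forall k n, N (u (k + n)%N - u k) <= C * 2 / 2 ^+ k.
Proof.
move=> C0 H k n.
have : N (u (k + n)%N - u k) <= C * 2 / 2 ^+ k * (1 - 1 / 2 ^+ n).
  elim: n => [|n IH]; first by rewrite addn0 subrr norm20 expr0 divr1 subrr mulr0.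
  apply: le_trans (norm2_tri (u (k + n)%N) _ _) _; rewrite addnS.
  apply: le_trans (lerD (H _) IH) _; apply: eq_le_num; rewrite exprD exprS.
  by field; rewrite !expf_neq0.
move/le_trans; apply; rewrite ler_piMr //; first by rewrite !mulr_ge0 ?invr_ge0 ?exprn_ge0.
Qed.

Lemma geometric_cauchy (C : R) (u : nat -> M) : 0 <= C -> (forall k, N (u k.+1 - u k) <= C / 2 ^+ k) ->
  norm2_cauchy (@tc_traces R M) u.
Proof.
move=> C0 H e e0; have [n0 hn] := inv_exp2_le (C * 2) (divr_gt0 e0 (ltr0Sn R 1)).
exists n0 => m n hm hn'; apply: le_lt_trans (norm2_tri (u n0) _ _) _.
rewrite [ltRHS](splitr e) (norm2BC (u n0)) -(subnKC hm) -(subnKC hn').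
by apply: ltrD; apply: le_lt_trans (geometric_tail C0 H _ _) (hn _ (leqnn _)).
Qed.
End Geometric.

(** * Approximate units and the 2-norm continuity of traces *)

Section ApproximateUnit.
Variables (R : realType) (M : tcAlgebra R).
Local Notation N := (norm2 (@tc_traces R M)).

(* [1 + m] is the Cayley transform (i + b) / (i - b). *)
Lemma cayley (b : M) : star b = b -> rnorm b <= 1/2 -> exists2 m : M,
  'i%C *: m - b ** m = 2 *: b & star m ** m + m + star m = 0.
Proof.
(* The equation (i - b)m = 2b is rewritten as m = T(m). The bound 1/2 on b makes T contract by 1/2
   and preserve the ball of radius 2. The second identity of the statement says that 1 + m is
   isometric. *)
move=> sb b2; pose T (x : M) := - ('i%C *: (2 *: b + b ** x)).
pose u := fun k => iter k T 0.
have c2 : cabs (2 : R[i]) = 2 by rewrite -(rmorph_nat (real_complex R)) cabsR normr_nat.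
have TB x y : T x - T y = - ('i%C *: (b ** (x - y))) by rewrite /T; salg.
have ub k : rnorm (u k) <= 2.
  elim: k => [|k IH] /=; first by rewrite rnorm0.
  rewrite /T rnormN rnormZ cabsi mul1r; apply: le_trans (rnormD _ _) _.
  rewrite rnormZ c2; have := rnormM b (u k); have := rnorm_ge0 b; have := rnorm_ge0 (u k); nra.
have u1 : N (u 1%N - u 0%N) <= 2 by rewrite subr0; apply: le_trans (norm2_rnorm _) (ub _).
have uN k : N (u k.+1 - u k) <= 2 / 2 ^+ k.
  elim: k => [|k IH]; first by rewrite expr0 divr1.
  rewrite -[u k.+2]/(T (u k.+1)) -[X in _ - X]/(T (u k)) TB norm2N norm2Z cabsi mul1r.
  apply: le_trans (norm2Ml _ _) _; rewrite exprS invfM mulrCA.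
  by apply: ler_pM; rewrite ?rnorm_ge0 ?norm2_ge0 // -[2^-1]mul1r.
have [m _ um] := bcvg_complete (ltr0Sn R 1) ub (geometric_cauchy (ler0n R 2) uN).
have mE : m = T m.
  apply: bcvg_unique (bcvg_shift um) _.
  by apply: bcvgN; apply: bcvgZ; apply: bcvgD (bcvg_cst _) (bcvgM (bcvg_cst _) um).
have E1 : 'i%C *: m - b ** m = 2 *: b.
  by rewrite {1}mE /T; salg; ring: (mulii R).
exists m => //.
have E2 : - ('i%C *: star m) - star m ** b = 2 *: b.
  rewrite -[RHS](_ : star (2 *: b) = _); last by rewrite starZ_conjc sb conjc_nat.
  by rewrite -E1 starB starZ_conjc starM sb conjci scaleNr.
have E3 : 'i%C *: (star m ** m + m + star m) = 0.
  have -> : 'i%C *: (star m ** m + m + star m) = 2^-1 *: (star m ** ('i%C *: m - b ** m)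
     - (- ('i%C *: star m) - star m ** b) ** m) + ('i%C *: m + 'i%C *: star m) by salg; field.
  rewrite E1 E2 cmulZr cmulZl -scalerBr scalerA mulVf ?pnatr_eq0 // scale1r.
  have -> : star m ** b - b ** m + ('i%C *: m + 'i%C *: star m) =
    ('i%C *: m - b ** m) - (- ('i%C *: star m) - star m ** b) by salg.
  by rewrite E1 E2 subrr.
by move/eqP: E3; rewrite scaler_eq0 => /orP[/eqP i0|/eqP //]; have := cabsi R; rewrite i0 cabs0 => /eqP; rewrite eq_sym oner_eq0.
Qed.

(* The Cesaro means of the powers of the unitary [1 + m] converge to 0 on the range of [m]. *)
Lemma approximate_unit (b : M) n : star b = b -> rnorm b <= 1/2 ->
  exists2 q : M, rnorm q <= 2 & rnorm (b - b ** q) <= 2 / n.+1%:R.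
Proof.
move=> sb b2; have [m mE mI] := cayley sb b2.
(* [d k] stands for (1 + m)^k - 1, which makes sense without a unit and has norm at most 2. *)
pose d := fix d k : M := if k is k'.+1 then d k' + m + m ** d k' else 0.
have dI k : star (d k) ** d k + d k + star (d k) = 0.
  elim: k => [|k IH] /=; first by rewrite star0 cmul0r !addr0.
  have -> : star (d k + m + m ** d k) ** (d k + m + m ** d k) + (d k + m + m ** d k) +
      star (d k + m + m ** d k) =
    (star m ** m + m + star m) + (star m ** m + m + star m) ** d k +
    star (d k) ** (star m ** m + m + star m) +
    star (d k) ** (star m ** m + m + star m) ** d k + (star (d k) ** d k + d k + star (d k)) by salg.
  by rewrite mI IH !(cmul0r, cmulr0, addr0).
have d2 k : rnorm (d k) <= 2.
  have : rnorm (d k) ^+ 2 <= 2 * rnorm (d k).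
    rewrite -rnorm_cstar.
    have -> : star (d k) ** d k = (star (d k) ** d k + d k + star (d k)) - (d k + star (d k)) by salg.
    rewrite dI sub0r rnormN; apply: le_trans (rnormD _ _) _; rewrite rnorm_star; lra.
  have := rnorm_ge0 (d k); nra.
have n0 : (n.+1%:R : R[i]) != 0 by rewrite pnatr_eq0.
pose c : R[i] := (n.+1%:R^-1)%:C.
have cn : cabs c = n.+1%:R^-1 by rewrite cabsR ger0_norm ?invr_ge0.
pose S := \sum_(k < n.+1) d k.
exists (- (c *: S)).
  rewrite rnormN rnormZ cn ler_pdivrMl ?ltr0Sn //; apply: le_trans (rnorm_sum _ _ _) _.
  rewrite mulr_natl -[n.+1 in leRHS]card_ord -sumr_const.
  by apply: ler_sum => i _; exact: d2.
(* Telescoping: m times the sum of (1 + m)^k over k <= n is (1 + m)^(n+1) - 1. *)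
have tel : n.+1%:R *: m + m ** S = d n.+1.
  rewrite /S; elim: (n.+1) => [|k IH]; first by rewrite scale0r big_ord0 cmulr0 addr0.
  rewrite big_ord_recr /= cmulDr mulrSr scalerDl scale1r -[X in _ = X + m + _]IH.
  by rewrite addrA; congr (_ + _); rewrite addrAC.
have mq : m - m ** - (c *: S) = c *: d n.+1.
  rewrite -tel scalerDr scalerA (_ : c * _ = 1); last first.
    by rewrite /c rmorphV ?unitfE ?pnatr_eq0 // rmorph_nat mulVf.
  by rewrite scale1r; salg.
have bE : b = 2^-1 *: ('i%C *: m - b ** m) by rewrite mE scalerA mulVf ?scale1r ?pnatr_eq0.
have -> : b - b ** - (c *: S) = 2^-1 *: ('i%C *: (c *: d n.+1) - b ** (c *: d n.+1)).
  by rewrite -mq {1 2}bE; salg.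
have c2 : cabs (2^-1 : R[i]) = 2^-1.
  by rewrite -(rmorph_nat (real_complex R)) -fmorphV cabsR ger0_norm // invr_ge0.
rewrite rnormZ c2.
have cd : rnorm (c *: d n.+1) <= 2 / n.+1%:R.
  by rewrite rnormZ cn mulrC ler_wpM2r ?invr_ge0.
have := rnormB ('i%C *: (c *: d n.+1)) (b ** (c *: d n.+1)); rewrite rnormZ cabsi.
have := rnormM b (c *: d n.+1); have := rnorm_ge0 (c *: d n.+1); have := rnorm_ge0 b.
move: cd; set t := 2 / _; set x := rnorm (c *: _); set y := rnorm b; set z := rnorm (b ** _).
set w := rnorm (_ - _); nra.
Qed.

(** Cauchy-Schwarz needs a second factor, and no unit is available yet: an approximate unit q with
    ||q|| <= 2 takes its place. Splitting into self-adjoint parts doubles the constant to 4. *)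
Lemma tau_le_norm2 (tau : M -> R[i]) (a : M) : is_trace tau -> cabs (tau a) <= 4 * trace_norm2 tau a.
Proof.
move=> ht.
have sa_small b : star b = b -> rnorm b <= 1/2 -> cabs (tau b) <= 2 * trace_norm2 tau b.
  move=> sb b2; apply: (@le_of_inv_nat _ _ _ 2) => n; have [q q2 bq] := approximate_unit n sb b2.
  rewrite -[b in leLHS](subrK (b ** q)) tauD // addrC; apply: le_trans (cabsD _ _) _; apply: lerD.
    rewrite -{1}sb; apply: le_trans (trace_CS2 ht _ _) _; rewrite mulrC.
    by rewrite ler_wpM2r ?trace_norm2_ge0 // (le_trans (trace_norm2_rnorm ht q)).
  exact: le_trans (tau_bound ht _) bq.
have sa b : star b = b -> cabs (tau b) <= 2 * trace_norm2 tau b.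
  move=> sb; pose t := 2 * (rnorm b + 1).
  have t0 : 0 < t by rewrite mulr_gt0 // ltr_wpDl ?rnorm_ge0.
  have := sa_small (t^-1%:C *: b); rewrite starZ_conjc conjcR sb => /(_ erefl).
  rewrite rnormZ tauZ // cabsM trace_norm2Z // cabsR gtr0_norm ?invr_gt0 //.
  rewrite mulrCA ler_pM2l ?invr_gt0 //; apply.
  rewrite ler_pdivrMl // /t; have := rnorm_ge0 b; lra.
pose re := (2^-1)%:C *: (a + star a); pose im := (2^-1)%:C *: ('i%C *: (star a - a)).
have h2 : (2^-1)%:C + (2^-1)%:C = 1 :> R[i].
  by rewrite -rmorphD -(rmorph1 (real_complex R)); congr (_%:C); lra.
have aE : a = re + 'i%C *: im.
  by rewrite -[LHS]scale1r -h2 /re /im; salg; ring: (mulii R).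
have half0 : cabs (2^-1)%:C = 2^-1 :> R by rewrite cabsR ger0_norm.
have re_sa : star re = re by rewrite /re; salg.
have im_sa : star im = im by rewrite /im; salg.
have re_n : trace_norm2 tau re <= trace_norm2 tau a.
  rewrite /re trace_norm2Z // half0.
  have := trace_norm2D ht a (star a); rewrite trace_norm2_star //; lra.
have im_n : trace_norm2 tau im <= trace_norm2 tau a.
  rewrite /im !trace_norm2Z // half0 cabsi.
  have := trace_norm2D ht (star a) (- a); rewrite trace_norm2N // trace_norm2_star //; lra.
have -> : tau a = tau re + 'i%C * tau im.
  by rewrite {1}aE (tauD ht) (tauZ ht 'i%C).
apply: le_trans (cabsD _ _) _; have -> : cabs ('i%C * tau im) = cabs (tau im) by rewrite cabsM cabsi mul1r.
have := sa _ re_sa; have := sa _ im_sa; lra.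
Qed.
End ApproximateUnit.

(** * Projections of almost full trace *)

Section Projections.
Variables (R : realType) (A : cstarType R).

(** Formally 1 - 2p is unitary, so y = x(1 - 2p) has the norm of x, and x(1 - p) is the mean of x
    and y. *)
Lemma rnorm_sub_proj (x p : A) : star p = p -> p ** p = p -> rnorm (x - x ** p) <= rnorm x.
Proof.
move=> sp pp; pose y := x - 2 *: (x ** p).
have c2 : cabs (2^-1 : R[i]) = 2^-1.
  by rewrite -(rmorph_nat (real_complex R)) -fmorphV cabsR ger0_norm // invr_ge0.
have yx : rnorm y = rnorm x.
  have : rnorm (star y) ^+ 2 = rnorm (star x) ^+ 2.
    rewrite -!rnorm_cstar !starK; congr rnorm.
    have -> : y ** star y = x ** star x - 2 *: (x ** p ** star x) - 2 *: (x ** star p ** star x)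
      + 4 *: (x ** (p ** star p) ** star x) by rewrite /y; salg; rewrite ?conjc_nat; ring.
    rewrite sp pp -addrA -!scaleNr -!scalerDl; rewrite -addrA -scalerDl.
    by rewrite (_ : -2 + (-2 + 4) = 0) ?scale0r ?addr0 //; ring.
  by rewrite !rnorm_star => /eqP; rewrite eqrXn2 ?rnorm_ge0 // => /eqP.
have -> : x - x ** p = 2^-1 *: (x + y) by rewrite /y; salg; field.
rewrite rnormZ c2; have := rnormD x y; rewrite yx; lra.
Qed.

(** By orthogonality the iterated squares of p + c are p plus those of c, of norm at most 2;
    repeated squaring removes the 2. *)
Lemma rnorm_orth_sum (p c : A) : star p = p -> p ** p = p -> star c = c -> p ** c = 0 ->
  rnorm c <= 1 -> rnorm (p + c) <= 1.
Proof.
move=> sp pp sc pc c1; pose u := fix u k : A := if k is k'.+1 then u k' ** u k' else c.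
have hu := @rnorm_iter_sqr R A u (fun=> erefl) sc.
have pu k : p ** u k = 0 by elim: k => //= k IH; rewrite cmulA IH cmul0r.
have up k : u k ** p = 0 by rewrite -sp -(proj1 (hu k)) -starM pu star0.
apply: (@rnorm_le_iter_sqr R A (fun k => p + u k) 2 1) => //.
- by move=> k /=; rewrite cmulDl !cmulDr pp pu up addr0 add0r.
- by rewrite starD sp sc.
- move=> k; rewrite expr1n mulr1; apply: le_trans (rnormD _ _) _.
  rewrite (_ : 2 = 1 + 1) //; apply: lerD; first exact: proj_rnorm.
  by rewrite (proj2 (hu k)) exprn_ile1 ?rnorm_ge0.
Qed.

(** For x = a - ap, the element x^* x is a contraction orthogonal to p, so tau(p) + tau(x^* x) <=
    ||p + x^* x|| <= 1. Thus a projection of almost full trace is almost a right unit on the whole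
    unit ball. *)
Lemma trace_defect (tau : A -> R[i]) (a p : A) : is_trace tau -> star p = p -> p ** p = p ->
  rnorm a <= 1 -> trace_sqr tau (a - a ** p) <= 1 - trace_sqr tau p.
Proof.
move=> ht sp pp a1; set x := a - a ** p.
have xp : x ** p = 0 by rewrite /x cmulBl -cmulA pp subrr.
have px : p ** star x = 0 by rewrite -sp -starM xp star0.
have x1 : rnorm (star x ** x) <= 1.
  by rewrite rnorm_cstar exprn_ile1 ?rnorm_ge0 // (le_trans (rnorm_sub_proj a sp pp)).
have := @rnorm_orth_sum p (star x ** x) sp pp; rewrite starM starK cmulA px cmul0r.
move=> /(_ erefl erefl x1) h; have := le_trans (tau_bound ht _) h.
rewrite tauD // -{1}pp -{1}sp !trace_sqrE // -rmorphD cabsR => /(le_trans (ler_norm _)).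
by rewrite lerBrDl.
Qed.
End Projections.

(** * Construction of the unit *)

Section Unit.
Variables (R : realType) (M : tcAlgebra R).
Hypothesis hM : hyperfinite M.
Local Notation X := (@tc_traces R M).
Local Notation N := (norm2 X).

Lemma eval_continuous (A : topologicalType) (a : A) :
  continuous (fun tau : {ptws A -> R[i]^o} => tau a : R[i]^o).
Proof.
move=> tau; have tt : {ptws, nbhs (tau : {ptws A -> R[i]^o}) --> tau} by exact: cvg_id.
by move/pointwise_cvgP : tt => /(_ a).
Qed.

(** A contraction that almost norms a trace does so for nearby traces, and X is compact. The
    covering form of compactness is applied to the filter of finite lists directed by inclusion. *)
Lemma finite_norming (e : R) : 0 < e -> exists s : seq M,
  forall tau, X tau -> exists2 a, a \in s & rnorm a <= 1 /\ 1 - e < cabs (tau a).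
Proof.
move=> e0; pose P (s : seq M) (tau : M -> R[i]) :=
  exists2 a, a \in s & rnorm a <= 1 /\ 1 - e < cabs (tau a).
pose F : set_system (seq M) := [set S | exists s0 : seq M, forall s : seq M, {subset s0 <= s} -> S s].
have FF : Filter F.
  split; first by exists [::].
    move=> S T [s0 hS] [t0 hT]; exists (s0 ++ t0) => s hs; split.
      by apply: hS => x xs; apply: hs; rewrite mem_cat xs.
    by apply: hT => x xs; apply: hs; rewrite mem_cat xs orbT.
  by move=> S T ST [s0 hS]; exists s0 => s /hS; exact: ST.
have /compact_near_coveringP /(_ _ F P FF) := tc_compact (@tcP R M).
have cover (tau : {ptws M -> R[i]^o}) : X tau -> \forall t \near tau & s \near F, P s t.
  move=> Xt; have [a a1 ae] := trace_norm_approx (tcX Xt) e0.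
  exists ([set t : {ptws M -> R[i]^o} | 1 - e < cabs (t a)], [set s : seq M | a \in s]); last first.
    by move=> [t s] /= [ht hs]; exists a.
  split=> /=; last by exists [:: a] => s; apply; rewrite inE.
  have d0 : 0 < cabs (tau a) - (1 - e) by rewrite subr_gt0.
  have := @eval_continuous M a tau; move/cvgrPdist_lt => /(_ (cabs (tau a) - (1 - e))%:C).
  rewrite ltcR => /(_ d0); apply: filterS => t /=; rewrite cabsE ltcR.
  have := cabsD (tau a - t a) (t a); rewrite subrK; lra.
by move=> /(_ cover) [s0 hs0]; exists s0 => tau Xt; exact: hs0 Xt.
Qed.

Lemma large_projection (eta : R) : 0 < eta -> exists2 p : M, star p = p /\ p ** p = p
  & forall tau, X tau -> 1 - eta <= trace_sqr tau p.
Proof.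
(* Norming loses d, the approximation of a in F loses 4d, and ||b||_2 <= 1 + d. With e the unit of
   F, Cauchy-Schwarz gives ||e||_2 >= 1 - 6d, whose square is at least 1 - 12d. *)
move=> eta0; pose d : R := Num.min eta 1 / 12.
have d0 : 0 < d by rewrite divr_gt0 // lt_min eta0 ltr01.
have [dle d1] : 12 * d <= eta /\ 12 * d <= 1.
  rewrite /d mulrC divfK; last by lra.
  by split; rewrite ge_min lexx ?orbT.
have [s hs] := finite_norming d0; have [F fdF hF] := hM s d0.
have [e [Fe se ex]] := fd_unit fdF.
exists e; first by rewrite ex.
move=> tau Xt; have ht := tcX Xt; have [a as_ [a1 ta]] := hs _ Xt; have [b Fb ab] := hF _ as_.
have nab : trace_norm2 tau (a - b) < d by apply: le_lt_trans (norm2_ub _ Xt) ab.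
have h1 : cabs (tau a) <= cabs (tau b) + 4 * d.
  rewrite -[a in leLHS](subrK b) tauD // addrC; apply: le_trans (cabsD _ _) _.
  rewrite lerD2l; apply: le_trans (tau_le_norm2 _ ht) _; lra.
have h2 : cabs (tau b) <= trace_norm2 tau e * trace_norm2 tau b.
  by rewrite -{1}(ex _ Fb) -{1}se; exact: trace_CS2.
have h3 : trace_norm2 tau b <= 1 + d.
  rewrite -[b](subrK a) addrC; apply: le_trans (trace_norm2D ht _ _) _; apply: lerD.
    exact: le_trans (trace_norm2_rnorm ht a) a1.
  by rewrite -(trace_norm2N ht) opprB ltW.
have e1 : rnorm e <= 1 by apply: proj_rnorm; rewrite ?ex.
have t1 : trace_norm2 tau e <= 1 := le_trans (trace_norm2_rnorm ht e) e1.
rewrite -trace_norm2_sqr //; have := trace_norm2_ge0 tau e; have := trace_norm2_ge0 tau b.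
move: h1 h2 h3 t1 ta; set t := trace_norm2 tau e; set x := cabs (tau a); set y := cabs (tau b).
set z := trace_norm2 tau b => h1 h2 h3 t1 ta z0 t0.
have h4 : 1 - 6 * d <= t by nra.
nra.
Qed.

Theorem tc_unit : exists one : M, [/\ star one = one, rnorm one <= 1,
  forall a, one ** a = a & forall a, a ** one = a].
Proof.
(* The defect in trace is (n+1)^-2 so that its square root bounds the 2-norm by 1/(n+1). Then p_m
   and p_n are both close to p_m p_n, hence the sequence is Cauchy. *)
have /choice [p pP] : forall n : nat, exists p : M, [/\ star p = p, p ** p = p
    & forall tau, X tau -> 1 - (n.+1%:R^-1) ^+ 2 <= trace_sqr tau p].
  by move=> n; have [|p [h1 h2] h3] := @large_projection (n.+1%:R^-1 ^+ 2); [rewrite exprn_gt0 ?invr_gt0|exists p].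
have p1 n : rnorm (p n) <= 1 by case: (pP n) => h1 h2 _; exact: proj_rnorm.
have defect1 a n : rnorm a <= 1 -> N (a - a ** p n) <= n.+1%:R^-1.
  move=> a1; apply: norm2_le => // tau Xt; have ht := tcX Xt; have [h1 h2 h3] := pP n.
  rewrite trace_norm2_le ?invr_ge0 //; apply: le_trans (trace_defect ht h1 h2 a1) _.
  by rewrite lerBlDr -lerBlDl; exact: h3.
have pc : norm2_cauchy X p.
  move=> e e0; have [n0 hn] := inv_nat_lt (divr_gt0 e0 (ltr0Sn R 1)); exists n0 => m n hm hn'.
  apply: le_lt_trans (norm2_tri (p m ** p n) _ _) _; rewrite [ltRHS](splitr e).
  apply: ltrD; first exact: le_lt_trans (defect1 _ n (p1 m)) (hn _ hn').
  have [sm _ _] := pP m; have [sn _ _] := pP n.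
  rewrite -norm2_star starB starM sm sn norm2BC.
  exact: le_lt_trans (defect1 _ m (p1 n)) (hn _ hm).
have [one one1 pone] := bcvg_complete ltr01 p1 pc.
have sone : star one = one.
  by apply: (bcvg_unique _ pone); apply: bcvg_ext (bcvg_star pone) => n; case: (pP n).
have aone a : a ** one = a.
  apply: (bcvg_unique (bcvgM (bcvg_cst a) pone)); split.
    by exists (rnorm a) => n; apply: le_trans (rnormM _ _) _; rewrite ler_piMr ?rnorm_ge0.
  have [->|a0] := eqVneq a 0.
    by move=> e e0; exists 0%N => n _; rewrite cmul0r subr0 norm20.
  have ap : 0 < rnorm a.
    by rewrite lt_def rnorm_ge0 andbT; apply: contraNneq a0 => /rnorm_eq0 ->.
  move=> e e0; have [n0 hn] := inv_nat_lt (divr_gt0 e0 ap); exists n0 => n /hn.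
  rewrite ltr_pdivlMr //; apply: le_lt_trans; rewrite norm2BC -ler_pdivrMr //.
  have := @defect1 ((rnorm a)^-1%:C *: a) n; rewrite rnormZ cabsR ger0_norm ?invr_ge0 ?(ltW ap) //.
  rewrite mulVf ?gt_eqF // => /(_ (lexx _)).
  by rewrite cmulZl -scalerBr norm2Z cabsR ger0_norm ?invr_ge0 ?(ltW ap) // mulrC.
exists one; split=> // a.
by rewrite -(starK a) -{1}sone -starM aone.
Qed.
End Unit.

(** * Perturbation of matrix units *)

Section MsysTheory.
Variables (R : realType) (A : cstarType R) (r : nat) (rho : nat -> nat) (v : nat -> A).
Hypotheses (hb : blocks r rho) (hv : msys r rho v).

Lemma rho_lt i : (i < r)%N -> (rho i < r)%N.
Proof. by move=> ir; have [h _] := hb ir; exact: leq_ltn_trans h ir. Qed.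
Lemma rho_rho i : (i < r)%N -> rho (rho i) = rho i.
Proof. by move=> ir; have [] := hb ir. Qed.
Lemma msysE i : (i < r)%N -> star (v i) ** v i = v (rho i).
Proof. by move=> ir; rewrite hv // eqxx. Qed.
Lemma msys_orth i j : (i < r)%N -> (j < r)%N -> i != j -> star (v i) ** v j = 0.
Proof. by move=> ir jr /negPf ij; rewrite hv // ij. Qed.
Lemma msys_sa i : (i < r)%N -> star (v (rho i)) = v (rho i).
Proof. by move=> ir; rewrite -msysE // starM starK. Qed.
Lemma msys_idem i : (i < r)%N -> v (rho i) ** v (rho i) = v (rho i).
Proof. by move=> ir; rewrite -{1}(msys_sa ir) msysE ?rho_lt // rho_rho. Qed.
Lemma msys_r i : (i < r)%N -> v i ** v (rho i) = v i.
Proof.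
move=> ir; apply/eqP; rewrite -subr_eq0; apply/eqP/star_mul_eq0.
have -> : star (v i ** v (rho i) - v i) ** (v i ** v (rho i) - v i) =
  star (v (rho i)) ** (star (v i) ** v i) ** v (rho i) - star (v (rho i)) ** (star (v i) ** v i)
  - (star (v i) ** v i) ** v (rho i) + star (v i) ** v i by salg.
by rewrite msysE // msys_sa // !msys_idem // subrr sub0r addNr.
Qed.
Lemma msys_l i : (i < r)%N -> v (rho i) ** star (v i) = star (v i).
Proof. by move=> ir; rewrite -(msys_sa ir) -starM msys_r. Qed.
Lemma msys_rnorm i : (i < r)%N -> rnorm (v i) <= 1.
Proof.
move=> ir; rewrite -(@ler_pXn2r _ 2) ?nnegrE ?rnorm_ge0 // -rnorm_cstar msysE // expr1n.
by apply: proj_rnorm; [exact: msys_sa|exact: msys_idem].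
Qed.

Definition msupp (k : nat) : A := \sum_(i < k) v i ** star (v i).

Lemma msupp_sa k : star (msupp k) = msupp k.
Proof. by rewrite /msupp star_sum; apply: eq_bigr => i _; rewrite starM starK. Qed.
Lemma msupp_l k j : (k <= r)%N -> (j < k)%N -> star (v j) ** msupp k = star (v j).
Proof.
move=> kr jk; have jr := leq_trans jk kr; rewrite /msupp cmul_sumr (bigD1 (Ordinal jk)) //= big1.
  by rewrite addr0 cmulA msysE // msys_l.
move=> i ij; rewrite cmulA msys_orth ?cmul0r //; first exact: leq_trans (ltn_ord i) kr.
by rewrite eq_sym.
Qed.
Lemma msupp_orth k : (k < r)%N -> msupp k ** v k = 0.
Proof.
move=> kr; rewrite /msupp cmul_suml big1 // => i _.
by rewrite -cmulA msys_orth ?cmulr0 ?ltn_eqF //; exact: ltn_trans (ltn_ord i) kr.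
Qed.
End MsysTheory.

Section Perturbation.
Variables (R : realType) (M : tcAlgebra R).
Local Notation N := (norm2 (@tc_traces R M)).
Variable F : nat -> set M.
Hypothesis fdF : forall l, fd_cstar_subalgebra (F l).

Lemma almost_projection_seq (h : nat -> M) (e : M) : (forall l, F l (h l)) ->
  (forall l, star (h l) = h l) -> bcvg h e -> e ** e = e ->
  exists g k g' : nat -> M, [/\ forall l, [/\ F l (g l), F l (k l) & g l = h l ** g' l],
    forall l, [/\ star (g l) = g l, g l ** g l = g l, star (k l) = k l & k l ** h l ** k l = g l],
    bcvg g e & bcvg k e].
Proof.
move=> Fh sh he ee.
have /choice [t tP] : forall l, exists t : M * M * M,
  [/\ F l t.1.1, F l t.1.2 & t.1.1 = h l ** t.2] /\
  [/\ star t.1.1 = t.1.1, t.1.1 ** t.1.1 = t.1.1, star t.1.2 = t.1.2 & t.1.2 ** h l ** t.1.2 = t.1.1] /\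
  [/\ rnorm t.1.2 <= 2, N (t.1.1 - h l) <= 5 * N (h l ** h l - h l)
    & N (t.1.2 - h l) <= 5 * N (h l ** h l - h l)].
  by move=> l; have [g [k [g' H]]] := almost_projection (fdF l) (Fh l) (sh l); exists (g, k, g').
exists (fun l => (t l).1.1), (fun l => (t l).1.2), (fun l => (t l).2).
have hh0 : null_seq (fun l => h l ** h l - h l).
  have [_] := bcvgB (bcvgM he he) he; rewrite ee subrr => H d d0.
  by have [n0 hn] := H d d0; exists n0 => n /hn; rewrite subr0.
split.
- by move=> l; case: (tP l).
- by move=> l; case: (tP l) => _ [].
- apply: (bcvg_near he).
    by exists 1 => l; case: (tP l) => _ [[h1 h2 _ _] _]; exact: proj_rnorm.
  by apply: (@null_seq_le _ _ 5) hh0 => l; case: (tP l) => _ [_ []].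
- apply: (bcvg_near he).
    by exists 2 => l; case: (tP l) => _ [_ []].
  by apply: (@null_seq_le _ _ 5) hh0 => l; case: (tP l) => _ [_ []].
Qed.

Variables (r : nat) (rho : nat -> nat) (v : nat -> M).
Hypotheses (hb : blocks r rho) (hv : msys r rho v).
Variable x : nat -> nat -> M.
Hypotheses (Fx : forall i l, (i < r)%N -> F l (x i l)) (hx : forall i, (i < r)%N -> bcvg (x i) (v i)).

Let blocks_le k : (k <= r)%N -> blocks k rho.
Proof. by move=> kr i ik; apply: hb; exact: leq_trans ik kr. Qed.

(* The new units are only close to [v], and need not have the same unit as [v]: when a partial
   isometry is added, all units of its block are cut down to its source projection. *)
Let perturb_step k : (k < r)%N ->
  (exists w : nat -> nat -> M, [/\ forall l i, (i < k)%N -> F l (w l i),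
    forall l, msys k rho (w l) & forall i, (i < k)%N -> bcvg (w^~ i) (v i)]) ->
  exists w : nat -> nat -> M, [/\ forall l i, (i < k.+1)%N -> F l (w l i),
    forall l, msys k.+1 rho (w l) & forall i, (i < k.+1)%N -> bcvg (w^~ i) (v i)].
Proof.
move=> kr [w [Fw wsys wv]]; have krW := ltnW kr.
have hbk := blocks_le krW.
pose q l := msupp (w l) k.
have Fq l : F l (q l).
  apply: (fd_sum (fdF l)) => i _ _; apply: (fdsM (fdF l)); first exact: Fw.
  by apply: (fds_star (fdF l)); exact: Fw.
have qQ : bcvg q (msupp v k).
  rewrite /q /msupp; apply: bcvg_sum => i _.
  by apply: bcvgM; [|apply: bcvg_star]; exact: wv.
(* Cutting off the supports of the units already built makes z exactly orthogonal to them, and keeps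
   the limit, as [v k] is orthogonal to the limit of the supports. *)
pose z l := x k l - q l ** x k l.
have Fz l : F l (z l).
  by apply: (fdB (fdF l)); [exact: Fx|apply: (fdsM (fdF l)); [exact: Fq|exact: Fx]].
have zv : bcvg z (v k).
  by have := bcvgB (hx kr) (bcvgM qQ (hx kr)); rewrite (msupp_orth hv kr) subr0.
have wz l j : (j < k)%N -> star (w l j) ** z l = 0.
  by move=> jk; rewrite /z cmulBr cmulA (msupp_l hbk (wsys l)) // subrr.
have [rk|rk] := eqVneq (rho k) k.
  have pk1 : star (v k) = v k by rewrite -rk; exact: (msys_sa hv kr).
  have pk2 : v k ** v k = v k by rewrite -{1 2 3}rk; exact: (msys_idem hb hv kr).
  (* For a new block, z z^* is self-adjoint and keeps the left orthogonality of z to the earlier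
     units; the projection g inherits it from the factorization g = h g'. *)
  have hy : bcvg (fun l => z l ** star (z l)) (v k).
    by have := bcvgM zv (bcvg_star zv); rewrite pk1 pk2.
  have [|l|g [kk [g' [g1 g2 gv _]]]] := almost_projection_seq _ _ hy pk2.
  - by move=> l; apply: (fdsM (fdF l)) => //; exact: (fds_star (fdF l)).
  - by rewrite starM starK.
  have wg l j : (j < k)%N -> star (w l j) ** g l = 0.
    by move=> jk; have [_ _ ->] := g1 l; rewrite !cmulA wz // !cmul0r.
  have gw l j : (j < k)%N -> star (g l) ** w l j = 0.
    by move=> jk; rewrite -(starK (w l j)) -starM wg // star0.
  exists (fun l i => if (i < k)%N then w l i else g l); split.
  - by move=> l i _; case: ifP => ik; [exact: Fw|case: (g1 l)].
  - move=> l i j; rewrite !ltnS; have [gs gg _ _] := g2 l.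
    case: (ltngtP i k) => // ik _; case: (ltngtP j k) => // jk _.
    + rewrite (wsys l) //; case: eqVneq => // ij; have [h _] := hbk _ ik.
      by rewrite (leq_ltn_trans h ik).
    + by rewrite wg // jk (ltn_eqF ik).
    + by rewrite gw // ik (gtn_eqF jk).
    + by rewrite ik jk eqxx rk ltnn gs gg.
  - move=> i; rewrite ltnS leq_eqVlt => /predU1P[->|ik].
      by apply: bcvg_ext gv => l; rewrite ltnn.
    by apply: bcvg_ext (wv i ik) => l; rewrite ik.
have [rkk rrk] := hb kr.
have rlt : (rho k < k)%N by rewrite ltn_neqAle rk rkk.
pose f l := w l (rho k).
have fs l : star (f l) = f l by rewrite /f -rrk; exact: (msys_sa (wsys l)).
have ff l : f l ** f l = f l by rewrite /f -{1 2 3}rrk; exact: (msys_idem hbk (wsys l)).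
have fv : bcvg f (v (rho k)) by exact: wv.
(* For an index in an earlier block, f is the diagonal unit of that block. Multiplying by f puts y^*
   y, and with it g, under f. *)
pose y l := z l ** f l.
have Fy l : F l (y l) by apply: (fdsM (fdF l)) => //; exact: Fw.
have yv : bcvg y (v k) by have := bcvgM zv fv; rewrite (msys_r hb hv kr).
have wy l j : (j < k)%N -> star (w l j) ** y l = 0 by move=> jk; rewrite /y cmulA wz // cmul0r.
have yf l : y l ** f l = y l by rewrite /y -cmulA ff.
have hh : bcvg (fun l => star (y l) ** y l) (v (rho k)).
  by have := bcvgM (bcvg_star yv) yv; rewrite (msysE hv kr).
have [|l|g [kk [g' [g1 g2 gv kv]]]] := almost_projection_seq _ _ hh (msys_idem hb hv kr).
- by move=> l; apply: (fdsM (fdF l)) => //; exact: (fds_star (fdF l)).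
- by rewrite starM starK.
have fg l : f l ** g l = g l.
  by have [_ _ ->] := g1 l; rewrite !cmulA -{1}(fs l) -starM yf.
have gf l : g l ** f l = g l.
  by have [gs _ _ _] := g2 l; rewrite -{1}gs -{1}(fs l) -starM fg gs.
pose c l i := if rho i == rho k then w l i ** g l else w l i.
have cy l i : (i < k)%N -> star (c l i) ** (y l ** kk l) = 0.
  move=> ik; rewrite /c; case: ifP => _; rewrite ?starM cmulA ?wy ?cmul0r //.
  by rewrite -(cmulA _ (star _)) wy // cmulr0 cmul0r.
have yc l i : (i < k)%N -> star (y l ** kk l) ** c l i = 0.
  by move=> ik; rewrite -(starK (c l i)) -starM cy // star0.
exists (fun l i => if (i < k)%N then c l i else y l ** kk l); split.
- move=> l i _; case: ifP => ik; last by apply: (fdsM (fdF l)) => //; case: (g1 l).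
  rewrite /c; case: ifP => _; last exact: Fw.
  by apply: (fdsM (fdF l)); [exact: Fw|case: (g1 l)].
- move=> l i j; rewrite !ltnS; have [gs gg ks kk1] := g2 l.
  case: (ltngtP i k) => // ik _; case: (ltngtP j k) => // jk _.
  + have [rii rri] := hbk _ ik; rewrite (leq_ltn_trans rii ik) /c rri.
    have ws := wsys l i j ik jk.
    case: (eqVneq (rho i) (rho k)) => ri; case: (eqVneq (rho j) (rho k)) => rj.
    * rewrite starM gs cmulA -(cmulA (g l)) ws; case: eqVneq => ij.
        by rewrite ri -/(f l) gf gg fg.
      by rewrite cmulr0 cmul0r.
    * rewrite starM gs -cmulA ws; case: eqVneq => ij; last by rewrite cmulr0.
      by rewrite -ij ri eqxx in rj.
    * rewrite cmulA ws; case: eqVneq => ij; last by rewrite cmul0r.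
      by rewrite ij rj eqxx in ri.
    * exact: ws.
  + by rewrite cy // jk (ltn_eqF ik).
  + by rewrite yc // ik (gtn_eqF jk).
  + rewrite ik jk eqxx rlt /c rrk eqxx -/(f l) fg starM ks.
    by rewrite -cmulA (cmulA (star _)) cmulA kk1.
- move=> i; rewrite ltnS leq_eqVlt => /predU1P[->|ik].
    have := bcvgM yv kv; rewrite (msys_r hb hv kr).
    by apply: bcvg_ext => l; rewrite ltnn.
  have ir := ltn_trans ik kr.
  rewrite /c; case: (eqVneq (rho i) (rho k)) => ri.
    have := bcvgM (wv i ik) gv; rewrite -ri (msys_r hb hv ir).
    by apply: bcvg_ext => l; rewrite ik.
  by apply: bcvg_ext (wv i ik) => l; rewrite ik.
Qed.

Theorem perturb : exists w : nat -> nat -> M, [/\ forall l i, (i < r)%N -> F l (w l i),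
  forall l, msys r rho (w l) & forall i, (i < r)%N -> bcvg (w^~ i) (v i)].
Proof.
suff H k : (k <= r)%N -> exists w : nat -> nat -> M, [/\ forall l i, (i < k)%N -> F l (w l i),
  forall l, msys k rho (w l) & forall i, (i < k)%N -> bcvg (w^~ i) (v i)] by exact: H.
elim: k => [|k IH] kr; first by exists (fun=> v); split.
by apply: perturb_step => //; apply: IH; exact: ltnW.
Qed.
End Perturbation.

(** * Coordinates with respect to matrix units *)

Section Msum.
Variables (R : realType) (A : cstarType R) (r : nat) (rho : nat -> nat).
Hypothesis hb : blocks r rho.
Implicit Types (v w : nat -> A) (c d : nat -> nat -> R[i]).

Definition msum c v : A := \sum_(i < r) \sum_(j < r | rho i == rho j) c i j *: (v i ** star (v j)).

Lemma msumD c d v : msum c v + msum d v = msum (fun i j => c i j + d i j) v.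
Proof.
rewrite /msum -big_split; apply: eq_bigr => i _; rewrite -big_split; apply: eq_bigr => j _.
by rewrite scalerDl.
Qed.
Lemma msumZ a c v : a *: msum c v = msum (fun i j => a * c i j) v.
Proof.
rewrite /msum scaler_sumr; apply: eq_bigr => i _; rewrite scaler_sumr.
by apply: eq_bigr => j _; rewrite scalerA.
Qed.
Lemma msum_star c v : star (msum c v) = msum (fun i j => conjc (c j i)) v.
Proof.
rewrite /msum star_sum.
transitivity (\sum_(i < r) \sum_(j < r | rho i == rho j) conjc (c i j) *: (v j ** star (v i))).
  apply: eq_bigr => i _; rewrite star_sum; apply: eq_bigr => j _.
  by rewrite starZ_conjc starM starK.
rewrite (exchange_big_dep xpredT) //=; apply: eq_bigr => j _.
by apply: eq_bigl => i; rewrite eq_sym.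
Qed.
Lemma msum_mulr c v j : msys r rho v -> (j < r)%N ->
  msum c v ** v j = \sum_(i < r | rho i == rho j) c i j *: v i.
Proof.
move=> hv jr; rewrite /msum cmul_suml [RHS]big_mkcond; apply: eq_bigr => i _ /=.
rewrite cmul_suml; case: ifP => ij.
  rewrite (bigD1 (Ordinal jr)) //= big1 ?addr0.
    by rewrite cmulZl -cmulA (msysE hv jr) -(eqP ij) (msys_r hb hv).
  move=> k /andP[_ kj]; rewrite cmulZl -cmulA (msys_orth hv) ?cmulr0 ?scaler0 //.
apply: big1 => k ik; rewrite cmulZl -cmulA (msys_orth hv) ?cmulr0 ?scaler0 //.
by apply: contraFneq ij => <-.
Qed.
Lemma msumM c d v : msys r rho v -> msum c v ** msum d v =
  msum (fun i k => \sum_(j < r | rho j == rho i) c i j * d j k) v.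
Proof.
move=> hv; rewrite {2}/msum cmul_sumr.
transitivity (\sum_(j < r) \sum_(k < r | rho j == rho k) \sum_(i < r | rho i == rho j)
   (c i j * d j k) *: (v i ** star (v k))).
  apply: eq_bigr => j _; rewrite cmul_sumr; apply: eq_bigr => k _.
  rewrite cmulZr cmulA (msum_mulr _ hv) // cmul_suml scaler_sumr; apply: eq_bigr => i _.
  by rewrite cmulZl scalerA mulrC.
rewrite /msum.
transitivity (\sum_(j < r) \sum_(i < r | rho i == rho j) \sum_(k < r | rho j == rho k)
   (c i j * d j k) *: (v i ** star (v k))).
  by apply: eq_bigr => j _; rewrite exchange_big.
rewrite (exchange_big_dep xpredT) //=; apply: eq_bigr => i _.
rewrite (exchange_big_dep (fun k : 'I_r => rho i == rho k)) /=; last first.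
  by move=> j k /eqP -> .
apply: eq_bigr => k /eqP ik; rewrite scaler_suml.
by apply: eq_bigl => j; rewrite -ik eq_sym andbb.
Qed.
Lemma msum_coef c v i j : msys r rho v -> (i < r)%N -> (j < r)%N -> rho i = rho j ->
  star (v i) ** msum c v ** v j = c i j *: v (rho i).
Proof.
move=> hv ir jr ij; rewrite -cmulA (msum_mulr _ hv) // cmul_sumr.
rewrite (bigD1 (Ordinal ir)) /=; last by rewrite ij.
rewrite cmulZr (msysE hv ir) big1 ?addr0 // => k /andP[_ ki].
by rewrite cmulZr (msys_orth hv) ?scaler0 // eq_sym.
Qed.
Lemma msum_delta v i j : (i < r)%N -> (j < r)%N -> rho i = rho j ->
  v i ** star (v j) = msum (fun k l => if (k == i) && (l == j) then 1 else 0) v.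
Proof.
move=> ir jr ij; rewrite /msum (bigD1 (Ordinal ir)) //= [X in _ + X]big1 ?addr0; last first.
  by move=> k ki; apply: big1 => l _; rewrite -[X in (X == i)]/(nat_of_ord k) (negPf (ki : (k != i :> nat))) scale0r.
rewrite (bigD1 (Ordinal jr)) /=; last by rewrite ij.
rewrite !eqxx scale1r big1 ?addr0 // => l /andP[_ lj].
by rewrite (negPf (lj : (l != j :> nat))) scale0r.
Qed.
Lemma eq_msum c d v : (forall i j, (i < r)%N -> (j < r)%N -> rho i = rho j -> c i j = d i j) ->
  msum c v = msum d v.
Proof.
by move=> cd; apply: eq_bigr => i _; apply: eq_bigr => j /eqP ij; rewrite cd.
Qed.

Variable v : nat -> A.
Hypothesis hv : msys r rho v.

Lemma mspan0 : mspan r rho v 0.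
Proof.
exists (fun _ _ => 0); rewrite big1 // => i _; rewrite big1 // => j _; by rewrite scale0r.
Qed.
Lemma mspanD x y : mspan r rho v x -> mspan r rho v y -> mspan r rho v (x + y).
Proof. by move=> [c ->] [d ->]; rewrite msumD; eexists. Qed.
Lemma mspanZ a x : mspan r rho v x -> mspan r rho v (a *: x).
Proof. by move=> [c ->]; rewrite msumZ; eexists. Qed.
Lemma mspanM x y : mspan r rho v x -> mspan r rho v y -> mspan r rho v (x ** y).
Proof. by move=> [c ->] [d ->]; rewrite -!/(msum _ _) msumM //; eexists. Qed.
Lemma mspan_star x : mspan r rho v x -> mspan r rho v (star x).
Proof. by move=> [c ->]; rewrite -/(msum _ _) msum_star; eexists. Qed.
Lemma mspan_unit i j : (i < r)%N -> (j < r)%N -> rho i = rho j -> mspan r rho v (v i ** star (v j)).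
Proof. by move=> ir jr ij; rewrite msum_delta //; eexists. Qed.
Lemma mspan_mem i : (i < r)%N -> mspan r rho v (v i).
Proof.
move=> ir; rewrite -(msys_r hb hv ir) -(msys_sa hv ir).
by apply: mspan_unit => //; [exact: (rho_lt hb)|rewrite (rho_rho hb)].
Qed.
End Msum.

(** * Homomorphisms determined by matrix units *)

Section Homs.
Variables (R : realType) (A : cstarType R).

(** Total functions with relations on a subset, so that the maps of the tower can be composed and
    passed to the limit without a type for each subalgebra. *)
Record hom_on (F : set A) (phi : A -> A) : Prop := HomOn {
  hom_onD : forall x y, F x -> F y -> phi (x + y) = phi x + phi y ;
  hom_onZ : forall c x, F x -> phi (c *: x) = c *: phi x ;
  hom_onM : forall x y, F x -> F y -> phi (x ** y) = phi x ** phi y ;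
  hom_on_star : forall x, F x -> phi (star x) = star (phi x) }.

Variables (r : nat) (rho : nat -> nat).
Hypothesis hb : blocks r rho.

Lemma hom_on_msum v phi c : msys r rho v -> hom_on (mspan r rho v) phi ->
  phi (msum r rho c v) = msum r rho c (phi \o v).
Proof.
move=> hv hphi; have F0 := mspan0 r rho v.
have phi0 : phi 0 = 0 by rewrite -{1}(scale0r 0) (hom_onZ hphi) // scale0r.
have phi_sum (P : pred 'I_r) (G : 'I_r -> A) : (forall i, P i -> mspan r rho v (G i)) ->
    mspan r rho v (\sum_(i < r | P i) G i) /\ phi (\sum_(i < r | P i) G i) = \sum_(i < r | P i) phi (G i).
  move=> FG; elim: (index_enum _) => [|i t [IH1 IH2]]; first by rewrite !big_nil.
  rewrite !big_cons; case: ifP => // Pi; split; first exact: mspanD (FG i Pi) IH1.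
  by rewrite (hom_onD hphi) ?IH2 //; exact: FG.
have Fij (i j : 'I_r) : rho i == rho j -> mspan r rho v (v i ** star (v j)).
  by move=> /eqP ij; exact: mspan_unit.
rewrite /msum (proj2 (phi_sum _ _ _)); last first.
  by move=> i _; apply: (proj1 (phi_sum _ _ _)) => j ij; apply: mspanZ; exact: Fij.
apply: eq_bigr => i _; rewrite (proj2 (phi_sum _ _ _)); last by move=> j ij; apply: mspanZ; exact: Fij.
apply: eq_bigr => j ij; rewrite (hom_onZ hphi) /=; last exact: Fij.
have Fv k : (k < r)%N -> mspan r rho v (v k) by exact: (mspan_mem hb hv).
rewrite (hom_onM hphi) ?(hom_on_star hphi) //; try exact: Fv.
by apply: mspan_star; exact: Fv.
Qed.

Lemma hom_on_msys v phi : msys r rho v -> hom_on (mspan r rho v) phi -> msys r rho (phi \o v).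
Proof.
move=> hv hphi i j ir jr /=.
have Fv k : (k < r)%N -> mspan r rho v (v k) by exact: (mspan_mem hb hv).
have phi0 : phi 0 = 0 by rewrite -{1}(scale0r 0) (hom_onZ hphi) ?scale0r //; exact: mspan0.
have Fi := Fv _ ir; have Fj := Fv _ jr.
rewrite -(hom_on_star hphi Fi) -(hom_onM hphi (mspan_star Fi) Fj).
by rewrite hv //; case: ifP.
Qed.

(** The bound K is applied to the iterated squares of x^* x, where its influence vanishes. This
    replaces the comparison of spectra. *)
Lemma hom_on_contractive v phi (K : R) : msys r rho v -> hom_on (mspan r rho v) phi ->
  (forall x, mspan r rho v x -> rnorm (phi x) <= K * rnorm x) ->
  forall x, mspan r rho v x -> rnorm (phi x) <= rnorm x.
Proof.
move=> hv hphi hK x Fx; pose h := star x ** x.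
have Fs : mspan r rho v (star x) := mspan_star Fx.
have Fh : mspan r rho v h by exact: mspanM.
have sh : star h = h by rewrite /h starM starK.
pose u := fix u k : A := if k is k'.+1 then u k' ** u k' else h.
have Fu k : mspan r rho v (u k) by elim: k => //= k IH; exact: mspanM.
have hu := @rnorm_iter_sqr R A u (fun=> erefl) sh.
suff : rnorm (phi h) <= rnorm h.
  rewrite /h (hom_onM hphi) // (hom_on_star hphi) // !rnorm_cstar.
  by rewrite ler_pXn2r // nnegrE rnorm_ge0.
apply: (@rnorm_le_iter_sqr R A (fun k => phi (u k)) K (rnorm h)).
- by move=> k /=; rewrite (hom_onM hphi).
- by rewrite -(hom_on_star hphi) // sh.
- exact: rnorm_ge0.
- by move=> k; apply: le_trans (hK _ (Fu k)) _; rewrite (proj2 (hu k)).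
Qed.

Variable v : nat -> A.
Hypotheses (hv : msys r rho v) (nz : forall i, (i < r)%N -> v i != 0).

(** Compressing by the contractions v_i and v_j leaves c_ij times a nonzero projection, which has
    norm 1. *)
Lemma coef_rnorm c i j : (i < r)%N -> (j < r)%N -> rho i = rho j ->
  cabs (c i j) <= rnorm (msum r rho c v).
Proof.
move=> ir jr ij; have p1 : rnorm (v (rho i)) = 1.
  have : rnorm (v (rho i)) ^+ 2 = rnorm (v (rho i)).
    by rewrite -rnorm_cstar (msys_sa hv ir) (msys_idem hb hv ir).
  have p0 : rnorm (v (rho i)) != 0.
    by apply: contraNneq (nz (rho_lt hb ir)) => /rnorm_eq0 ->.
  by move=> /eqP; rewrite expr2 -subr_eq0 -{3}(mulr1 (rnorm _)) -mulrBr mulf_eq0 (negPf p0) subr_eq0 => /eqP.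
rewrite -[leLHS]mulr1 -p1 -rnormZ -(msum_coef hb c hv ir jr ij).
apply: le_trans (rnormM _ _) _; apply: le_trans (ler_piMr _ (msys_rnorm hb hv jr)) _.
  exact: rnorm_ge0.
apply: le_trans (rnormM _ _) _; apply: ler_piMl; first exact: rnorm_ge0.
by rewrite rnorm_star (msys_rnorm hb hv ir).
Qed.

Lemma msum_hom w : msys r rho w ->
  exists2 phi : A -> A, hom_on (mspan r rho v) phi & forall c, phi (msum r rho c v) = msum r rho c w.
Proof.
move=> hw.
have /choice [cf cfE] : forall x, exists c, mspan r rho v x -> x = msum r rho c v.
  move=> x; have [[c xE]|nx] := pselect (mspan r rho v x); first by exists c.
  by exists (fun _ _ => 0).
have phiE c : msum r rho (cf (msum r rho c v)) w = msum r rho c w.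
  have E : msum r rho c v = msum r rho (cf (msum r rho c v)) v by apply: cfE; exists c.
  apply: eq_msum => i j ir jr ij.
  have : (cf (msum r rho c v) i j - c i j) *: v (rho i) = 0.
    by rewrite scalerBl -!(msum_coef hb _ hv ir jr ij) -E subrr.
  move/eqP; rewrite scaler_eq0 (negPf (nz (rho_lt hb ir))) orbF subr_eq0.
  by move/eqP.
exists (fun x => msum r rho (cf x) w); last exact: phiE.
split.
- by move=> x y [c ->] [d ->]; rewrite -!/(msum _ _ _ _) msumD !phiE msumD.
- by move=> a x [c ->]; rewrite -!/(msum _ _ _ _) msumZ !phiE msumZ.
- by move=> x y [c ->] [d ->]; rewrite -!/(msum _ _ _ _) msumM // !phiE msumM.
- by move=> x [c ->]; rewrite -!/(msum _ _ _ _) msum_star !phiE msum_star.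
Qed.
End Homs.

(** * Approximate intertwining *)

Lemma eventually_forall_lt (P : nat -> nat -> Prop) (r : nat) :
  (forall i, (i < r)%N -> exists n0 : nat, forall n, (n0 <= n)%N -> P i n) ->
  exists n0 : nat, forall n, (n0 <= n)%N -> forall i, (i < r)%N -> P i n.
Proof.
elim: r => [|r IH] H; first by exists 0%N.
have [n1 h1] := IH (fun i ir => H i (leqW ir)); have [n2 h2] := H r (leqnn _).
exists (maxn n1 n2) => n; rewrite geq_max => /andP[k1 k2] i.
by rewrite ltnS leq_eqVlt => /predU1P[->|ir]; [exact: h2|exact: h1].
Qed.

Section Intertwining.
Variables (R : realType) (M : tcAlgebra R).
Hypothesis hM : hyperfinite M.
Local Notation X := (@tc_traces R M).
Local Notation N := (norm2 X).

Record stage := Stage {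
  st_size : nat ; st_rho : nat -> nat ; st_unit : nat -> M ;
  st_blocks : blocks st_size st_rho ;
  st_msys : msys st_size st_rho st_unit ;
  st_neq0 : forall i, (i < st_size)%N -> st_unit i != 0 }.

Definition st_span (S : stage) : set M := mspan (st_size S) (st_rho S) (st_unit S).

(** Hyperfiniteness is applied for each l with error 1/(l+1), giving subalgebras F_l that contain
    norm-bounded sequences converging to the units. The perturbed units then converge as well, and
    one large l is selected at the end. *)
Lemma next_stage (S : stage) (s : seq M) (e : R) : 0 < e -> exists (S' : stage) (w : nat -> M),
  [/\ forall i, (i < st_size S)%N -> st_span S' (w i), msys (st_size S) (st_rho S) w,
    forall i, (i < st_size S)%N -> N (w i - st_unit S i) < e
  & forall a, a \in s -> exists2 b, st_span S' b & rnorm b <= rnorm a * 2 /\ N (b - a) < e].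
Proof.
move=> e0; case: S => r rho v hb hv nz /=.
pose t := [seq v i | i <- iota 0 r] ++ s.
have /choice [F hF] : forall l : nat, exists F : set M, fd_cstar_subalgebra F /\
    forall a, a \in t -> exists2 b, F b & rnorm b <= rnorm a * 2 /\ N (b - a) <= 2 * l.+1%:R^-1.
  move=> l; have l0 : (0 : R) < l.+1%:R^-1 by rewrite invr_gt0.
  have [F fdF h] := hM t l0.
  exists F; split=> // a /h [b Fb ab]; have [c [Fc c1 c2]] := truncate_norm2 fdF (rnorm_ge0 a) Fb (lexx _).
  exists c => //; split=> //; apply: le_trans c2 _; rewrite ler_pM2l // norm2BC; exact: ltW.
have vt i : (i < r)%N -> v i \in t.
  by move=> ir; rewrite mem_cat; apply/orP; left; apply/mapP; exists i; rewrite ?mem_iota.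
have /choice [x xP] : forall il : nat * nat, exists b : M, (il.1 < r)%N ->
    F il.2 b /\ rnorm b <= rnorm (v il.1) * 2 /\ N (b - v il.1) <= 2 * il.2.+1%:R^-1.
  move=> [i l] /=; have [ir|ir] := ltnP i r; last by exists 0.
  by have [b Fb hbb] := (hF l).2 _ (vt _ ir); exists b.
have xv i : (i < r)%N -> bcvg (fun l => x (i, l)) (v i).
  move=> ir; split; first by exists (rnorm (v i) * 2) => l; case: (xP (i, l) ir) => _ [].
  move=> d d0; have [n0 hn] := inv_nat_lt (divr_gt0 d0 (ltr0Sn R 1)); exists n0 => n /hn.
  rewrite ltr_pdivlMr // mulrC; apply: le_lt_trans.
  by case: (xP (i, n) ir) => _ [].
have Fx i l : (i < r)%N -> F l (x (i, l)) by move=> ir; case: (xP (i, l) ir).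
have [w [Fw wsys wv]] := perturb (fun l => (hF l).1) hb hv Fx xv.
have [n1 h1] : exists n0 : nat, forall n, (n0 <= n)%N -> forall i, (i < r)%N -> N (w n i - v i) < e.
  by apply: eventually_forall_lt => i /wv [_ /(_ e e0)].
have [n2 h2] := inv_nat_lt (divr_gt0 e0 (ltr0Sn R 1)).
pose l := maxn n1 n2.
have [r' [rho' [v' [hb' hv' nz' FE]]]] := fd_structure (hF l).1.
exists (Stage hb' hv' nz'), (w l); split.
- by move=> i ir; apply/FE; exact: Fw.
- exact: wsys.
- by apply: h1; exact: leq_maxl.
- move=> a as_; have [|b Fb [b1 b2]] := (hF l).2 a; first by rewrite mem_cat as_ orbT.
  exists b; first exact/FE; split=> //; apply: le_lt_trans b2 _.
  by rewrite mulrC -ltr_pdivlMr //; apply: h2; exact: leq_maxr.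
Qed.

Lemma next_hom (S : stage) (s : seq M) (n : nat) : exists (S' : stage) (phi : M -> M),
  [/\ hom_on (st_span S) phi, forall x, st_span S x -> st_span S' (phi x),
    forall x, st_span S x -> rnorm (phi x) <= rnorm x,
    forall x, st_span S x -> N (phi x - x) <= rnorm x / 2 ^+ n
  & forall a, a \in s -> exists2 b, st_span S' b & rnorm b <= rnorm a * 2 /\ N (b - a) <= 1 / 2 ^+ n].
Proof.
(* An element x has at most r^2 coefficients, each bounded by ||x||, and every matrix unit moves by
   at most 2e. The successor keeps the denominator nonzero when r = 0. *)
pose r := st_size S; pose e : R := (2 ^+ n)^-1 / (2 * (r * r).+1%:R).
have e0 : 0 < e by rewrite divr_gt0 ?invr_gt0 ?exprn_gt0 ?mulr_gt0.
have [S' [w [Sw wsys wv sb]]] := next_stage S s e0.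
case: S @r @e e0 Sw wsys wv sb => r rho v hb hv nz /= e0 Sw wsys wv sb.
set e := _ / _ in e0 wv sb.
have [phi hphi phiE] := msum_hom hb hv nz wsys; exists S', phi.
have w1 i : (i < r)%N -> rnorm (w i) <= 1 := msys_rnorm hb wsys (i := i).
have v1 i : (i < r)%N -> rnorm (v i) <= 1 := msys_rnorm hb hv (i := i).
have phi_span x : mspan r rho v x -> st_span S' (phi x).
  case: S' Sw {sb} => r' rho' v' hb' hv' nz' /= Sw [c ->].
  rewrite -/(msum _ _ _ _) phiE /msum /st_span /=.
  elim/big_ind: _ => [||i _]; [exact: mspan0|exact: mspanD|].
  elim/big_ind: _ => [||j _]; [exact: mspan0|exact: mspanD|].
  apply: mspanZ; apply: (mspanM hb' hv'); first exact: Sw.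
  by apply: mspan_star; exact: Sw.
have bounded x : mspan r rho v x -> rnorm (phi x) <= (r * r)%:R * rnorm x.
  move=> [c ->]; rewrite -/(msum _ _ _ _) phiE natrM {1}/msum.
  apply: le_trans (rnorm_sum _ _ _) _.
  apply: le_trans (_ : \sum_(i < r) r%:R * rnorm (msum r rho c v) <= _); last first.
    by rewrite sumr_const card_ord -[leLHS]mulr_natl mulrA.
  apply: ler_sum => i _; apply: le_trans (rnorm_sum _ _ _) _.
  rewrite big_mkcond; apply: le_trans (_ : \sum_(j < r) rnorm (msum r rho c v) <= _); last first.
    by rewrite sumr_const card_ord [leRHS]mulr_natl.
  apply: ler_sum => j _; case: eqVneq => [ij|_]; last exact: rnorm_ge0.
  rewrite rnormZ -[leRHS]mulr1; apply: ler_pM; rewrite ?cabs_ge0 ?rnorm_ge0 //.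
    exact: (coef_rnorm hb hv nz c (ltn_ord i) (ltn_ord j) ij).
  apply: le_trans (rnormM _ _) _; rewrite rnorm_star.
  by rewrite -[1]mulr1; apply: ler_pM; rewrite ?rnorm_ge0 ?w1.
split=> //.
- exact: (hom_on_contractive hb hv hphi bounded).
- move=> x [c ->]; rewrite -/(msum r rho c v) phiE; set K := rnorm _.
  have -> : msum r rho c w - msum r rho c v = \sum_(i < r) \sum_(j < r | rho i == rho j)
      c i j *: (w i ** star (w j) - v i ** star (v j)).
    rewrite /msum -sumrB; apply: eq_bigr => i _; rewrite -sumrB; apply: eq_bigr => j _.
    by rewrite scalerBr.
  have K0 : 0 <= K by exact: rnorm_ge0.
  apply: le_trans (norm2_sum _ _ _) _.
  apply: le_trans (_ : \sum_(i < r) r%:R * (K * (2 * e)) <= _).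
    apply: ler_sum => i _; apply: le_trans (norm2_sum _ _ _) _.
    rewrite big_mkcond; apply: le_trans (_ : \sum_(j < r) K * (2 * e) <= _); last first.
      by rewrite sumr_const card_ord [leRHS]mulr_natl.
    apply: ler_sum => j _; case: eqVneq => [ij|_]; last by rewrite mulr_ge0 ?mulr_ge0 ?(ltW e0).
    rewrite norm2Z; apply: ler_pM; rewrite ?cabs_ge0 ?norm2_ge0 //.
      exact: (coef_rnorm hb hv nz c (ltn_ord i) (ltn_ord j) ij).
    have -> : w i ** star (w j) - v i ** star (v j) =
      w i ** (star (w j - v j)) + (w i - v i) ** star (v j) by salg.
    apply: le_trans (norm2D _ _) _; rewrite mulr_natl mulr2n; apply: lerD.
      apply: le_trans (norm2Ml _ _) _; rewrite norm2_star -[leRHS]mul1r.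
      by apply: ler_pM; rewrite ?rnorm_ge0 ?norm2_ge0 ?w1 ?(ltW (wv _ _)).
    apply: le_trans (norm2Mr _ _) _; rewrite rnorm_star -[leRHS]mulr1.
    by apply: ler_pM; rewrite ?rnorm_ge0 ?norm2_ge0 ?v1 ?(ltW (wv _ _)).
  rewrite sumr_const card_ord -[leLHS]mulr_natl.
  have -> : r%:R * (r%:R * (K * (2 * e))) = K / 2 ^+ n * ((r * r)%:R / (r * r).+1%:R).
    have q0 : (r * r).+1%:R != 0 :> R by rewrite pnatr_eq0.
    have p0 : 2 ^+ n != 0 :> R by rewrite expf_neq0.
    by rewrite /e; move: (_.+1%:R) (2 ^+ n) q0 p0 => q p q0 p0; rewrite natrM; field; rewrite q0.
  by rewrite ler_piMr ?divr_ge0 ?exprn_ge0 // ler_pdivrMr // mul1r ler_nat.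
- move=> a /sb [b Sb [b1 b2]]; exists b => //; split=> //; apply: le_trans (ltW b2) _.
  rewrite /e mul1r ler_piMr ?invr_ge0 ?exprn_ge0 // invf_le1 ?mulr_gt0 //.
  by rewrite -natrM ler1n.
Qed.

Lemma norm2_lim_le (C : R) u a b : bcvg (M := M) u a -> (forall n, N (u n - b) <= C) -> N (a - b) <= C.
Proof.
move=> [_ ua] uC; apply/ler_addgt0Pr => e /ua [n0 /(_ n0 (leqnn _)) h].
by apply: le_trans (norm2_tri (u n0) _ _) _; rewrite [leRHS]addrC; apply: lerD => //; rewrite norm2BC ltW.
Qed.

Hypothesis sepM : norm2_separable M.

(** The maps [phi n] contract the operator norm, so the later steps move the image of x from stage n
    by at most ||x|| / 2^n, ||x|| / 2^(n+1), and so on. Hence the composites converge to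
    homomorphisms [psi]. *)
Theorem fd_tower_nonunital : exists (r : nat -> nat) (rho : nat -> nat -> nat) (u : nat -> nat -> M),
  [/\ forall n, blocks (r n) (rho n), forall n, msys (r n) (rho n) (u n),
    forall n x, mspan (r n) (rho n) (u n) x -> mspan (r n.+1) (rho n.+1) (u n.+1) x
  & forall a (e : R), 0 < e -> exists n, exists2 b, mspan (r n) (rho n) (u n) b & N (b - a) < e].
Proof.
have [D Dc Dd] := sepM.
have [d dD] : exists d : nat -> M, forall a (e : R), 0 < e -> exists n, N (d n - a) < e.
  have D0 : D !=set0 by have [b Db _] := Dd 0 1 ltr01; exists b.
  have [d hd] : exists d : nat -> M, D `<=` range d.
    have /countable_injP [f finj] := Dc.
    have /choice [d dE] : forall n, exists x, (exists2 y, D y & f y = n) -> D x /\ f x = n.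
      move=> n; have [[y Dy fy]|h] := pselect (exists2 y, D y & f y = n); first by exists y.
      by exists 0.
    exists d => x Dx; exists (f x) => //; have [|h1 h2] := dE (f x); first by exists x.
    by apply: finj; rewrite ?inE.
  exists d => a e e0; have [b Db ab] := Dd a e e0; have [n _ dn] := hd _ Db.
  by exists n; rewrite dn norm2BC.
have /choice [nxt nxtP] : forall Sn : stage * nat, exists Sp : stage * (M -> M),
  [/\ hom_on (st_span Sn.1) Sp.2, forall x, st_span Sn.1 x -> st_span Sp.1 (Sp.2 x),
    forall x, st_span Sn.1 x -> rnorm (Sp.2 x) <= rnorm x,
    forall x, st_span Sn.1 x -> N (Sp.2 x - x) <= rnorm x / 2 ^+ Sn.2
  & forall a, a \in map d (iota 0 Sn.2.+1) ->
      exists2 b, st_span Sp.1 b & rnorm b <= rnorm a * 2 /\ N (b - a) <= 1 / 2 ^+ Sn.2].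
  move=> [S n]; have [S' [phi h]] := next_hom S (map d (iota 0 n.+1)) n.
  by exists (S', phi).
have b0 : blocks 0 id by [].
have s0 : msys 0 id (fun=> 0 : M) by [].
have z0 i : (i < 0)%N -> (fun=> 0 : M) i != 0 by [].
(* The construction starts at the zero algebra. *)
pose St := fix St n : stage := if n is n'.+1 then (nxt (St n', n')).1 else Stage b0 s0 z0.
pose F n := st_span (St n); pose phi n := (nxt (St n, n)).2.
have P1 n : hom_on (F n) (phi n) by case: (nxtP (St n, n)).
have P2 n x : F n x -> F n.+1 (phi n x) by case: (nxtP (St n, n)) => _ h _ _ _; exact: h.
have P3 n x : F n x -> rnorm (phi n x) <= rnorm x by case: (nxtP (St n, n)) => _ _ h _ _; exact: h.
have P4 n x : F n x -> N (phi n x - x) <= rnorm x / 2 ^+ n.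
  by case: (nxtP (St n, n)) => _ _ _ h _; exact: h.
have P5 n k : (k <= n)%N -> exists2 b, F n.+1 b & rnorm b <= rnorm (d k) * 2 /\ N (b - d k) <= 1 / 2 ^+ n.
  move=> kn; case: (nxtP (St n, n)) => _ _ _ _ h; apply: h.
  by apply/mapP; exists k => //; rewrite mem_iota.
pose comp := fix comp n m (x : M) : M := if m is m'.+1 then phi (n + m')%N (comp n m' x) else x.
have compF n m x : F n x -> F (n + m)%N (comp n m x).
  by elim: m => [|m IH] Fx /=; rewrite ?addn0 // addnS; apply: P2; exact: IH.
have comp_rnorm n m x : F n x -> rnorm (comp n m x) <= rnorm x.
  move=> Fx; elim: m => //= m IH; apply: le_trans IH; apply: P3; exact: compF.
have comp_step n m x : F n x -> N (comp n m.+1 x - comp n m x) <= rnorm x / 2 ^+ n / 2 ^+ m.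
  move=> Fx /=; apply: le_trans (P4 _ _ (compF _ _ _ Fx)) _.
  rewrite exprD invfM mulrA ler_wpM2r ?invr_ge0 ?exprn_ge0 // ler_wpM2r ?invr_ge0 ?exprn_ge0 //.
  exact: comp_rnorm.
have comp_lim n x : exists a, F n x -> bcvg (fun m => comp n m x) a /\ N (a - x) <= rnorm x / 2 ^+ n * 2.
  have [Fx|nFx] := pselect (F n x); last by exists 0.
  have K0 : 0 <= rnorm x / 2 ^+ n by rewrite divr_ge0 ?rnorm_ge0 ?exprn_ge0.
  have C0 : 0 < rnorm x + 1 by rewrite ltr_wpDl ?rnorm_ge0.
  have hC m : rnorm (comp n m x) <= rnorm x + 1.
    by apply: le_trans (comp_rnorm n m x Fx) _; rewrite lerDl.
  have hstep := fun m => comp_step n m x Fx.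
  have [a _ ha] := bcvg_complete C0 hC (geometric_cauchy K0 hstep).
  exists a => _; split=> //; apply: (norm2_lim_le ha) => m.
  by have := geometric_tail K0 hstep 0 m; rewrite expr0 divr1.
have /choice [psi psiP] : forall nx : nat * M, exists a, F nx.1 nx.2 ->
    bcvg (fun m => comp nx.1 m nx.2) a /\ N (a - nx.2) <= rnorm nx.2 / 2 ^+ nx.1 * 2.
  by move=> [n x]; exact: comp_lim.
have psi_lim n x : F n x -> bcvg (fun m => comp n m x) (psi (n, x)) by move=> /(psiP (n, x)) [].
have psi_near n x : F n x -> N (psi (n, x) - x) <= rnorm x / 2 ^+ n * 2 by move=> /(psiP (n, x)) [].
have hbn n : blocks (st_size (St n)) (st_rho (St n)) := @st_blocks (St n).
have hvn n : msys (st_size (St n)) (st_rho (St n)) (st_unit (St n)) := @st_msys (St n).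
have FD n x y : F n x -> F n y -> F n (x + y) by exact: mspanD.
have FZ n c x : F n x -> F n (c *: x) by exact: mspanZ.
have FM n x y : F n x -> F n y -> F n (x ** y) by exact: (mspanM (hbn n) (hvn n)).
have Fs n x : F n x -> F n (star x) by exact: mspan_star.
have compD n m x y : F n x -> F n y -> comp n m (x + y) = comp n m x + comp n m y.
  by move=> Fx Fy; elim: m => //= m ->; apply: (hom_onD (P1 _)); exact: compF.
have compZ n m c x : F n x -> comp n m (c *: x) = c *: comp n m x.
  by move=> Fx; elim: m => //= m ->; apply: (hom_onZ (P1 _)); exact: compF.
have compM n m x y : F n x -> F n y -> comp n m (x ** y) = comp n m x ** comp n m y.
  by move=> Fx Fy; elim: m => //= m ->; apply: (hom_onM (P1 _)); exact: compF.
have comps n m x : F n x -> comp n m (star x) = star (comp n m x).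
  by move=> Fx; elim: m => //= m ->; apply: (hom_on_star (P1 _)); exact: compF.
have psi_hom n : hom_on (F n) (fun x => psi (n, x)).
  split=> [x y Fx Fy|c x Fx|x y Fx Fy|x Fx].
  - apply: (bcvg_unique (psi_lim _ _ (FD _ _ _ Fx Fy))).
    by apply: bcvg_ext (bcvgD (psi_lim _ _ Fx) (psi_lim _ _ Fy)) => m; rewrite compD.
  - apply: (bcvg_unique (psi_lim _ _ (FZ _ c _ Fx))).
    by apply: bcvg_ext (bcvgZ c (psi_lim _ _ Fx)) => m; rewrite compZ.
  - apply: (bcvg_unique (psi_lim _ _ (FM _ _ _ Fx Fy))).
    by apply: bcvg_ext (bcvgM (psi_lim _ _ Fx) (psi_lim _ _ Fy)) => m; rewrite compM.
  - apply: (bcvg_unique (psi_lim _ _ (Fs _ _ Fx))).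
    by apply: bcvg_ext (bcvg_star (psi_lim _ _ Fx)) => m; rewrite comps.
(* Both are limits of the same composites, up to a shift; this makes the images of the limit maps
   increase. *)
have psi_phi n x : F n x -> psi (n.+1, phi n x) = psi (n, x).
  move=> Fx; apply: (bcvg_unique (psi_lim _ _ (P2 _ _ Fx))).
  apply: bcvg_ext (bcvg_shift (psi_lim _ _ Fx)) => m; elim: m => [|m IH] /=; first by rewrite addn0.
  by rewrite -IH /= addSnnS.
pose r n := st_size (St n); pose rho n := st_rho (St n).
pose u n i := psi (n, st_unit (St n) i).
have psi_span n x : F n x -> mspan (r n) (rho n) (u n) (psi (n, x)).
  by move=> [c ->]; exists c; exact: (hom_on_msum (hbn n) _ (hvn n) (psi_hom n)).
have span_psi n y : mspan (r n) (rho n) (u n) y -> exists2 x, F n x & y = psi (n, x).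
  move=> [c ->]; exists (msum (r n) (rho n) c (st_unit (St n))); first by exists c.
  by apply/esym; exact: (hom_on_msum (hbn n) _ (hvn n) (psi_hom n)).
exists r, rho, u; split=> //.
- by move=> n; exact: (hom_on_msys (hbn n) (hvn n) (psi_hom n)).
- by move=> n y /span_psi [x Fx ->]; rewrite -psi_phi //; apply: psi_span; exact: P2.
- move=> a e e0; have e3 : 0 < e / 3 by rewrite divr_gt0.
  have [k dk] := dD a _ e3.
  (* The factor 4 combines the 2 from truncation in ||b|| <= 2 ||d k|| with the 2 from the geometric
     series in [psi_near]. *)
  have [n1 h1] := inv_exp2_le 1 e3; have [n2 h2] := inv_exp2_le (rnorm (d k) * 4) e3.
  pose n := maxn k (maxn n1 n2).
  have [b Fb [b1 b2]] := P5 n k (leq_maxl _ _).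
  exists n.+1, (psi (n.+1, b)); first exact: psi_span.
  apply: le_lt_trans (norm2_tri b _ _) _.
  apply: le_lt_trans (lerD (lexx _) (norm2_tri (d k) _ _)) _.
  have k1 : 1 / 2 ^+ n < e / 3 by apply: h1; rewrite !leq_max leqnn orbT.
  have k2 : rnorm (d k) * 4 / 2 ^+ n.+1 < e / 3 by apply: h2; apply: leqW; rewrite !leq_max leqnn !orbT.
  have k3 : N (psi (n.+1, b) - b) <= rnorm (d k) * 4 / 2 ^+ n.+1.
    apply: le_trans (psi_near _ _ Fb) _; rewrite mulrAC ler_wpM2r ?invr_ge0 ?exprn_ge0 //.
    by move: b1; lra.
  by move: k1 k2 k3 b2 dk; lra.
Qed.
End Intertwining.

(** * Adjoining the unit *)

Section UnitalSystem.
Variables (R : realType) (A : cstarType R) (r : nat) (rho : nat -> nat) (v : nat -> A) (one : A).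
Hypotheses (hb : blocks r rho) (hv : msys r rho v).
Hypotheses (one_sa : star one = one) (one_l : forall a, one ** a = a) (one_r : forall a, a ** one = a).

(* Adjoining the complement of the support makes the system unital; this is what allows the
   connecting maps of the tower to be non-unital up to here. *)
Definition ext_rho (i : nat) : nat := if (i < r)%N then rho i else i.
Definition ext_unit (i : nat) : A := if (i < r)%N then v i else one - msupp v r.

Lemma ext_blocks : blocks r.+1 ext_rho.
Proof.
move=> i ir; rewrite /ext_rho; case: ifP => h; last by rewrite h.
by rewrite (rho_lt hb h) (rho_rho hb h); have [] := hb h.
Qed.

Lemma ext_msys : msys r.+1 ext_rho ext_unit.
Proof.
have sq := msupp_sa v r.
have vq j : (j < r)%N -> star (v j) ** (one - msupp v r) = 0.
  by move=> jr; rewrite cmulBr one_r (msupp_l hb hv) ?subrr.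
have qv j : (j < r)%N -> star (one - msupp v r) ** v j = 0.
  by move=> jr; rewrite -(starK (v j)) -starM vq ?star0.
have qq : msupp v r ** msupp v r = msupp v r.
  rewrite {1}/msupp cmul_suml; apply: eq_bigr => i _.
  by rewrite -cmulA (msupp_l hb hv).
move=> i j; rewrite !ltnS /ext_unit /ext_rho.
case: (ltngtP i r) => // ir _; case: (ltngtP j r) => // jr _.
- by rewrite hv // (rho_lt hb ir).
- by rewrite vq // jr (ltn_eqF ir).
- by rewrite qv // ir (gtn_eqF jr).
- rewrite ir jr eqxx ltnn starB one_sa sq cmulBl one_l cmulBr one_r qq subrr subr0 //.
Qed.

Lemma mspan_sub (S : set A) r' rho' (u : nat -> A) : S 0 -> (forall a b, S a -> S b -> S (a + b)) ->
  (forall c a, S a -> S (c *: a)) ->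
  (forall i j, (i < r')%N -> (j < r')%N -> rho' i = rho' j -> S (u i ** star (u j))) ->
  forall x, mspan r' rho' u x -> S x.
Proof.
move=> S0 SD SZ Su x [c ->]; elim/big_ind: _ => // i _; elim/big_ind: _ => // j /eqP ij.
by apply: SZ; exact: Su.
Qed.

Lemma ext_mspan_mono x : mspan r rho v x -> mspan r.+1 ext_rho ext_unit x.
Proof.
apply: mspan_sub => [|||i j ir jr ij]; [exact: mspan0|exact: mspanD|exact: mspanZ|].
have -> : v i ** star (v j) = ext_unit i ** star (ext_unit j) by rewrite /ext_unit ir jr.
by apply: mspan_unit; rewrite ?(ltn_trans _ (ltnSn r)) //; rewrite /ext_rho ir jr.
Qed.

Lemma ext_one : mspan r.+1 ext_rho ext_unit one.
Proof.
rewrite -(subrK (msupp v r) one); apply: mspanD; last first.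
  apply: ext_mspan_mono; rewrite /msupp; elim/big_ind: _ => [||i _]; [exact: mspan0|exact: mspanD|].
  exact: mspan_unit.
have -> : one - msupp v r = ext_unit r by rewrite /ext_unit ltnn.
exact: (mspan_mem ext_blocks ext_msys).
Qed.

(** The adjoined unit is [one] minus an element of the old span, so the extended algebras still
    increase along the tower although the supports change. *)
Lemma ext_mspan_sub (S : set A) : S 0 -> (forall a b, S a -> S b -> S (a + b)) ->
  (forall c a, S a -> S (c *: a)) -> (forall a b, S a -> S b -> S (a ** b)) ->
  (forall a, S a -> S (star a)) -> S one -> (forall x, mspan r rho v x -> S x) ->
  forall x, mspan r.+1 ext_rho ext_unit x -> S x.
Proof.
move=> S0 SD SZ SM Ss S1 Sv; have Su i : S (ext_unit i).
  rewrite /ext_unit; case: ifP => ir; first by apply: Sv; exact: (mspan_mem hb hv).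
  apply: SD => //; rewrite -scaleN1r; apply: SZ; apply: Sv.
  rewrite /msupp; elim/big_ind: _ => [||j _]; [exact: mspan0|exact: mspanD|].
  exact: mspan_unit.
by apply: mspan_sub => // i j _ _ _; apply: SM => //; exact: Ss.
Qed.
End UnitalSystem.

(** * Closedness of finite dimensional subalgebras in the 2-norm *)

Section Tower.
Variables (R : realType) (M : tcAlgebra R).
Local Notation X := (@tc_traces R M).
Local Notation N := (norm2 X).

Definition norm2_closed (S : set M) : Prop :=
  forall x, (forall e : R, 0 < e -> exists2 y, S y & N (x - y) < e) -> S x.

(** A trace that does not vanish at p is divided by its value there; it is 2-norm continuous by
    [tau_le_norm2]. If all traces in X vanish at p, then p = 0 and f = 0 serves. *)
Lemma projection_coefficient (p : M) : star p = p -> p ** p = p -> exists f : M -> R[i],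
  [/\ forall x y, f (x - y) = f x - f y, exists2 K : R, 0 <= K & forall x, cabs (f x) <= K * N x
    & forall c, f (c *: p) *: p = c *: p].
Proof.
move=> sp pp; have [[tau Xt tp]|nt] := pselect (exists2 tau, X tau & trace_sqr tau p != 0).
  have ht := tcX Xt; pose t := trace_sqr tau p.
  have t0 : 0 < t by rewrite lt_def tp trace_sqr_ge0.
  have tauE : tau p = t%:C by rewrite -{1}pp -{1}sp trace_sqrE.
  exists (fun x => t^-1%:C * tau x); split.
  - by move=> x y; rewrite tauB // mulrBr.
  - exists (t^-1 * 4); first by rewrite mulr_ge0 // invr_ge0 ltW.
    move=> x; rewrite cabsM cabsR gtr0_norm ?invr_gt0 // -mulrA ler_pM2l ?invr_gt0 //.
    by apply: le_trans (tau_le_norm2 _ ht) _; rewrite ler_pM2l // norm2_ub.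
  - by move=> c; rewrite tauZ // tauE mulrCA -rmorphM mulVf ?gt_eqF // mulr1.
have -> : p = 0.
  apply: norm2_eq0; apply/eqP; rewrite eq_le norm2_ge0 andbT.
  apply: norm2_le => // tau Xt; rewrite /trace_norm2.
  have [->|h] := eqVneq (trace_sqr tau p) 0; first by rewrite sqrtr0.
  by case: nt; exists tau.
exists (fun=> 0); split.
- by move=> x y; rewrite subrr.
- by exists 0 => // x; rewrite cabs0 mul0r.
- by move=> c; rewrite !scaler0.
Qed.

(** The map [Q] reads off coefficients by the functionals above. It is Lipschitz for the 2-norm,
    takes values in the span and fixes it, so a limit of elements of the span is fixed by [Q]
    too. *)
Lemma mspan_norm2_closed r rho (v : nat -> M) : blocks r rho -> msys r rho v ->
  norm2_closed (mspan r rho v).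
Proof.
move=> hb hv x hx.
have /choice [f fP] : forall i, exists f : M -> R[i], (i < r)%N -> [/\ forall x y, f (x - y) = f x - f y,
    exists2 K : R, 0 <= K & forall x, cabs (f x) <= K * N x
    & forall c, f (c *: v (rho i)) *: v (rho i) = c *: v (rho i)].
  move=> i; have [ir|_] := ltnP i r; last by exists (fun=> 0).
  have [f h] := projection_coefficient (msys_sa hv ir) (msys_idem hb hv ir); by exists f.
have /choice [K KP] : forall i, exists K : R, (i < r)%N -> 0 <= K /\ forall x, cabs (f i x) <= K * N x.
  move=> i; have [ir|_] := ltnP i r; last by exists 0.
  by have [_ [K K0 hK] _] := fP i ir; exists K.
pose Q y := msum r rho (fun i j => f i (star (v i) ** y ** v j)) v.
have Qid y : mspan r rho v y -> Q y = y.
  move=> [c ->]; rewrite -/(msum _ _ _ _) /Q {1 3}/msum; apply: eq_bigr => i _; apply: eq_bigr => j /eqP ij.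
  have [_ _ fp] := fP i (ltn_ord i); rewrite (msum_coef hb c hv (ltn_ord i) (ltn_ord j) ij).
  have E : v i ** star (v j) = v i ** v (rho i) ** star (v j) by rewrite (msys_r hb hv).
  by rewrite E -cmulZl -cmulZr fp cmulZr cmulZl.
have v1 i : (i < r)%N -> rnorm (v i) <= 1 := msys_rnorm hb hv (i := i).
have QN y z : N (Q y - Q z) <= (\sum_(i < r) \sum_(j < r) K i) * N (y - z).
  rewrite /Q /msum -sumrB; apply: le_trans (norm2_sum _ _ _) _; rewrite mulr_suml; apply: ler_sum => i _.
  rewrite -sumrB; apply: le_trans (norm2_sum _ _ _) _; rewrite mulr_suml big_mkcond; apply: ler_sum => j _.
  have [K0 hK] := KP i (ltn_ord i); have [fB _ _] := fP i (ltn_ord i).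
  case: ifP => _; last by rewrite mulr_ge0 ?norm2_ge0.
  rewrite -scalerBl norm2Z -fB -cmulBl -cmulBr -[leRHS]mulr1; apply: ler_pM; rewrite ?cabs_ge0 ?norm2_ge0 //.
    apply: le_trans (hK _) _; rewrite ler_wpM2l //.
    apply: le_trans (norm2Mr _ _) _; rewrite -[leRHS]mulr1; apply: ler_pM; rewrite ?rnorm_ge0 ?norm2_ge0 ?v1 //.
    apply: le_trans (norm2Ml _ _) _; rewrite rnorm_star -[leRHS]mul1r.
    by apply: ler_pM; rewrite ?rnorm_ge0 ?norm2_ge0 ?v1.
  apply: le_trans (norm2_rnorm _) _; apply: le_trans (rnormM _ _) _; rewrite rnorm_star.
  by rewrite -[1]mulr1; apply: ler_pM; rewrite ?rnorm_ge0 ?v1.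
set C := \sum_(i < r) _ in QN.
have C0 : 0 <= C by apply: sumr_ge0 => i _; apply: sumr_ge0 => j _; case: (KP i (ltn_ord i)).
suff -> : x = Q x by eexists.
apply/esym/eqP; rewrite -subr_eq0; apply/eqP/norm2_eq0/eqP; rewrite eq_le norm2_ge0 andbT.
apply/ler_addgt0Pr => e e0; rewrite add0r.
have C1 : 0 < C + 1 by rewrite ltr_wpDl.
have [y Sy xy] := hx _ (divr_gt0 e0 C1); apply: le_trans (norm2_tri (Q y) _ _) _.
rewrite {2}(Qid _ Sy) (norm2BC y); apply: le_trans (lerD (QN _ _) (lexx _)) _.
move: xy; rewrite ltr_pdivlMr // => /ltW; apply: le_trans; apply: eq_le_num; ring.
Qed.

Lemma norm_closed (S : set M) : norm2_closed S -> closed S.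
Proof.
move=> hS x hx; apply: hS => e e0; have eC : 0 < e%:C by rewrite ltcR.
have [y [Sy]] := hx _ (nbhsx_ballx x _ eC); rewrite -ball_normE /= rnormE ltcR => xy.
by exists y => //; apply: le_lt_trans (norm2_rnorm _) xy.
Qed.

Lemma mspan_fd r rho (v : nat -> M) : blocks r rho -> msys r rho v ->
  exists s : seq M, (forall a, a \in s -> mspan r rho v a) /\
    forall a, mspan r rho v a -> exists c : 'I_(size s) -> R[i], a = \sum_(i < size s) c i *: s`_i.
Proof.
move=> hb hv.
pose f (p : 'I_r * 'I_r) : M := if rho p.1 == rho p.2 then v p.1 ** star (v p.2) else 0.
exists [seq f p | p <- enum {: 'I_r * 'I_r}]; split.
  move=> a /mapP [p _ ->]; rewrite /f; case: eqP => h; last exact: mspan0.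
  exact: mspan_unit.
have gen (l : seq ('I_r * 'I_r)) (g : 'I_r * 'I_r -> R[i]) :
    exists c : 'I_(size (map f l)) -> R[i], \sum_(p <- l) g p *: f p = \sum_(i < size (map f l)) c i *: (map f l)`_i.
  elim: l => [|p l [c IH]]; first by exists (fun=> 0); rewrite big_nil big_ord0.
  exists (fun k => oapp c (g p) (unlift ord0 k)).
  rewrite big_cons IH /= big_ord_recl unlift_none /=; congr (_ + _).
  by apply: eq_bigr => i _; rewrite liftK.
move=> a [c ->]; have [c' cE] := gen (enum {: 'I_r * 'I_r}) (fun p => c p.1 p.2).
exists c'; rewrite -cE big_enum /= -(pair_big xpredT xpredT (fun i j : 'I_r => c i j *: f (i, j))) /=.
apply: eq_bigr => i _; rewrite big_mkcond; apply: eq_bigr => j _.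
by rewrite /f /=; case: ifP; rewrite ?scaler0.
Qed.

Hypotheses (hM : hyperfinite M) (sepM : norm2_separable M).

Theorem fd_tower : exists (one : M) (G : nat -> set M),
  [/\ star one = one, rnorm one <= 1, (forall a, one ** a = a) /\ (forall a, a ** one = a),
    (forall n, G n one) /\ (forall n x, G n x -> G n.+1 x)
  & (forall n, exists r rho v, [/\ blocks r rho, msys r rho v & G n = mspan r rho v]) /\
    forall a (e : R), 0 < e -> exists n, exists2 b, G n b & N (b - a) < e].
Proof.
have [one [h1 h2 h3 h4]] := tc_unit hM.
have [r [rho [u [hb hu mono dense]]]] := fd_tower_nonunital hM sepM.
pose G n := mspan (r n).+1 (ext_rho (r n) (rho n)) (ext_unit (r n) (u n) one).
have hb' n := ext_blocks (hb n); have hu' n := ext_msys (hb n) (hu n) h1 h3 h4.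
have G1 n : G n one by exact: (ext_one (hb n) (hu n) h1 h3 h4).
exists one, G; split=> //; split=> //.
- move=> n; apply: (ext_mspan_sub (hb n) (hu n)) => //.
  + exact: mspan0.
  + exact: mspanD.
  + exact: mspanZ.
  + exact: (mspanM (hb' n.+1) (hu' n.+1)).
  + exact: mspan_star.
  + by move=> x /mono; exact: ext_mspan_mono.
- by move=> n; exists (r n).+1, (ext_rho (r n) (rho n)), (ext_unit (r n) (u n) one); split.
- move=> a e /dense -/(_ a) [n [b Gb ab]]; exists n, b => //; exact: ext_mspan_mono.
Qed.
End Tower.

(** * Inductive limits inside a tracially complete algebra *)

Section SubAlg.
Variables (R : realType) (A : cstarType R).

(** Closedness takes the place of a dimension bound, because the norm closure of the union of the
    tower is of this form as well. *)
Record cstar_subalg := CstarSubalg {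
  csub :> set A ;
  csub0 : csub 0 ;
  csubD : forall a b, csub a -> csub b -> csub (a + b) ;
  csubZ : forall (c : R[i]) a, csub a -> csub (c *: a) ;
  csubM : forall a b, csub a -> csub b -> csub (a ** b) ;
  csub_star : forall a, csub a -> csub (star a) ;
  csub_closed : closed csub }.

Variable S : cstar_subalg.

Definition csub_pred : {pred A} := fun x => x \in (S : set A).

Lemma csub_submod : submod_closed csub_pred.
Proof.
split; first by rewrite inE; exact: csub0.
move=> c x y; rewrite !inE => Sx Sy.
by apply: csubD => //; apply: csubZ.
Qed.

HB.instance Definition _ := GRing.isSubmodClosed.Build R[i] A csub_pred csub_submod.

Definition csub_type : Type := {x : A | csub_pred x}.
HB.instance Definition _ := [isSub of csub_type for @sval A csub_pred].
HB.instance Definition _ := [Choice of csub_type by <:].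
HB.instance Definition _ := [SubChoice_isSubLmodule of csub_type by <:].

Definition csub_norm (x : csub_type) : R[i] := `|val x|.
Lemma csub_normD x y : csub_norm (x + y) <= csub_norm x + csub_norm y.
Proof. by rewrite /csub_norm raddfD ler_normD. Qed.
Lemma csub_normZ (l : R[i]) x : csub_norm (l *: x) = `|l| * csub_norm x.
Proof. by rewrite /csub_norm linearZ normrZ. Qed.
Lemma csub_norm0 x : csub_norm x = 0 -> x = 0.
Proof. by move=> /normr0_eq0 x0; apply: val_inj; rewrite x0 raddf0. Qed.

HB.instance Definition _ := @Lmodule_isNormed.Build R[i] csub_type csub_norm
   csub_normD csub_normZ csub_norm0.

Lemma csub_complete (F : set_system csub_type) :
  ProperFilter F -> cauchy F -> cvg F.
Proof.
move=> FF FC.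
have FvC : cauchy (val @ F).
  apply: cauchy_exP => e e0; have /cauchyP /(_ e e0) [x Fx] := FC.
  exists (val x); rewrite /= nbhs_simpl /=; apply: filterS Fx => y.
  by rewrite -!ball_normE /=.
have /cauchy_cvgP/cvg_ex [x Fx] := FvC.
have Sx : csub S x.
  apply: (@closed_cvg csub_type A F _ (val : csub_type -> A) (csub S) (@csub_closed S) _ x Fx).
  by apply: nearW => y; have := valP y; rewrite inE.
pose y : csub_type := exist _ x (mem_set Sx).
apply/cvg_ex; exists y; apply/cvgrPdist_lt => e e0.
by move/cvgrPdist_lt : Fx => /(_ e e0).
Qed.

HB.instance Definition _ := Uniform_isComplete.Build csub_type csub_complete.

Definition csub_mk x (Sx : csub S x) : csub_type := exist _ x (mem_set Sx).
Lemma csubP (x : csub_type) : csub S (val x).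
Proof. by have := valP x; rewrite inE. Qed.

Definition csub_mul (x y : csub_type) := csub_mk (csubM (csubP x) (csubP y)).
Definition csub_str (x : csub_type) := csub_mk (csub_star (csubP x)).

Lemma csub_mulA : associative csub_mul.
Proof. by move=> x y z; apply: val_inj; rewrite /= cmulA. Qed.
Lemma csub_mulDl : left_distributive csub_mul +%R.
Proof. by move=> x y z; apply: val_inj; rewrite /= cmulDl. Qed.
Lemma csub_mulDr : right_distributive csub_mul +%R.
Proof. by move=> x y z; apply: val_inj; rewrite /= cmulDr. Qed.
Lemma csub_mulZl (c : R[i]) a b : csub_mul (c *: a) b = c *: csub_mul a b.
Proof. by apply: val_inj; rewrite /= cmulZl. Qed.
Lemma csub_mulZr (c : R[i]) a b : csub_mul a (c *: b) = c *: csub_mul a b.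
Proof. by apply: val_inj; rewrite /= cmulZr. Qed.
Lemma csub_strK : involutive csub_str.
Proof. by move=> x; apply: val_inj; rewrite /= starK. Qed.
Lemma csub_strD a b : csub_str (a + b) = csub_str a + csub_str b.
Proof. by apply: val_inj; rewrite /= starD. Qed.
Lemma csub_strZ (c : R[i]) a : csub_str (c *: a) = c^* *: csub_str a.
Proof. by apply: val_inj; rewrite /= starZ. Qed.
Lemma csub_strM a b : csub_str (csub_mul a b) = csub_mul (csub_str b) (csub_str a).
Proof. by apply: val_inj; rewrite /= starM. Qed.
Lemma csub_cnormM (a b : csub_type) : `|csub_mul a b| <= `|a| * `|b|.
Proof. exact: cnormM. Qed.
Lemma csub_cstar (a : csub_type) : `|csub_mul (csub_str a) a| = `|a| ^+ 2.
Proof. exact: cstar_identity. Qed.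
HB.instance Definition _ := isCStarAlgebra.Build R csub_type csub_mulA csub_mulDl csub_mulDr
  csub_mulZl csub_mulZr csub_strK csub_strD csub_strZ csub_strM csub_cnormM csub_cstar.
Definition csub_alg : cstarType R := csub_type.
End SubAlg.

(** * Restriction of traces to a subalgebra *)

Section TraceRestriction.
Variables (R : realType) (M : tcAlgebra R) (S : cstar_subalg M).
Local Notation X := (@tc_traces R M).
Local Notation B := (csub_alg S).

Definition csub_traces : set (B -> R[i]) := [set (tau \o (val : B -> M)) | tau in X].

Lemma csub_norm2 (x : B) : norm2 csub_traces x = norm2 X (val x).
Proof. by rewrite /norm2 /csub_traces image_comp. Qed.

Variable one : M.
Hypotheses (one_sa : star one = one) (one1 : rnorm one <= 1).
Hypotheses (one_l : forall a, one ** a = a) (S1 : csub S one).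

(** Only the norm could drop under restriction. Cauchy-Schwarz against [one] bounds |tau(a)| by
    ||one||_2 on the unit ball of M, so tau(one) has modulus at least 1, and [one] lies in S. *)
Lemma csub_is_trace tau : is_trace tau -> is_trace (tau \o (val : B -> M)).
Proof.
move=> ht; pose one' : B := csub_mk S1.
have n1 : 1 <= trace_norm2 tau one.
  apply/ler_addgt0Pr => e e0; have [a a1 ae] := trace_norm_approx ht e0.
  rewrite -lerBlDr; apply: le_trans (ltW ae) _; rewrite -(one_l a) -{1}one_sa.
  apply: le_trans (trace_CS2 ht _ _) _; rewrite ler_piMr ?trace_norm2_ge0 //.
  exact: le_trans (trace_norm2_rnorm ht a) a1.
have t1 : 1 <= cabs (tau one).
  rewrite -(one_l one) -{1}one_sa trace_sqrE // cabsR ger0_norm ?trace_sqr_ge0 //.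
  by rewrite -trace_norm2_sqr // exprn_ege1.
split=> /=.
- by move=> a b; exact: (tauD ht).
- by move=> c a; exact: (tauZ ht).
- by move=> a; exact: (trace_ge0 ht).
- set E := [set _ | _ in _].
  have E1 : ubound E 1.
    move=> _ [a /= a1 <-]; apply: le_trans (tau_bound ht (val a)) _.
    by move: a1; rewrite rnormE lecR.
  have Et : E (cabs (tau one)).
    by exists one' => //=; rewrite rnormE lecR.
  apply/eqP; rewrite eq_le; apply/andP; split; first by apply: ge_sup => //; exists (cabs (tau one)).
  by apply: le_trans t1 _; apply: ub_le_sup => //; exists 1.
- by move=> a b; exact: (tauC ht).
Qed.

Hypothesis Scl : norm2_closed (csub S).

Lemma csub_tracially_complete : tracially_complete csub_traces.
Proof.
split.
- by move=> _ [tau Xt <-]; apply: csub_is_trace; exact: tcX.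
- pose g (tau : {ptws M -> R[i]^o}) : {ptws B -> R[i]^o} := tau \o (val : B -> M).
  have -> : csub_traces = g @` X by [].
  apply: (@continuous_compact _ _ g); last exact: tc_compact (@tcP R M).
  apply: continuous_subspaceT => tau.
  apply/(@pointwise_cvgP B R[i]^o (g @ nbhs tau) (g tau)) => t.
  exact: (@eval_continuous R M (val t) tau).
- move=> t _ _ t01 [s Xs <-] [u Xu <-]; exists (fun a => t%:C * s a + (1 - t)%:C * u a) => //.
  exact: (tc_convex (@tcP R M) t01 Xs Xu).
- split.
  + by move=> a b; rewrite !csub_norm2; exact: norm2D.
  + by move=> c a; rewrite !csub_norm2; exact: norm2Z.
  + by move=> a; rewrite csub_norm2 => /norm2_eq0 a0; apply: val_inj.
- move=> u u1 uc.
  have uc' : norm2_cauchy X (fun n => val (u n)).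
    move=> e e0; have [n0 hn] := uc e e0; exists n0 => m n hm hn'.
    by have := hn _ _ hm hn'; rewrite csub_norm2.
  have [a a1 ua] := bcvg_complete ltr01 (u1 : forall n, rnorm (val (u n)) <= 1) uc'.
  have Sa : csub S a.
    apply: Scl => e e0; have [_ /(_ e e0) [n0 /(_ n0 (leqnn _)) h]] := ua.
    by exists (val (u n0)); [exact: csubP|rewrite norm2BC].
  exists (csub_mk Sa) => //; have bu : bounded_seq (fun n => val (u n)) by exists 1.
  have := (proj1 (bcvg_norm2_cvg a bu)) ua; rewrite /norm2_cvg.
  by under [in X in _ -> X]eq_fun do rewrite csub_norm2.
Qed.

Definition csub_tc : tcAlgebra R := TcAlgebra csub_tracially_complete.
End TraceRestriction.

(** * The inductive limit of the tower *)

Section TowerLimit.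
Variables (R : realType) (M : tcAlgebra R) (one : M) (G : nat -> set M).
Local Notation X := (@tc_traces R M).
Local Notation N := (norm2 X).
Hypotheses (one_sa : star one = one) (one1 : rnorm one <= 1).
Hypotheses (one_l : forall a, one ** a = a) (G1 : forall n, G n one).
Hypothesis Gmono : forall n x, G n x -> G n.+1 x.
Hypothesis Gspan : forall n, exists r rho v, [/\ blocks r rho, msys r rho v & G n = mspan r rho v].
Hypothesis Gdense : forall a (e : R), 0 < e -> exists n, exists2 b, G n b & N (b - a) < e.

Let Gcl n : norm2_closed (G n).
Proof. by have [r [rho [v [hb hv ->]]]] := Gspan n; exact: mspan_norm2_closed. Qed.
Let G0 n : G n 0. Proof. by have [r [rho [v [_ _ ->]]]] := Gspan n; exact: mspan0. Qed.
Let GD n a b : G n a -> G n b -> G n (a + b).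
Proof. by have [r [rho [v [_ _ ->]]]] := Gspan n; exact: mspanD. Qed.
Let GZ n (c : R[i]) a : G n a -> G n (c *: a).
Proof. by have [r [rho [v [_ _ ->]]]] := Gspan n; exact: mspanZ. Qed.
Let GM n a b : G n a -> G n b -> G n (a ** b).
Proof. by have [r [rho [v [hb hv ->]]]] := Gspan n; exact: (mspanM hb hv). Qed.
Let Gs n a : G n a -> G n (star a).
Proof. by have [r [rho [v [_ _ ->]]]] := Gspan n; exact: mspan_star. Qed.
Let Gfd n : fd_cstar_subalgebra (G n).
Proof.
split; [exact: G0|exact: GD|exact: GZ|exact: GM|exact: Gs|exact: norm_closed|].
by have [r [rho [v [hb hv ->]]]] := Gspan n; have [s [_ hs]] := mspan_fd hb hv; exists s.
Qed.
Let Gmon m n x : (m <= n)%N -> G m x -> G n x.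
Proof. by move=> /subnKC <- Gx; elim: (n - m)%N => [|k IH]; rewrite ?addn0 // addnS; exact: Gmono. Qed.

Definition tower_alg n : cstar_subalg M :=
  CstarSubalg (@G0 n) (@GD n) (@GZ n) (@GM n) (@Gs n) (norm_closed (@Gcl n)).
Definition tower n : tcAlgebra R :=
  @csub_tc R M (tower_alg n) one one_sa one1 one_l (G1 n) (@Gcl n).
Definition tower_map n (x : tower n) : tower n.+1 :=
  @csub_mk R M (tower_alg n.+1) (val x) (Gmono (csubP x)).

Lemma tower_fd n : finite_dimensional (tower n).
Proof.
have [s [sG sspan]] : exists s : seq M, (forall a, a \in s -> G n a) /\
    forall a, G n a -> exists c : 'I_(size s) -> R[i], a = \sum_(i < size s) c i *: s`_i.
  by have [r [rho [v [hb hv ->]]]] := Gspan n; exact: mspan_fd.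
pose f (a : M) : tower n := if pselect (G n a) is left h then @csub_mk R M (tower_alg n) a h else 0.
have fE a : G n a -> val (f a) = a by rewrite /f; case: pselect.
exists (map f s) => a; have [c aE] := sspan _ (csubP a).
exists (fun i => c (cast_ord (size_map f s) i)); apply: val_inj; rewrite aE raddf_sum /=.
rewrite [RHS](reindex (cast_ord (esym (size_map f s)))) /=; last first.
  by exists (cast_ord (size_map f s)) => i _; rewrite ?cast_ordK ?cast_ordKV.
apply: eq_bigr => i _; rewrite cast_ordKV (nth_map 0) ?ltn_ord //.
by rewrite fE //; apply: sG; exact: mem_nth.
Qed.

Lemma tower_map_morphism n : tc_morphism (@tower_map n).
Proof.
split; first by split=> *; apply: val_inj.
by move=> _ [tau Xt <-]; exists tau.
Qed.

(** The C*-inductive limit is realised inside M as the operator norm closure of the union; the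
    connecting maps are then inclusions. *)
Let U : set M := [set x | forall e : R, 0 < e -> exists n, exists2 b, G n b & rnorm (x - b) < e].

Let GU n x : G n x -> U x.
Proof. by move=> Gx e e0; exists n, x => //; rewrite subrr rnorm0. Qed.
Let UD a b : U a -> U b -> U (a + b).
Proof.
move=> Ua Ub e e0; have e2 : 0 < e / 2 by rewrite divr_gt0.
have [m [c Gc ac]] := Ua _ e2; have [n [d Gd bd]] := Ub _ e2.
exists (maxn m n), (c + d).
  by apply: GD; [apply: Gmon Gc; exact: leq_maxl|apply: Gmon Gd; exact: leq_maxr].
by rewrite opprD addrACA; apply: le_lt_trans (rnormD _ _) _; rewrite [ltRHS](splitr e) ltrD.
Qed.
Let UZ (c : R[i]) a : U a -> U (c *: a).
Proof.
move=> Ua e e0; have c1 : 0 < cabs c + 1 by rewrite ltr_wpDl ?cabs_ge0.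
have [n [b Gb ab]] := Ua _ (divr_gt0 e0 c1); exists n, (c *: b); first exact: GZ.
rewrite -scalerBr rnormZ; move: ab; rewrite ltr_pdivlMr //; apply: le_lt_trans.
by rewrite mulrC ler_wpM2l ?rnorm_ge0 // lerDl.
Qed.
Let UM a b : U a -> U b -> U (a ** b).
Proof.
move=> Ua Ub e e0.
pose K := rnorm a + rnorm b + 1; have K0 : 0 < K by rewrite ltr_wpDl ?addr_ge0 ?rnorm_ge0.
pose d : R := Num.min 1 (e / (2 * K)).
have d0 : 0 < d by rewrite lt_min ltr01 divr_gt0 // mulr_gt0.
have [m [c Gc ac]] := Ua _ d0; have [n [y Gy by_]] := Ub _ d0.
exists (maxn m n), (c ** y).
  by apply: GM; [apply: Gmon Gc; exact: leq_maxl|apply: Gmon Gy; exact: leq_maxr].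
have -> : a ** b - c ** y = a ** (b - y) + (a - c) ** y by salg.
have y1 : rnorm y <= rnorm b + 1.
  rewrite -[y in leLHS](subrK b) addrC; apply: le_trans (rnormD _ _) _; rewrite lerD2l.
  rewrite -rnormN opprB; apply: ltW; apply: lt_le_trans by_ _; by rewrite ge_min lexx.
have dK : 2 * K * d <= e.
  rewrite mulrC -ler_pdivlMr; last by rewrite mulr_gt0.
  by rewrite ge_min lexx orbT.
apply: le_lt_trans (rnormD _ _) _; apply: le_lt_trans (lerD (rnormM _ _) (rnormM _ _)) _.
have := rnorm_ge0 a; have := rnorm_ge0 b; have := rnorm_ge0 y; have := rnorm_ge0 (b - y).
have := rnorm_ge0 (a - c); move: ac by_ y1 dK d0 K0; rewrite /K.
set x1 := rnorm (a - c); set x2 := rnorm (b - y); set x3 := rnorm y; set x4 := rnorm a; set x5 := rnorm b.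
move=> h1 h2 h3 h4 h5 h6 h7 h8 h9 h10 h11.
have k1 : x4 * x2 <= x4 * d by rewrite ler_wpM2l // ltW.
have k2 : x1 * x3 <= d * (x5 + 1) by apply: ler_pM => //; exact: ltW.
have k3 : x4 * d + d * (x5 + 1) < 2 * (x4 + x5 + 1) * d by nra.
by apply: le_lt_trans (lerD k1 k2) _; apply: lt_le_trans k3 h4.
Qed.
Let Us a : U a -> U (star a).
Proof.
move=> Ua e /Ua [n [b Gb ab]]; exists n, (star b); first exact: Gs.
by rewrite -starB rnorm_star.
Qed.
Let Ucl : closed U.
Proof.
move=> x hx e e0; have e2 : 0 < e / 2 by rewrite divr_gt0.
have eC : 0 < (e / 2)%:C by rewrite ltcR.
have [y [Uy]] := hx _ (nbhsx_ballx x _ eC); rewrite -ball_normE /= rnormE ltcR => xy.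
have [n [b Gb yb]] := Uy _ e2; exists n, b => //.
have -> : x - b = (x - y) + (y - b) by rewrite addrA subrK.
by apply: le_lt_trans (rnormD _ _) _; rewrite [ltRHS](splitr e) ltrD.
Qed.

Definition tower_union : cstar_subalg M :=
  CstarSubalg (GU (@G0 0%N)) UD UZ UM Us Ucl.
Local Notation A := (csub_alg tower_union).
Definition tower_incl n (x : tower n) : A :=
  @csub_mk R M tower_union (val x) (GU (csubP x)).

Lemma tower_cstar_limit : cstar_limit tower_map tower_incl.
Proof.
split.
- by move=> n; split=> *; apply: val_inj.
- by move=> n a; apply: val_inj.
- move=> n a.
  have iterE k : val (phi_iter tower_map k a) = val a by elim: k.
  have -> : (fun k => rnorm (phi_iter tower_map k a)) = (fun=> rnorm (tower_incl a)).
    by apply/funext => k; rewrite -[LHS]/(rnorm (val (phi_iter tower_map k a))) iterE.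
  exact: cvg_cst.
- apply/seteqP; split=> // x _ B /nbhs_ballP [e /= e0 eB].
  have eE : e = (complex.Re e)%:C by rewrite RRe_real // gtr0_real.
  have r0 : 0 < complex.Re e by rewrite -ltcR -eE.
  have [n [b Gb xb]] := (csubP x : U (val x)) _ r0.
  exists (tower_incl (@csub_mk R M (tower_alg n) b Gb)); split; first by exists n => //; eexists.
  by apply: eB; rewrite -ball_normE /= rnormE eE ltcR.
Qed.

Lemma tower_limit_traces : limit_traces tower_incl = @csub_traces R M tower_union.
Proof.
have tr := @csub_is_trace R M tower_union one one_sa one1 one_l (GU (G1 0%N)).
apply/seteqP; split=> [s [hs hn]|_ [tau Xt <-]]; last first.
  by split; [exact: (tr _ (tcX Xt))|move=> n; exists tau].
have /choice [t tP] : forall n, exists tau, X tau /\ tau \o (val : tower n -> M) = s \o @tower_incl n.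
  by move=> n; have [tau Xt tE] := hn n; exists tau.
have tb m n b (Gb : G n b) : (n <= m)%N -> t m b = s (tower_incl (@csub_mk R M (tower_alg n) b Gb)).
  move=> nm; have Gmb : G m b := Gmon nm Gb.
  have /(congr1 (fun g => g (@csub_mk R M (tower_alg m) b Gmb))) /= -> := (tP m).2.
  by congr s; apply: val_inj.
have Ft : ProperFilter (t @ \oo) by exact: fmap_proper_filter.
have [|tau [Xt ct]] := tc_compact (@tcP R M) Ft.
  by exists 0%N => // n _; case: (tP n).
(* The values t_m(b) are constant for m >= n and evaluation at b is continuous, so the cluster point
   tau takes the same value. *)
have tauE n b (Gb : G n b) : tau b = s (tower_incl (@csub_mk R M (tower_alg n) b Gb)).
  set z := s _; apply/eqP; rewrite -subr_eq0; apply: contraT => nz.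
  have d0 : 0 < `|tau b - z| by rewrite normr_gt0.
  have hnb : nbhs (tau : {ptws M -> R[i]^o}) [set u | `|tau b - u b| < `|tau b - z|].
    by have /cvgrPdist_lt /(_ _ d0) := @eval_continuous R M b tau.
  have hev : (t @ \oo) [set u | u b = z] by exists n => // m nm; exact: tb.
  have [u [/= uz]] := ct _ _ hev hnb; by rewrite uz ltxx.
exists tau => //; apply/funext => x /=; apply/eqP; rewrite -subr_eq0; apply/eqP/cabs_eq0/eqP.
rewrite eq_le cabs_ge0 andbT; apply/ler_addgt0Pr => e e0; rewrite add0r.
have [n [b Gb xb]] := (csubP x : U (val x)) _ (divr_gt0 e0 (ltr0Sn R 1)).
pose b' := tower_incl (@csub_mk R M (tower_alg n) b Gb).
have -> : tau (val x) - s x = tau (val x - b) + s (b' - x).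
  by rewrite (tauB (tcX Xt)) (tauB hs) (tauE _ _ Gb) addrA subrK.
apply: le_trans (cabsD _ _) _; rewrite [leRHS](splitr e); apply: lerD.
  by apply: le_trans (tau_bound (tcX Xt) _) _; exact: ltW.
apply: le_trans (tau_bound hs _) _; rewrite -rnormN opprB; exact: ltW.
Qed.

Let Y := limit_traces tower_incl.

Let Y_norm2 (x : A) : norm2 Y x = N (val x).
Proof. by rewrite /Y tower_limit_traces csub_norm2. Qed.

Let bc_bcvg u a : bcvg (fun n => val (u n : A)) a -> bounded_cauchy Y u.
Proof.
move=> ua; split; first by case: ua.
by move=> e /(bcvg_cauchy ua) [n0 hn]; exists n0 => m n hm hn'; rewrite Y_norm2; exact: hn.
Qed.

Let bc_lim u : bounded_cauchy Y u -> exists a, bcvg (fun n => val (u n : A)) a.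
Proof.
move=> [bu uc]; have [C C0 uC] := @bounded_seqP R M (fun n => val (u n)) bu.
have [|a _ ua] := bcvg_complete C0 uC; last by exists a.
by move=> e /uc [n0 hn]; exists n0 => m n hm hn'; have := hn _ _ hm hn'; rewrite Y_norm2.
Qed.

Lemma tower_completion : exists q : (nat -> A) -> M, tracial_completion Y q.
Proof.
(* The quotient map sends a sequence to its 2-norm limit in M, and arbitrary other sequences to some
   default. *)
have /choice [q qP] : forall u, exists a, bounded_cauchy Y u -> bcvg (fun n => val (u n : A)) a.
  move=> u; have [bu|nbu] := pselect (bounded_cauchy Y u); last by exists 0.
  by have [a ua] := bc_lim bu; exists a.
have qE u a : bcvg (fun n => val (u n : A)) a -> q u = a.
  by move=> ua; exact: bcvg_unique (qP _ (bc_bcvg ua)) ua.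
(* Density provides approximants in the 2-norm only; truncating them inside [G k] bounds their
   operator norms by 2 ||b||. *)
have surj b : exists2 u, bounded_cauchy Y u & q u = b.
  have /choice [c cP] : forall n : nat, exists c : M,
      U c /\ rnorm c <= rnorm b * 2 /\ N (c - b) <= 2 * n.+1%:R^-1.
    move=> n; have n0 : (0 : R) < n.+1%:R^-1 by rewrite invr_gt0.
    have [k [a Ga ab]] := Gdense b n0.
    have [c [Gc c1 c2]] := truncate_norm2 (Gfd k) (rnorm_ge0 b) Ga (lexx _).
    exists c; split; first exact: GU Gc.
    by split=> //; apply: le_trans c2 _; rewrite ler_pM2l // ltW.
  pose u n : A := @csub_mk R M tower_union (c n) (cP n).1.
  have ub : bcvg (fun n => val (u n)) b.
    split; first by exists (rnorm b * 2) => n; case: (cP n) => _ [].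
    move=> e e0; have [n0 hn] := inv_nat_lt (divr_gt0 e0 (ltr0Sn R 1)); exists n0 => n /hn.
    rewrite ltr_pdivlMr // mulrC; apply: le_lt_trans; by case: (cP n) => _ [].
  by exists u; [exact: bc_bcvg ub|exact: qE].
have tau_cvg tau u : X tau -> bounded_cauchy Y u ->
    (tau (val (u n : A)) : R[i]^o) @[n --> \oo] --> (tau (q u) : R[i]^o).
  move=> Xt bu; have [_ hu] := qP _ bu; apply/cvgrPdist_lt => e e0.
  have eE : e = (complex.Re e)%:C by rewrite RRe_real // gtr0_real.
  have r0 : 0 < complex.Re e / 4 by rewrite divr_gt0 // -ltcR -eE.
  have [n0 hn] := hu _ r0; exists n0 => // n /hn.
  rewrite ltr_pdivlMr // => h; rewrite eE cabsE ltcR -(tauB (tcX Xt)).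
  apply: le_lt_trans (tau_le_norm2 _ (tcX Xt)) _; apply: le_lt_trans h.
  rewrite mulrC ler_pM2r // norm2BC; exact: norm2_ub.
exists q; split.
- by move=> u v bu bv; apply: qE; exact: bcvgD (qP _ bu) (qP _ bv).
- by move=> c u bu; apply: qE; exact: bcvgZ (qP _ bu).
- by move=> u v bu bv; apply: qE; exact: bcvgM (qP _ bu) (qP _ bv).
- by move=> u bu; apply: qE; exact: bcvg_star (qP _ bu).
- exact: surj.
- move=> u bu; have hu := qP _ bu; have bs := bcvg_bounded hu.
  have E : norm2_cvg Y u 0 <-> norm2_cvg X (fun n => val (u n)) 0.
    rewrite /norm2_cvg (_ : (fun n => norm2 Y (u n - 0)) = (fun n => N (val (u n) - 0))) //.
    by apply/funext => n; rewrite Y_norm2 raddfB /= raddf0.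
  rewrite E -(bcvg_norm2_cvg _ bs); split=> [u0|]; first by rewrite -u0.
  exact: qE.
- apply/seteqP; split=> [tau Xt|s [t]].
    exists (tau \o (val : A -> M)); first by rewrite /Y tower_limit_traces; exists tau.
    by move=> u bu; exact: tau_cvg.
  move=> Yt; have [tau Xt <-] : @csub_traces R M tower_union t by rewrite -tower_limit_traces.
  move=> hs.
  suff -> : s = tau by [].
  apply/funext => a; have [u bu <-] := surj a.
  have h1 := hs u bu; have h2 := tau_cvg _ _ Xt bu.
  exact: (norm_cvg_unique h1 h2).
Qed.

Lemma tower_inductive_limit : tc_inductive_limit tower_map M.
Proof.
have [q hq] := tower_completion.
by exists A, tower_incl, q; split; first exact: tower_cstar_limit.
Qed.
End TowerLimit.

Theorem theorem8p4 (R : realType) (M : tcAlgebra R)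
    (hM : hyperfinite M) (sepM : norm2_separable M) :
  exists (N : nat -> tcAlgebra R) (phi : forall n, N n -> N n.+1)
         (L : tcAlgebra R),
    [/\ forall n, finite_dimensional (N n),
        forall n, tc_morphism (phi n),
        tc_inductive_limit phi L
      & tc_isomorphic M L].
Proof.
have [one [G [h1 h2 [h3 _] [h4 h5] [h6 h7]]]] := fd_tower hM sepM.
(* M itself serves as the limit, so the isomorphism is the identity. *)
exists (tower h1 h2 h3 h4 h6), (@tower_map _ _ _ _ h1 h2 h3 h4 h5 h6), M; split.
- exact: tower_fd.
- exact: tower_map_morphism.
- exact: tower_inductive_limit.
- by exists id, id; split.
Qed.
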